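(* (1) The family of $2$-step nilsequences is a sub-algebra of $\ell^\infty(\mathbb Z)$ that contains all almost periodic sequences and is invariant under complex conjugation, under the shift, and under uniform limits. (2) If $\mathbf a=(a_n)_{n\in\mathbb Z}$ is a $2$-step nilsequence and $(I_j)_{j\in\mathbb N}$ is a sequence of intervals of $\mathbb Z$ whose lengths tend to infinity, then the limit $$\mathrm{Av}(\mathbf a):=\lim_{j\to\infty}\frac1{|I_j|}\sum_{n\in I_j}a_n$$ exists and does not depend on the choice of the sequence $(I_j)$ of intervals.
   Context: Sequences are complex valued and indexed by $\mathbb Z$; $\ell^\infty(\mathbb Z)$ carries the uniform norm and pointwise operations. The shift is $\sigma\mathbf a=(a_{n+1})_{n\in\mathbb Z}$. A sequence is almost periodic if it is a uniform limit of finite linear combinations of the sequences $(\exp(2\pi i nt))_{n\in\mathbb Z}$, $t\in\mathbb R/\mathbb Z$. A group $G$ is $2$-step nilpotent if its commutator subgroup $G_2$ is contained in its center. A $2$-step nilmanifold is $X=G/\Gamma$ with $G$ a $2$-step nilpotent Lie group and $\Gamma$ a discrete cocompact subgroup; $G$ acts on $X$ by left translation. A basic $2$-step nilsequence is a sequence $(f(\tau^n\cdot x_0))_{n\in\mathbb Z}$ with $f\colon X\to\mathbb C$ continuous on a $2$-step nilmanifold $X=G/\Gamma$, $\tau\in G$, $x_0\in X$. A $2$-step nilsequence is a uniform limit of basic $2$-step nilsequences. *)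

(* Defs.v *)
From HB Require Import structures.
From mathcomp Require Import all_boot all_order all_algebra complex.
From mathcomp Require Import all_classical all_reals all_analysis.

Set Implicit Arguments.
Unset Strict Implicit.
Unset Printing Implicit Defensive.

Import Order.TTheory GRing.Theory Num.Theory numFieldNormedType.Exports.

Local Open Scope classical_set_scope.
Local Open Scope ring_scope.
Local Open Scope quotient_scope.

(* Naming the numClosedFieldType structure of R[i] lets canonical inference    *)
(* find the normed (hence topological and uniform) structure of the complex    *)
(* numbers; R[i] itself carries no topology in the library.                    *)
Definition Cplx (R : realType) : numClosedFieldType := R[i].

Section Smooth.
Context {R : realType}.

(* C^k on an open set U: all iterated directional derivatives of order at most *)
(* k exist and are continuous on U.                                            *)
Fixpoint Ck_on (m n k : nat) (U : set 'rV[R]_m) (f : 'rV[R]_m -> 'rV[R]_n)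
    : Prop :=
  {in U, continuous f} /\
  if k is k'.+1 then
    forall v : 'rV[R]_m,
      {in U, forall x, derivable f x v} /\ Ck_on k' U ('D_v f)
  else True.

Definition smooth_on (m n : nat) (U : set 'rV[R]_m)
    (f : 'rV[R]_m -> 'rV[R]_n) : Prop :=
  forall k, Ck_on k U f.

(* A chart is a partially defined homeomorphism, given by two total functions  *)
(* whose values off the domain, resp. off its image, are irrelevant.           *)
Record chart (T : Type) (n : nat) := Chart {
  chart_dom : set T;
  chart_map : T -> 'rV[R]_n;
  chart_inv : 'rV[R]_n -> T }.

Definition chart_img (T : Type) (n : nat) (c : chart T n) : set 'rV[R]_n :=
  chart_map c @` chart_dom c.

Definition is_chart (T : topologicalType) (n : nat) (c : chart T n) : Prop :=
  [/\ open (chart_dom c), open (chart_img c),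
      {in chart_dom c, cancel (chart_map c) (chart_inv c)},
      {in chart_dom c, continuous (chart_map c)} &
      {in chart_img c, continuous (chart_inv c)}].

(* f read in the charts c and d is smooth wherever it is defined.              *)
Definition smooth_in_charts (S T : Type) (m n : nat)
    (c : chart S m) (d : chart T n) (f : S -> T) : Prop :=
  smooth_on (chart_img c `&` (f \o chart_inv c) @^-1` chart_dom d)
            (chart_map d \o f \o chart_inv c).

Definition smooth_atlas (T : topologicalType) (n : nat)
    (A : set (chart T n)) : Prop :=
  [/\ forall c, A c -> is_chart c,
      \bigcup_(c in A) chart_dom c = setT &
      forall c d, A c -> A d -> smooth_in_charts c d id].

Definition smooth_map (S T : topologicalType) (m n : nat)
    (A : set (chart S m)) (B : set (chart T n)) (f : S -> T) : Prop :=
  continuous f /\ forall c d, A c -> B d -> smooth_in_charts c d f.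

Definition prod_chart (S T : Type) (m n : nat)
    (c : chart S m) (d : chart T n) : chart (S * T) (m + n) :=
  {| chart_dom := chart_dom c `*` chart_dom d;
     chart_map := fun p => row_mx (chart_map c p.1) (chart_map d p.2);
     chart_inv := fun z => (chart_inv c (lsubmx z), chart_inv d (rsubmx z)) |}.

Definition prod_atlas (S T : Type) (m n : nat)
    (A : set (chart S m)) (B : set (chart T n)) : set (chart (S * T) (m + n)) :=
  [set prod_chart p.1 p.2 | p in A `*` B].

End Smooth.
Arguments chart R T n : clear implicits.

(* Connectedness is not required, and dimension 0 (countable discrete groups)  *)
(* is allowed.                                                                 *)
HB.mixin Record isLieGroup (R : realType) (G : Type)
    of Group G & Topological G := {
  lie_dim : nat;
  lie_atlas : set (chart R G lie_dim);
  lie_hausdorff : hausdorff_space G;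
  lie_second_countable : @second_countable G;
  lie_smooth_atlas : smooth_atlas lie_atlas;
  lie_mul_smooth : smooth_map (prod_atlas lie_atlas lie_atlas) lie_atlas
                     (fun p : G * G => (p.1 * p.2)%g);
  lie_inv_smooth : smooth_map lie_atlas lie_atlas (fun x : G => (x^-1)%g) }.

#[short(type="lieGroupType")]
HB.structure Definition LieGroup (R : realType) :=
  {G of isLieGroup R G & Group G & Topological G}.

Definition zexpg (G : groupType) (x : G) (n : int) : G :=
  match n with
  | Posz k => (x ^+ k)%g
  | Negz k => (x ^- k.+1)%g
  end.

(* The subgroup generated by all commutators.                                  *)
Definition commutator_subgroup (G : groupType) : set G :=
  [set z | forall H : groupClosed G,
     (forall x y : G, [~ x, y]%g \in H) -> z \in H].

Definition center (G : groupType) : set G :=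
  [set z | forall x : G, commute z x].

Definition two_step_nilpotent (G : groupType) : Prop :=
  @commutator_subgroup G `<=` @center G.

Section Cosets.
Context {G : groupType} (Gamma : groupClosed G).

Definition coset_rel : rel G := fun x y => (x^-1 * y)%g \in Gamma.

Lemma coset_rel_refl : reflexive coset_rel.
Proof. by move=> x; rewrite /coset_rel mulVg gpred1. Qed.

Lemma coset_rel_sym : symmetric coset_rel.
Proof.
by move=> x y; rewrite /coset_rel -gpredV invgM invgK.
Qed.

Lemma coset_rel_trans : transitive coset_rel.
Proof.
move=> y x z xy yz; rewrite /coset_rel.
by rewrite -[z](mulVKg y) mulgA; apply: gpredM.
Qed.

Canonical coset_equiv :=
  EquivRel coset_rel coset_rel_refl coset_rel_sym coset_rel_trans.

End Cosets.

(* G / Gamma, the space of left cosets g Gamma, with the quotient topology.    *)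
Definition coset_space (R : realType) (G : lieGroupType R)
    (Gamma : groupClosed G) :=
  quotient_topology {eq_quot (coset_equiv Gamma)}.

Section Translation.
Context {R : realType} {G : lieGroupType R} {Gamma : groupClosed G}.

Definition translate (tau : G) (x : coset_space Gamma) : coset_space Gamma :=
  \pi_(coset_space Gamma) (tau * repr x)%g.

Lemma translate_pi (tau g : G) :
  translate tau (\pi_(coset_space Gamma) g) =
  \pi_(coset_space Gamma) (tau * g)%g.
Proof.
apply/(@eqmodP _ (coset_equiv Gamma)) => /=; rewrite /coset_rel.
have /(@eqmodP _ (coset_equiv Gamma)) /= : repr (\pi_(coset_space Gamma) g) =
    g %[mod {eq_quot (coset_equiv Gamma)}] by exact: reprK.
by rewrite /coset_rel invgM -mulgA mulKg.
Qed.

End Translation.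

Definition discrete_subgroup (R : realType) (G : lieGroupType R)
    (Gamma : groupClosed G) : Prop :=
  [set g : G | g \in Gamma] `<=` isolated [set g : G | g \in Gamma].

Definition cocompact (R : realType) (G : lieGroupType R)
    (Gamma : groupClosed G) : Prop :=
  compact [set: coset_space Gamma].

Definition two_step_nilmanifold (R : realType) (G : lieGroupType R)
    (Gamma : groupClosed G) : Prop :=
  [/\ two_step_nilpotent G, discrete_subgroup Gamma & cocompact Gamma].

Section Sequences.
Context {R : realType}.
Local Notation C := (Cplx R).
Implicit Types (a : int -> C) (A : set (int -> C)).

Definition linfty : set (int -> C) := [set a | bounded_fun a].

Definition uniform_limits A : set (int -> C) :=
  [set a | exists u : nat -> int -> C,
     (forall k, A (u k)) /\ {uniform, u @ \oo --> a}].

(* n |-> exp (2 pi i n t); it depends only on the class of t modulo 1.         *)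
Definition expseq (t : R) : int -> C :=
  fun n => let x := 2 * pi * (n%:~R * t) in (cos x +i* sin x)%C.

Definition trig_poly : set (int -> C) :=
  [set a | exists (m : nat) (c : 'I_m -> C) (t : 'I_m -> R),
     a = \sum_(j < m) c j *: expseq (t j)].

Definition almost_periodic : set (int -> C) := uniform_limits trig_poly.

Definition basic_two_step_nilseq : set (int -> C) :=
  [set a | exists (G : lieGroupType R) (Gamma : groupClosed G)
             (f : coset_space Gamma -> C) (tau : G) (x0 : coset_space Gamma),
     [/\ two_step_nilmanifold Gamma, continuous f &
         a = fun n => f (translate (zexpg tau n) x0)]].

Definition two_step_nilseq : set (int -> C) :=
  uniform_limits basic_two_step_nilseq.

Definition shift_seq a : int -> C := fun n => a (n + 1).

Definition conj_seq a : int -> C := fun n => Num.conj (a n).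

Definition subalgebra_of A B : Prop :=
  [/\ A `<=` B, A 1,
      forall (c : C) a b, A a -> A b -> A (c *: a + b) &
      forall a b, A a -> A b -> A (a * b)].

(* Average over the interval {m, m + 1, ..., m + l - 1} of length l.           *)
Definition interval_avg a (m : int) (l : nat) : C :=
  (\sum_(0 <= k < l) a (m + k%:Z)) / l%:R.

End Sequences.

(* Main.v *)
(** Part (1): pointwise operations on basic nilsequences are realised on the
    product of two nilmanifolds, exponentials on R/Z; the rest passes to uniform
    limits.

    Part (2) uses neither Haar measure nor ergodic theory.  Lift a continuous
    function on X to a right Gamma-invariant, left uniformly continuous F on G.
    The centre Z of G is abelian, so it carries an invariant mean, and a
    Peter-Weyl argument for that mean approximates F uniformly by finite sums of
    functions F_i with F_i (z x) = chi_i z * F_i x for z in Z, chi_i unitary.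
    Fix e, put b n = F_i (tau^n g0), and by compactness write tau^t g0 =
    u s_j gamma with u near 1, gamma in Gamma and s_j in a finite set.  As the
    commutators of tau and u are central, every translate of b is, up to e, one
    of finitely many translates of b multiplied by some psi^n with |psi| = 1.
    Either the averages of b over long intervals tend uniformly to 0, or many
    translates of b have a large average over one window; by a large sieve two
    of the corresponding psi are then so close that b has an e-almost period.
    In the second case b is Bohr almost periodic, hence has a uniform mean. *)

Require Import Defs.
From HB Require Import structures.
From mathcomp Require Import all_boot all_order all_algebra complex.
From mathcomp Require Import all_classical all_reals all_analysis.
From mathcomp Require Import ring lra zify.
Set Implicit Arguments.
Unset Strict Implicit.
Unset Printing Implicit Defensive.
Import Order.TTheory GRing.Theory Num.Theory numFieldNormedType.Exports.
Import ComplexField.Normc.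
Local Open Scope classical_set_scope.
Local Open Scope ring_scope.
Local Notation Re := complex.Re.
Local Notation Im := complex.Im.

(** The eigenfunction sequences b need not be almost periodic: quadratic phases such as exp(2 pi i
    n^2 t) occur among them, and their translates agree only up to linear phases psi^n. A large
    average of b over many translated windows means that one fixed sequence correlates with many
    psi; almost orthogonality of exponentials bounds the number of well-separated psi by a constant
    depending only on the size of the average, whatever the number of windows. Enough translates
    therefore force a near coincidence. Passing to eigenfunctions of Z is what turns the central
    factor [tau, u]^n into a scalar. The mean on Z is only finitely additive: iterated means need
    not commute and mean-square limits need not exist. Total boundedness of translates, expressed as
    a finite colouring, takes the place of compactness: it restores Fubini, and it makes pointwise
    ultralimits of convolutions uniform, so that a character arises as a limit from approximate
    joint eigenvectors of the translations. *)

Section ComplexModulus.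
Context {R : realType}.
Implicit Types x y z : R[i].

(** The norm [|x|] lies in [R[i]]; a modulus with values in [R] gives access to the total order, to
    suprema and to [lra]. *)
Definition cnorm x : R := normc x.

Lemma cnormE x : `|x| = (cnorm x)%:C%C.
Proof. by []. Qed.

Lemma cnorm_ge0 x : 0 <= cnorm x.
Proof. by case: x => a b; rewrite /cnorm sqrtr_ge0. Qed.

Lemma cnormD x y : cnorm (x + y) <= cnorm x + cnorm y.
Proof. exact: (@le_normcD R). Qed.

Lemma cnormM x y : cnorm (x * y) = cnorm x * cnorm y.
Proof. exact: normcM. Qed.

Lemma cnormN x : cnorm (- x) = cnorm x.
Proof. exact: (@normcN R). Qed.

Lemma cnormB x y : cnorm (x - y) <= cnorm x + cnorm y.
Proof. by rewrite -(cnormN y) cnormD. Qed.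

Lemma cnorm_distC x y : cnorm (x - y) = cnorm (y - x).
Proof. by rewrite -cnormN opprB. Qed.

Lemma cnorm_tri y x z : cnorm (x - z) <= cnorm (x - y) + cnorm (y - z).
Proof. by rewrite (le_trans _ (cnormD _ _))// addrA subrK. Qed.

Lemma cnormV x : cnorm x^-1 = (cnorm x)^-1.
Proof. exact: normcV. Qed.

Lemma cnorm0 : cnorm 0 = 0.
Proof. exact: normc0. Qed.

Lemma cnorm1 : cnorm 1 = 1.
Proof. exact: normc1. Qed.

Lemma cnorm_eq0 x : (cnorm x == 0) = (x == 0).
Proof.
by apply/eqP/eqP => [/eq0_normc//|->]; rewrite cnorm0.
Qed.

Lemma cnormX x n : cnorm (x ^+ n) = cnorm x ^+ n.
Proof. by elim: n => [|n IH]; rewrite ?cnorm1// !exprS cnormM IH. Qed.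

Lemma cnorm_exprz x (n : int) : cnorm (x ^ n) = cnorm x ^ n.
Proof. by case: n => n; rewrite ?NegzE -?exprz_inv ?cnormV -?exprnP cnormX // cnormV. Qed.

Lemma sqr_cnorm x : cnorm x ^+ 2 = Re x ^+ 2 + Im x ^+ 2.
Proof.
by case: x => a b; rewrite /cnorm/= sqr_sqrtr// addr_ge0// sqr_ge0.
Qed.

Lemma cnorm_real (a : R) : cnorm a%:C%C = `|a|.
Proof. by rewrite /cnorm/= expr0n addr0 sqrtr_sqr. Qed.

Lemma cnorm_nat n : cnorm n%:R = n%:R.
Proof.
have -> : n%:R = (n%:R : R)%:C%C :> R[i] by rewrite rmorph_nat.
by rewrite cnorm_real normr_nat.
Qed.

Lemma cnorm_Re x : `|Re x| <= cnorm x.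
Proof.
rewrite -(@ler_sqr _ _ _) ?nnegrE ?cnorm_ge0// sqr_cnorm real_normK ?num_real//.
by rewrite lerDl sqr_ge0.
Qed.

Lemma cnorm_Im x : `|Im x| <= cnorm x.
Proof.
rewrite -(@ler_sqr _ _ _) ?nnegrE ?cnorm_ge0// sqr_cnorm real_normK ?num_real//.
by rewrite lerDr sqr_ge0.
Qed.

Lemma cnorm_ReIm x : cnorm x <= `|Re x| + `|Im x|.
Proof.
rewrite {1}(complexE x); apply: (le_trans (cnormD _ _)).
by rewrite cnormM !cnorm_real lerD2l /cnorm /= expr0n expr1n/= add0r sqrtr1 mul1r.
Qed.

Lemma cnorm_conj x : cnorm (conjc x) = cnorm x.
Proof. by case: x => a b; rewrite /cnorm/= sqrrN. Qed.

Lemma mulc_conj x : x * conjc x = ((cnorm x) ^+ 2)%:C%C.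
Proof.
rewrite sqr_cnorm; case: x => a b /=; apply/eqP; rewrite eq_complex /=.
by apply/andP; split; apply/eqP; ring.
Qed.

Lemma cnorm_sum I (r : seq I) (P : pred I) (F : I -> R[i]) :
  cnorm (\sum_(i <- r | P i) F i) <= \sum_(i <- r | P i) cnorm (F i).
Proof.
elim/big_rec2: _ => [|i y1 y2 _ IH]; first by rewrite cnorm0.
by apply: (le_trans (cnormD _ _)); rewrite lerD2l.
Qed.

Lemma unit_neq0 x : cnorm x = 1 -> x != 0.
Proof. by rewrite -cnorm_eq0 => ->; exact: oner_neq0. Qed.

Lemma re_conj_sqr x y :
  cnorm (x - y) ^+ 2 = cnorm x ^+ 2 - 2 * Re (x * conjc y) + cnorm y ^+ 2.
Proof. by rewrite !sqr_cnorm; case: x => a b; case: y => c d /=; ring. Qed.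

End ComplexModulus.

(** * Limits along an ultrafilter *)

Section UltraLimits.
Context {R : realType} {I : Type} (U : set_system I) {UU : UltraFilter U}.

Definition is_ulim (f : I -> R) (l : R) :=
  forall e : R, 0 < e -> U [set i | `|f i - l| <= e].

(** The limit is the supremum of the levels [x] for which [x <= f i] holds on a set of [U]. *)
Lemma is_ulim_exists (f : I -> R) B :
  (forall i, `|f i| <= B) -> exists l, is_ulim f l.
Proof.
move=> fB; pose A : set R := [set x | U [set i | x <= f i]].
have A0 : A (- B).
  by rewrite /A/=; apply: filterS filterT => i _ /=;
    rewrite -lerN2 opprK (le_trans _ (fB i))// ler_normr lexx orbT.
have AB : ubound A B.
  move=> x /= /filter_ex[i /= h]; apply: (le_trans h).
  exact: le_trans (ler_norm _) (fB i).
have hA : has_sup A by split; [exists (- B)|exists B].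
exists (sup A) => e e0.
have [x Ax xe] := sup_adherent e0 hA.

have [h|h] := in_ultra_setVsetC [set i | sup A + e <= f i] UU.
  by have := sup_ubound (ex_intro _ _ AB) h; lra.
apply: filterS (filterI Ax h) => i /= [xf /negP].
by rewrite -ltNge => h2; rewrite ler_distl; apply/andP; split; lra.
Qed.

Lemma is_ulim_unique f l l' : is_ulim f l -> is_ulim f l' -> l = l'.
Proof.
move=> h h'; apply/eqP; rewrite -subr_eq0 -normr_eq0; apply/negPn/negP => n0.
have p : 0 < `|l - l'| / 3 by rewrite divr_gt0// lt0r n0 normr_ge0.
have [i /= []] := filter_ex (filterI (h _ p) (h' _ p)).
rewrite !ler_distl => /andP[a b] /andP[c d].
have : `|l - l'| <= 2 * (`|l - l'| / 3) by rewrite ler_distl; lra.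
lra.
Qed.

Lemma is_ulim_cst l : is_ulim (fun=> l) l.
Proof. by move=> e e0; apply: filterS filterT => i _ /=; rewrite subrr normr0 ltW. Qed.

Lemma is_ulimD f g l l' : is_ulim f l -> is_ulim g l' ->
  is_ulim (fun i => f i + g i) (l + l').
Proof.
move=> h h' e e0; have e2 : 0 < e / 2 by lra.
apply: filterS (filterI (h _ e2) (h' _ e2)) => i /= [].
rewrite !ler_distl => /andP[a b] /andP[c d]; lra.
Qed.

Lemma is_ulimZ c f l : is_ulim f l -> is_ulim (fun i => c * f i) (c * l).
Proof.
move=> h e e0.
have c1 : 0 < `|c| + 1 by rewrite ltr_wpDl.
apply: filterS (h _ (divr_gt0 e0 c1)) => i /= hi.
rewrite -mulrBr normrM; apply: (le_trans (ler_wpM2l (normr_ge0 _) hi)).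
rewrite mulrA ler_pdivrMr// mulrC ler_wpM2l//; [exact: ltW | lra].
Qed.

Lemma is_ulim_ge0 f l : (forall i, 0 <= f i) -> is_ulim f l -> 0 <= l.
Proof.
move=> f0 h; rewrite leNgt; apply/negP => l0.
have p : 0 < - l / 2 by lra.
have /filter_ex[i /=] := h _ p.
have := f0 i; rewrite ler_distl => h1 /andP[h2 h3]; lra.
Qed.

Lemma is_ulim_near f g l : is_ulim f l ->
  (forall e : R, 0 < e -> U [set i | `|f i - g i| <= e]) -> is_ulim g l.
Proof.
move=> h h' e e0; have e2 : 0 < e / 2 by lra.
apply: filterS (filterI (h _ e2) (h' _ e2)) => i /= [].
rewrite !ler_distl => /andP[a b] /andP[c d]; lra.
Qed.

Definition is_culim (f : I -> R[i]) (l : R[i]) :=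
  forall e : R, 0 < e -> U [set i | cnorm (f i - l) <= e].

Lemma is_culim_exists (f : I -> R[i]) B :
  (forall i, cnorm (f i) <= B) -> exists l, is_culim f l.
Proof.
move=> fB.
have [a ha] : exists a, is_ulim (fun i => Re (f i)) a.
  by apply: (@is_ulim_exists _ B) => i; apply: le_trans (cnorm_Re _) (fB i).
have [b hb] : exists b, is_ulim (fun i => Im (f i)) b.
  by apply: (@is_ulim_exists _ B) => i; apply: le_trans (cnorm_Im _) (fB i).
exists (a +i* b)%C => e e0; have e2 : 0 < e / 2 by lra.
apply: filterS (filterI (ha _ e2) (hb _ e2)) => i /= [h1 h2].
apply: (le_trans (cnorm_ReIm _)); move: h1 h2.
by case: (f i) => c d /= h1 h2; lra.
Qed.

Lemma is_culim_unique f l l' : is_culim f l -> is_culim f l' -> l = l'.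
Proof.
move=> h h'; apply/eqP; rewrite -subr_eq0 -cnorm_eq0; apply/negPn/negP => n0.
have p : 0 < cnorm (l - l') / 3 by rewrite divr_gt0// lt0r n0 cnorm_ge0.
have [i /= [h1 h2]] := filter_ex (filterI (h _ p) (h' _ p)).
have : cnorm (l - l') <= cnorm (f i - l) + cnorm (f i - l').
  by rewrite (cnorm_distC (f i)) cnorm_tri.
lra.
Qed.

Lemma is_culim_norm_le f l B : (forall i, cnorm (f i) <= B) -> is_culim f l ->
  cnorm l <= B.
Proof.
move=> fB h; apply/ler_addgt0Pr => e e0.
have /filter_ex[i /= h1] := h _ e0.
have : cnorm l <= cnorm (f i - l) + cnorm (f i).
  by rewrite [X in X + _]cnorm_distC (le_trans _ (cnormD _ _))// subrK.
by have := fB i; lra.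
Qed.

Lemma is_culim_norm_ge f l B : (forall i, B <= cnorm (f i)) -> is_culim f l ->
  B <= cnorm l.
Proof.
move=> fB h; apply/ler_addgt0Pr => e e0.
have /filter_ex[i /= h1] := h _ e0.
have : cnorm (f i) <= cnorm (f i - l) + cnorm l.
  by rewrite (le_trans _ (cnormD _ _))// subrK.
by have := fB i; lra.
Qed.

Lemma is_culim_cst l : is_culim (fun=> l) l.
Proof. by move=> e e0; apply: filterS filterT => i _ /=; rewrite subrr cnorm0 ltW. Qed.

Lemma is_culimD f g l l' : is_culim f l -> is_culim g l' ->
  is_culim (fun i => f i + g i) (l + l').
Proof.
move=> h h' e e0; have e2 : 0 < e / 2 by lra.
apply: filterS (filterI (h _ e2) (h' _ e2)) => i /= [h1 h2].
have -> : f i + g i - (l + l') = (f i - l) + (g i - l') by ring.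
by apply: (le_trans (cnormD _ _)); lra.
Qed.

Lemma is_culimM f g l l' B : (forall i, cnorm (f i) <= B) ->
  is_culim f l -> is_culim g l' -> is_culim (fun i => f i * g i) (l * l').
Proof.
move=> fB h h' e e0.
have B0 : 0 <= B.
  by have [i _] := filter_ex (filterT : U setT); apply: le_trans (cnorm_ge0 _) (fB i).
have B1 : 0 < B + 1 by lra.
have l1 : 0 < cnorm l' + 1 by have := cnorm_ge0 l'; lra.
have p1 : 0 < (e / 2) / (B + 1) by rewrite divr_gt0//; lra.
have p2 : 0 < (e / 2) / (cnorm l' + 1) by rewrite divr_gt0//; lra.
apply: filterS (filterI (h _ p2) (h' _ p1)) => i /= [h1 h2].
have -> : f i * g i - l * l' = f i * (g i - l') + (f i - l) * l' by ring.
apply: (le_trans (cnormD _ _)); rewrite !cnormM.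
have -> : e = e / 2 + e / 2 by lra.
apply: lerD.
  rewrite -[leRHS](@mulfVK _ (B + 1)) ?gt_eqF// mulrC.
  by apply: ler_pM => //; rewrite ?cnorm_ge0//; have := fB i; lra.
rewrite -[leRHS](@mulfVK _ (cnorm l' + 1)) ?gt_eqF//.
by apply: ler_pM => //; rewrite ?cnorm_ge0//; lra.
Qed.

Lemma is_culim_near f g l : is_culim f l ->
  (forall e : R, 0 < e -> U [set i | cnorm (f i - g i) <= e]) -> is_culim g l.
Proof.
move=> h h' e e0; have e2 : 0 < e / 2 by lra.
apply: filterS (filterI (h _ e2) (h' _ e2)) => i /= [h1 h2].
have : cnorm (g i - l) <= cnorm (f i - l) + cnorm (f i - g i).
  by rewrite (le_trans _ (cnormB _ _))//; have -> : f i - l - (f i - g i) = g i - l by ring.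
lra.
Qed.

End UltraLimits.

Definition bddf {R : realType} {T : Type} (f : T -> R) :=
  exists B : R, forall z, `|f z| <= B.

(** [M] is a total function on [A -> R], so its laws are restricted to bounded functions. *)
Record invariant_mean {R : realType} {A : zmodType} (M : (A -> R) -> R)
    : Prop := InvariantMean {
  meanD : forall f g, bddf f -> bddf g ->
    M (fun z => f z + g z) = M f + M g;
  meanZ : forall c f, bddf f -> M (fun z => c * f z) = c * M f;
  mean1 : M (fun=> 1) = 1;
  mean_ge0 : forall f, bddf f -> (forall z, 0 <= f z) -> 0 <= M f;
  mean_shift : forall f s, bddf f -> M (fun z => f (z + s)) = M f }.

(** * Invariant means and almost periodic functions *)

Section MeanExistence.
Context {R : realType} {A : zmodType}.
Implicit Types (f g : A -> R) (S : seq A).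

Definition step_avg (N : nat) (s : A) f : A -> R :=
  fun z => N.+1%:R^-1 * \sum_(n < N.+1) f (z + s *+ n).

(** The average over all sums of [s *+ n_s], for [s] in [S] and [n_s <= N], counted with
    multiplicity. These boxes play the part of Folner sets. *)
Definition box_avg S (N : nat) f : A -> R := foldr (step_avg N) f S.

Lemma step_avg_le N s f B : (forall z, `|f z| <= B) ->
  forall z, `|step_avg N s f z| <= B.
Proof.
move=> fB z; rewrite /step_avg normrM ger0_norm ?invr_ge0//.
rewrite ler_pdivrMl ?ltr0Sn//; apply: (le_trans (ler_norm_sum _ _ _)).
apply: (le_trans (ler_sum _ (fun i _ => fB _))).
by rewrite sumr_const card_ord mulr_natl.
Qed.

Lemma box_avg_le S N f B : (forall z, `|f z| <= B) ->
  forall z, `|box_avg S N f z| <= B.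
Proof. by move=> fB; elim: S => [//|s S IH]; apply: step_avg_le. Qed.

Lemma box_avgD S N f g :
  box_avg S N (fun z => f z + g z) = fun z => box_avg S N f z + box_avg S N g z.
Proof.
elim: S => [//|s S IH]; rewrite /= IH; apply/funext => z.
by rewrite /step_avg big_split mulrDr.
Qed.

Lemma box_avgZ S N c f :
  box_avg S N (fun z => c * f z) = fun z => c * box_avg S N f z.
Proof.
elim: S => [//|s S IH]; rewrite /= IH; apply/funext => z.
by rewrite /step_avg -mulr_sumr mulrCA.
Qed.

Lemma box_avg1 S N : box_avg S N (fun=> 1) = fun=> 1.
Proof.
elim: S => [//|s S IH]; rewrite /= IH; apply/funext => z.
by rewrite /step_avg sumr_const card_ord mulVf// pnatr_eq0.
Qed.

Lemma box_avg_ge0 S N f : (forall z, 0 <= f z) -> forall z, 0 <= box_avg S N f z.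
Proof.
move=> f0; elim: S => [//|s S IH] z /=.
by rewrite /step_avg mulr_ge0 ?invr_ge0// sumr_ge0.
Qed.

Lemma box_avg_shift S N f t :
  box_avg S N (fun z => f (z + t)) = fun z => box_avg S N f (z + t).
Proof.
elim: S => [//|s S IH]; rewrite /= IH; apply/funext => z.
by rewrite /step_avg; congr (_ * _); apply: eq_bigr => n _; rewrite addrAC.
Qed.

(** The factor of the iterated average that belongs to [s] telescopes and leaves two end terms; the
    other factors are averages and preserve the bound. *)
Lemma box_avg_invariant S N f B s : (forall z, `|f z| <= B) -> s \in S ->
  forall z, `|box_avg S N (fun z => f (z + s)) z - box_avg S N f z| <=
    2 * B / N.+1%:R.
Proof.
move=> fB; elim: S => [//|a S IH]; rewrite inE => /orP[/eqP <-|sS] z /=.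
  have gB := box_avg_le S N fB; rewrite box_avg_shift /step_avg -mulrBr -sumrB.
  rewrite normrM ger0_norm ?invr_ge0// mulrC ler_pM2r ?invr_gt0 ?ltr0Sn//.
  set g := box_avg S N f in gB *.
  have -> : \sum_(i < N.+1) (g (z + s *+ i + s) - g (z + s *+ i)) =
      g (z + s *+ N.+1) - g z.
    rewrite -(big_mkord xpredT (fun i => g (z + s *+ i + s) - g (z + s *+ i))).
    rewrite (eq_bigr (fun i => g (z + s *+ i.+1) - g (z + s *+ i))); last first.
      by move=> i _; rewrite mulrSr addrA.
    by rewrite telescope_sumr// mulr0n addr0.
  by rewrite (le_trans (ler_normB _ _))//; have := gB z; have := gB (z + s *+ N.+1); lra.
rewrite /step_avg -mulrBr -sumrB.
set h := fun y => box_avg S N (fun z => f (z + s)) y - box_avg S N f y.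
rewrite [X in `|X|](_ : _ = step_avg N a h z) //.
by apply: step_avg_le => y; exact: IH.
Qed.

(** [S] eventually contains any given finite list and [N] exceeds any given bound. The same filter
    later indexes approximate eigenvectors by the translations tested and the accuracy reached. *)
Definition box_filter : set_system (seq A * nat) :=
  [set P | exists (S0 : seq A) (N0 : nat), forall S N,
     {subset S0 <= S} -> (N0 <= N)%N -> P (S, N)].

Lemma box_filter_proper : ProperFilter box_filter.
Proof.
apply: Build_ProperFilter_ex => [P [S0 [N0 h]]|].
  by exists (S0, N0); apply: h.
split.
- by exists [::], 0%N.
- move=> P Q [S0 [N0 h]] [S1 [N1 h1]]; exists (S0 ++ S1), (maxn N0 N1) => S N sS.
  rewrite geq_max => /andP[n0 n1]; split.
    by apply: h => // x xS; apply: sS; rewrite mem_cat xS.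
  by apply: h1 => // x xS; apply: sS; rewrite mem_cat xS orbT.
- by move=> P Q PQ [S0 [N0 h]]; exists S0, N0 => S N sS n0; apply: PQ; apply: h.
Qed.

Lemma invariant_mean_exists : exists M : (A -> R) -> R, invariant_mean M.
Proof.
have [U [UU sU]] := ultraFilterLemma box_filter_proper.
pose av f (i : seq A * nat) := box_avg i.1 i.2 f 0.
(* Boundedness is assumed inside the existential, so that a single choice yields a total [M];
   unbounded functions receive 0. *)
have ex f : exists l, bddf f -> is_ulim U (av f) l.
  have [[B fB]|nb] := pselect (bddf f); last by exists 0.
  by have [l hl] := is_ulim_exists (fun i => box_avg_le i.1 i.2 fB 0); exists l.
have [M hM] := choice ex; exists M; split.
- move=> f g bf bg; apply: (is_ulim_unique _ (is_ulimD (hM _ bf) (hM _ bg))).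
  have -> : (fun i => av f i + av g i) = av (fun z => f z + g z).
    by apply/funext => i; rewrite /av box_avgD.
  apply: hM; move: bf bg => [B fB] [B' gB]; exists (B + B') => z.
  by rewrite (le_trans (ler_normD _ _))// lerD.
- move=> c f bf; apply: (is_ulim_unique _ (is_ulimZ c (hM _ bf))).
  have -> : (fun i => c * av f i) = av (fun z => c * f z).
    by apply/funext => i; rewrite /av box_avgZ.
  apply: hM; move: bf => [B fB]; exists (`|c| * B) => z.
  by rewrite normrM ler_wpM2l.
- apply: (is_ulim_unique _ (is_ulim_cst 1)).
  have -> : (fun=> 1) = av (fun=> 1).
    by apply/funext => i; rewrite /av box_avg1.
  by apply: hM; exists 1 => z; rewrite normr1.
- move=> f bf f0; apply: is_ulim_ge0 (hM _ bf) => i; exact: box_avg_ge0.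
- move=> f s bf; have bs : bddf (fun z => f (z + s)).
    by move: bf => [B fB]; exists B.
  apply: (is_ulim_unique (hM _ bs)).
  apply: (is_ulim_near (hM _ bf)) => e e0; apply: sU.
  move: bf => [B fB]; have B0 : 0 <= B by apply: le_trans (fB 0).
  exists [:: s], (Num.truncn (2 * B / e)) => S N sS hN /=.
  rewrite distrC (le_trans (box_avg_invariant _ fB _ 0))//.
    by apply: sS; rewrite inE.
  rewrite /= ler_pdivrMr ?ltr0Sn// [leRHS]mulrC -ler_pdivrMr//.
  by rewrite (le_trans (ltW (archimedean.Num.Theory.truncnS_gt _)))// ler_nat.
Qed.

End MeanExistence.

Definition bddc {R : realType} {T : Type} (f : T -> R[i]) :=
  exists B : R, forall z, cnorm (f z) <= B.

Section BoundedFunctions.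
Context {R : realType} {T : Type}.
Implicit Types (f g : T -> R) (p q : T -> R[i]).

Lemma bddfD f g : bddf f -> bddf g -> bddf (fun z => f z + g z).
Proof.
move=> [B fB] [B' gB]; exists (B + B') => z.
by rewrite (le_trans (ler_normD _ _))// lerD.
Qed.

Lemma bddfM f g : bddf f -> bddf g -> bddf (fun z => f z * g z).
Proof.
by move=> [B fB] [B' gB]; exists (B * B') => z; rewrite normrM ler_pM.
Qed.

Lemma bddf_cst (c : R) : bddf (fun _ : T => c).
Proof. by exists `|c|. Qed.

Lemma bddcD p q : bddc p -> bddc q -> bddc (fun z => p z + q z).
Proof.
move=> [B fB] [B' gB]; exists (B + B') => z.
by rewrite (le_trans (cnormD _ _))// lerD.
Qed.

Lemma bddcM p q : bddc p -> bddc q -> bddc (fun z => p z * q z).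
Proof.
move=> [B fB] [B' gB]; exists (B * B') => z.
by rewrite cnormM ler_pM// cnorm_ge0.
Qed.

Lemma bddcN p : bddc p -> bddc (fun z => - p z).
Proof. by move=> [B fB]; exists B => z; rewrite cnormN. Qed.

Lemma bddcB p q : bddc p -> bddc q -> bddc (fun z => p z - q z).
Proof. by move=> bp bq; apply: bddcD => //; exact: bddcN. Qed.

Lemma bddc_cst (c : R[i]) : bddc (fun _ : T => c).
Proof. by exists (cnorm c). Qed.

Lemma bddc_conj p : bddc p -> bddc (fun z => conjc (p z)).
Proof. by move=> [B fB]; exists B => z; rewrite cnorm_conj. Qed.

Lemma bddc_cnorm p : bddc p -> bddf (fun z => cnorm (p z)).
Proof. by move=> [B fB]; exists B => z; rewrite ger0_norm ?cnorm_ge0. Qed.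

Lemma bddc_sqr p : bddc p -> bddf (fun z => cnorm (p z) ^+ 2).
Proof. by move=> bp; apply: (bddfM (bddc_cnorm bp) (bddc_cnorm bp)). Qed.

Lemma bddc_Re p : bddc p -> bddf (fun z => Re (p z)).
Proof. by move=> [B fB]; exists B => z; exact: le_trans (cnorm_Re _) (fB z). Qed.

Lemma bddc_Im p : bddc p -> bddf (fun z => Im (p z)).
Proof. by move=> [B fB]; exists B => z; exact: le_trans (cnorm_Im _) (fB z). Qed.

Lemma bddc_unit p : (forall z, cnorm (p z) = 1) -> bddc p.
Proof. by move=> p1; exists 1 => z; rewrite p1. Qed.

End BoundedFunctions.

#[global] Hint Resolve bddfD bddfM bddf_cst bddcD bddcM bddcN bddcB bddc_cst
  bddc_conj bddc_cnorm bddc_sqr bddc_Re bddc_Im : core.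

Section ComplexMean.
Context {R : realType} {A : zmodType} (M : (A -> R) -> R).
Hypothesis hM : invariant_mean M.
Local Notation C := R[i].
Implicit Types (f g : A -> R) (p q v : A -> C).

Lemma mean_cst (c : R) : M (fun=> c) = c.
Proof.
have -> : (fun _ : A => c) = (fun z => c * (fun=> 1) z).
  by apply/funext => z; rewrite mulr1.
by rewrite (meanZ hM)// (mean1 hM) mulr1.
Qed.

Lemma meanB f g : bddf f -> bddf g -> M (fun z => f z - g z) = M f - M g.
Proof.
move=> bf bg; rewrite -mulN1r -(meanZ hM)// -(meanD hM)//.
  by congr M; apply/funext => z; rewrite mulN1r.
by apply: bddfM.
Qed.

Lemma mean_le f g : bddf f -> bddf g -> (forall z, f z <= g z) -> M f <= M g.
Proof.
move=> bf bg fg; rewrite -subr_ge0 -meanB//; apply: (mean_ge0 hM).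
  apply: bddfD => //; have [B gB] := bf; exists B => z; by rewrite normrN.
by move=> z; rewrite subr_ge0.
Qed.

Lemma mean_sum (m : nat) (F : 'I_m -> A -> R) : (forall i, bddf (F i)) ->
  M (fun z => \sum_(i < m) F i z) = \sum_(i < m) M (F i).
Proof.
move=> bF; suff [//] : bddf (fun z => \sum_(i < m) F i z) /\
   M (fun z => \sum_(i < m) F i z) = \sum_(i < m) M (F i).
elim: m F bF => [|m IH] F bF.
  have -> : (fun z => \sum_(i < 0) F i z) = fun=> 0.
    by apply/funext => z; rewrite big_ord0.
  by rewrite mean_cst big_ord0; split.
have -> : (fun z => \sum_(i < m.+1) F i z) =
    fun z => \sum_(i < m) F (widen_ord (leqnSn m) i) z + F ord_max z.
  by apply/funext => z; rewrite big_ord_recr.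
have [b e] := IH _ (fun i => bF (widen_ord (leqnSn m) i)).
by rewrite big_ord_recr/= -e; split; [exact: bddfD|rewrite (meanD hM)].
Qed.

Lemma mean_CauchySchwarz f g : bddf f -> bddf g ->
  M (fun z => f z * g z) ^+ 2 <=
  M (fun z => f z ^+ 2) * M (fun z => g z ^+ 2).
Proof.
move=> bf bg; set X := M (fun z => f z ^+ 2); set Z := M (fun z => g z ^+ 2).
set Y := M _.
have bf2 : bddf (fun z => f z ^+ 2) by apply: (bddfM bf bf).
have bg2 : bddf (fun z => g z ^+ 2) by apply: (bddfM bg bg).
have X0 : 0 <= X by apply: (mean_ge0 hM) => // z; exact: sqr_ge0.
have Z0 : 0 <= Z by apply: (mean_ge0 hM) => // z; exact: sqr_ge0.
have key t : 0 <= X - 2 * t * Y + t ^+ 2 * Z.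
  have -> : X - 2 * t * Y + t ^+ 2 * Z = M (fun z => (f z - t * g z) ^+ 2).
    have -> : (fun z => (f z - t * g z) ^+ 2) =
      (fun z => (f z ^+ 2 - (2 * t) * (f z * g z)) + t ^+ 2 * g z ^+ 2).
      by apply/funext => z; ring.
    have b1 : bddf (fun z => 2 * t * (f z * g z)) by do ?apply: bddfM.
    rewrite (meanD hM) ?meanB ?(meanZ hM)//.
    - exact: bddfM.
    - by apply: bddfD => //; have [B gB] := b1; exists B => z; rewrite normrN.
    - by apply: bddfM.
  apply: (mean_ge0 hM) => [|z]; last exact: sqr_ge0.
  have b : bddf (fun z => f z - t * g z).
    apply: bddfD => //; have [B gB] : bddf (fun z => t * g z) by apply: bddfM.
    by exists B => z; rewrite normrN.
  exact: (bddfM b b).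
have [Z00|Zn0] := eqVneq Z 0.
  rewrite Z00 mulr0; have [->|Yn0] := eqVneq Y 0; first by rewrite expr0n.
  (* With Z = 0 the quadratic is affine in [t], and this [t] gives it the value -1. *)
  have := key ((X + 1) / (2 * Y)); rewrite Z00 mulr0 addr0.
  have -> : 2 * ((X + 1) / (2 * Y)) * Y = X + 1 by field.
  lra.
have Zp : 0 < Z by rewrite lt0r Zn0.
have := key (Y / Z).
have -> : X - 2 * (Y / Z) * Y + (Y / Z) ^+ 2 * Z = (X * Z - Y ^+ 2) / Z by field.
by rewrite pmulr_lge0 ?invr_gt0// subr_ge0.
Qed.

Definition cmean p : C := (M (fun z => Re (p z)) +i* M (fun z => Im (p z)))%C.

Lemma cmeanD p q : bddc p -> bddc q ->
  cmean (fun z => p z + q z) = cmean p + cmean q.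
Proof.
move=> bp bq; rewrite /cmean.
have -> : (fun z => Re (p z + q z)) = fun z => Re (p z) + Re (q z).
  by apply/funext => z; case: (p z); case: (q z).
have -> : (fun z => Im (p z + q z)) = fun z => Im (p z) + Im (q z).
  by apply/funext => z; case: (p z); case: (q z).
by rewrite !(meanD hM); auto.
Qed.

Lemma cmeanZ (c : C) p : bddc p -> cmean (fun z => c * p z) = c * cmean p.
Proof.
move=> bp; rewrite /cmean; case: c => a b.
have bR := bddc_Re bp; have bI := bddc_Im bp.
have -> : (fun z => Re ((a +i* b)%C * p z)) = fun z => a * Re (p z) + (- b) * Im (p z).
  by apply/funext => z; case: (p z) => x y /=; ring.
have -> : (fun z => Im ((a +i* b)%C * p z)) = fun z => a * Im (p z) + b * Re (p z).
  by apply/funext => z; case: (p z) => x y /=.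
rewrite !(meanD hM) ?(meanZ hM); auto.
by apply/eqP; rewrite eq_complex/=; apply/andP; split; apply/eqP; ring.
Qed.

Lemma cmeanB p q : bddc p -> bddc q ->
  cmean (fun z => p z - q z) = cmean p - cmean q.
Proof.
move=> bp bq; rewrite -mulN1r -cmeanZ// -cmeanD//; last by apply: bddcM.
by congr cmean; apply/funext => z; rewrite mulN1r.
Qed.

Lemma cmean_cst (c : C) : cmean (fun=> c) = c.
Proof. by rewrite /cmean !mean_cst; case: c. Qed.

Lemma cmean_real f : cmean (fun z => (f z)%:C%C) = (M f)%:C%C.
Proof. by rewrite /cmean/= mean_cst. Qed.

Lemma cmean_shift p s : bddc p -> cmean (fun z => p (z + s)) = cmean p.
Proof.
move=> bp; rewrite /cmean.
by rewrite (mean_shift hM s (bddc_Re bp)) (mean_shift hM s (bddc_Im bp)).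
Qed.

Lemma cmean_sum (m : nat) (F : 'I_m -> A -> C) : (forall i, bddc (F i)) ->
  cmean (fun z => \sum_(i < m) F i z) = \sum_(i < m) cmean (F i).
Proof.
move=> bF; suff [//] : bddc (fun z => \sum_(i < m) F i z) /\
   cmean (fun z => \sum_(i < m) F i z) = \sum_(i < m) cmean (F i).
elim: m F bF => [|m IH] F bF.
  have -> : (fun z => \sum_(i < 0) F i z) = fun=> 0.
    by apply/funext => z; rewrite big_ord0.
  by rewrite cmean_cst big_ord0; split.
have -> : (fun z => \sum_(i < m.+1) F i z) =
    fun z => \sum_(i < m) F (widen_ord (leqnSn m) i) z + F ord_max z.
  by apply/funext => z; rewrite big_ord_recr.
have [b e] := IH _ (fun i => bF (widen_ord (leqnSn m) i)).
by rewrite big_ord_recr/= -e; split; [exact: bddcD|rewrite cmeanD].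
Qed.

Lemma cmean_norm p : bddc p -> cnorm (cmean p) <= M (fun z => cnorm (p z)).
Proof.
move=> bp; set c := cmean p.
have [c0|cn0] := eqVneq c 0.
  by rewrite c0 cnorm0; apply: (mean_ge0 hM); auto => z; exact: cnorm_ge0.
have n0 : cnorm c != 0 by rewrite cnorm_eq0.
(* [w] rotates the mean onto the positive real axis, where its modulus is the mean of a real
   part. *)
pose w : C := conjc c * (cnorm c)^-1%:C%C.
have w1 : cnorm w = 1.
  by rewrite cnormM cnorm_conj cnorm_real normfV ger0_norm ?cnorm_ge0// divff.
have cE : cnorm c = Re (cmean (fun z => w * p z)).
  rewrite cmeanZ// -/c /w -mulrA [_ * c]mulrC mulrA [conjc c * c]mulrC mulc_conj.
  by rewrite -rmorphM /= expr2 mulfK.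
rewrite cE /cmean/=; apply: mean_le; auto => z.
apply: (le_trans (ler_norm _)); apply: (le_trans (cnorm_Re _)).
by rewrite cnormM w1 mul1r.
Qed.

Lemma cmean_norm_le p (B : R) : (forall z, cnorm (p z) <= B) ->
  cnorm (cmean p) <= B.
Proof.
move=> pB; have bp : bddc p by exists B.
rewrite (le_trans (cmean_norm bp))// -[leRHS]mean_cst.
by apply: mean_le; auto.
Qed.

Definition msq p : R := M (fun z => cnorm (p z) ^+ 2).

Lemma msq_ge0 p : bddc p -> 0 <= msq p.
Proof. by move=> bp; apply: (mean_ge0 hM); auto => z; exact: sqr_ge0. Qed.

Lemma msq_shift p s : bddc p -> msq (fun z => p (z + s)) = msq p.
Proof. by move=> bp; rewrite /msq (mean_shift hM s (bddc_sqr bp)). Qed.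

Lemma msqZ (c : C) p : bddc p -> msq (fun z => c * p z) = cnorm c ^+ 2 * msq p.
Proof.
move=> bp; rewrite /msq -(meanZ hM); auto; congr M; apply/funext => z.
by rewrite cnormM exprMn.
Qed.

Lemma msq_par p q : bddc p -> bddc q ->
  msq (fun z => p z + q z) + msq (fun z => p z - q z) = 2 * msq p + 2 * msq q.
Proof.
move=> bp bq; rewrite /msq -!(meanZ hM) -?(meanD hM); auto.
congr M; apply/funext => z; rewrite !sqr_cnorm.
by case: (p z) => a b; case: (q z) => c d /=; ring.
Qed.

Lemma cmean_CauchySchwarz p q : bddc p -> bddc q ->
  cnorm (cmean (fun z => p z * q z)) ^+ 2 <= msq p * msq q.
Proof.
move=> bp bq; apply: (le_trans _ (mean_CauchySchwarz (bddc_cnorm bp) (bddc_cnorm bq))).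
rewrite ler_sqr ?nnegrE ?cnorm_ge0//; last first.
  by apply: (mean_ge0 hM); auto => z; rewrite mulr_ge0// cnorm_ge0.
apply: (le_trans (cmean_norm (bddcM bp bq))).
by under eq_fun do rewrite cnormM.
Qed.

Lemma msq_conj p : msq (fun z => conjc (p z)) = msq p.
Proof. by rewrite /msq; under eq_fun do rewrite cnorm_conj. Qed.

Lemma msq_le p (B : R) : (forall z, cnorm (p z) <= B) -> msq p <= B ^+ 2.
Proof.
move=> pB; have bp : bddc p by exists B.
rewrite -[leRHS]mean_cst; apply: mean_le; auto => z.
by rewrite lerXn2r ?nnegrE ?cnorm_ge0// (le_trans (cnorm_ge0 _) (pB 0)).
Qed.

End ComplexMean.

(* Total boundedness of the translates of g, as a finite colouring of A.       *)
Definition ap_fun {R : realType} {A : zmodType} (g : A -> R[i]) :=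
  forall e : R, 0 < e -> exists (m : nat) (c : A -> 'I_m),
    forall z w, c z = c w -> forall s, cnorm (g (z + s) - g (w + s)) <= e.

(** Colours that are not attained are sent to [t0]. *)
Lemma coloring_repr (T : Type) (t0 : T) (m : nat) (c : T -> 'I_m) :
  exists r : 'I_m -> T, forall t, c (r (c t)) = c t.
Proof.
have ex (i : 'I_m) : exists t, (exists t', c t' = i) -> c t = i.
  have [[t' ti]|n] := pselect (exists t', c t' = i); first by exists t'.
  by exists t0.
by have [r hr] := choice ex; exists r => t; apply: hr; exists t.
Qed.

Section AlmostPeriodicFunctions.
Context {R : realType} {A : zmodType}.
Implicit Types (g h : A -> R[i]).

Lemma ap_funD g h : ap_fun g -> ap_fun h -> ap_fun (fun z => g z + h z).
Proof.
move=> hg hh e e0; have e2 : 0 < e / 2 by lra.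
have [m [c hc]] := hg _ e2; have [n [d hd]] := hh _ e2.
exists #|{: 'I_m * 'I_n}|, (fun z => enum_rank (c z, d z)) => z w /enum_rank_inj[cz dz] s.
have -> : g (z + s) + h (z + s) - (g (w + s) + h (w + s)) =
   (g (z + s) - g (w + s)) + (h (z + s) - h (w + s)) by ring.
apply: (le_trans (cnormD _ _)); have := hc _ _ cz s; have := hd _ _ dz s; lra.
Qed.

Lemma ap_funZ a g : ap_fun g -> ap_fun (fun z => a * g z).
Proof.
move=> hg e e0.
have c1 : 0 < cnorm a + 1 by rewrite ltr_wpDl ?cnorm_ge0.
have [m [c hc]] := hg _ (divr_gt0 e0 c1); exists m, c => z w zw s.
rewrite -mulrBr cnormM; apply: (le_trans (ler_wpM2l (cnorm_ge0 _) (hc _ _ zw s))).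
rewrite mulrA ler_pdivrMr// mulrC ler_wpM2l//; [exact: ltW | lra].
Qed.

End AlmostPeriodicFunctions.

Section Convolution.
Context {R : realType} {A : zmodType} (M : (A -> R) -> R).
Hypothesis hM : invariant_mean M.
Local Notation C := R[i].
Local Notation cmean := (@cmean R A M).
Local Notation msq := (@msq R A M).
Implicit Types (f g p q v : A -> C).

(* A Fubini theorem for a finitely additive mean; it fails without ap_fun.     *)
Lemma ap_mean_swap g p q : ap_fun g -> bddc g -> bddc p -> bddc q ->
  cmean (fun z => p z * cmean (fun w => g (z + w) * q w)) =
  cmean (fun w => q w * cmean (fun z => g (z + w) * p z)).
Proof.
move=> apg bg bp bq; apply/eqP; rewrite -subr_eq0 -cnorm_eq0.
rewrite eq_le cnorm_ge0 andbT.
have [Bp hBp] := bp; have [Bq hBq] := bq.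
have Bp0 : 0 <= Bp := le_trans (cnorm_ge0 _) (hBp 0).
have Bq0 : 0 <= Bq := le_trans (cnorm_ge0 _) (hBq 0).
have [Bg hBg] := bg.
apply/ler_addgt0Pr => e e0; rewrite add0r.
(* Each of the two iterated means changes by at most [d * (Bp * Bq)] when the kernel is replaced;
   the added 1 keeps the denominator positive. *)
pose d := e / (2 * (Bp * Bq + 1)).
have P1 : 0 < 2 * (Bp * Bq + 1) by rewrite mulr_gt0// ltr_wpDl// mulr_ge0.
have d0 : 0 < d by rewrite divr_gt0.
have [m [c hc]] := apg _ d0; have [r hr] := coloring_repr 0 c.
(* With [z] replaced by the representative of its colour, the kernel is a finite sum of products,
   and the exchange of means is linearity. *)
pose G z w := g (r (c z) + w).
have gG z w : cnorm (g (z + w) - G z w) <= d by apply: hc; rewrite hr.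
pose K i := cmean (fun w => g (r i + w) * q w).
pose P i := cmean (fun z => (c z == i)%:R * p z).
have bK i : bddc (fun w => g (r i + w) * q w).
  by apply: bddcM => //; exists Bg.
have bP i : bddc (fun z => (c z == i)%:R * p z).
  by apply: bddcM => //; exists 1 => z; rewrite cnorm_nat; case: (c z == i);
      rewrite ?ler01 ?lexx.
have L : cmean (fun z => p z * cmean (fun w => G z w * q w)) = \sum_i K i * P i.
  have -> : (fun z => p z * cmean (fun w => G z w * q w)) =
      fun z => \sum_i K i * ((c z == i)%:R * p z).
    apply/funext => z; rewrite (bigD1 (c z))//= eqxx mul1r big1 ?addr0 1?mulrC//.
    by move=> i /negPf; rewrite eq_sym => ->; rewrite mul0r mulr0.
  rewrite (cmean_sum hM) => [|i]; last by apply: bddcM.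
  by apply: eq_bigr => i _; rewrite (cmeanZ hM).
have Rr : cmean (fun w => q w * cmean (fun z => G z w * p z)) = \sum_i K i * P i.
  have -> : (fun w => q w * cmean (fun z => G z w * p z)) =
      fun w => \sum_i P i * (g (r i + w) * q w).
    apply/funext => w.
    have -> : (fun z => G z w * p z) =
       fun z => \sum_i g (r i + w) * ((c z == i)%:R * p z).
      apply/funext => z; rewrite (bigD1 (c z))//= eqxx mul1r big1 ?addr0//.
      by move=> i /negPf; rewrite eq_sym => ->; rewrite mul0r mulr0.
    rewrite (cmean_sum hM) => [|i]; last by apply: bddcM.
    rewrite mulr_sumr; apply: eq_bigr => i _; rewrite (cmeanZ hM)// -/(P i).
    by ring.
  rewrite (cmean_sum hM) => [|i]; last by apply: bddcM.
  by apply: eq_bigr => i _; rewrite (cmeanZ hM)// mulrC.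
have bgz z : bddc (fun w => g (z + w)) by exists Bg.
have bgw w : bddc (fun z => g (z + w)) by exists Bg.
have hGB z w : cnorm (G z w) <= Bg by exact: hBg.
have bGz z : bddc (G z) by exists Bg => w; exact: hBg.
have bGw w : bddc (fun z => G z w) by exists Bg => z; exact: hBg.
have inn (x y s : A -> C) (B : R) : bddc x -> bddc y -> bddc s ->
    (forall z, cnorm (s z) <= B) ->
    (forall z, cnorm (x z - y z) <= d) ->
    cnorm (cmean (fun z => x z * s z) - cmean (fun z => y z * s z)) <= d * B.
  move=> bx bY bs sB xy; rewrite -(cmeanB hM); auto.
  apply: (cmean_norm_le hM) => z.
  by rewrite -mulrBl cnormM ler_pM// cnorm_ge0.
have out (x y s : A -> C) (B B' : R) : bddc x -> bddc y -> bddc s -> 0 <= B -> 0 <= B' ->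
    (forall z, cnorm (s z) <= B) ->
    (forall z, cnorm (x z - y z) <= d * B') ->
    cnorm (cmean (fun z => s z * x z) - cmean (fun z => s z * y z)) <= d * (B * B').
  move=> bx bY bs B0 B0' sB xy; rewrite -(cmeanB hM); auto.
  apply: (cmean_norm_le hM) => z; rewrite -mulrBr cnormM mulrCA.
  by rewrite ler_pM// cnorm_ge0.
have bcm (F : A -> A -> C) (B : R) : (forall z w, cnorm (F z w) <= B) ->
    bddc (fun z => cmean (F z)).
  by move=> hF; exists B => z; apply: (cmean_norm_le hM).
have b1 : bddc (fun z => cmean (fun w => g (z + w) * q w)).
  by apply: (bcm _ (Bg * Bq)) => z w; rewrite cnormM ler_pM ?cnorm_ge0//.
have b2 : bddc (fun z => cmean (fun w => G z w * q w)).
  by apply: (bcm _ (Bg * Bq)) => z w; rewrite cnormM ler_pM ?cnorm_ge0//.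
have b3 : bddc (fun w => cmean (fun z => g (z + w) * p z)).
  by apply: (bcm _ (Bg * Bp)) => z w; rewrite cnormM ler_pM ?cnorm_ge0//.
have b4 : bddc (fun w => cmean (fun z => G z w * p z)).
  by apply: (bcm _ (Bg * Bp)) => z w; rewrite cnormM ler_pM ?cnorm_ge0//.
have h1 := out _ _ _ _ _ b1 b2 bp Bp0 Bq0 hBp (fun z => inn _ _ _ _ (bgz z)
    (bGz z) bq hBq (gG z)).
have h2 := out _ _ _ _ _ b3 b4 bq Bq0 Bp0 hBq (fun w => inn _ _ _ _ (bgw w)
    (bGw w) bp hBp (fun z => gG z w)).
rewrite L in h1; rewrite Rr in h2.
have dE : d * (2 * (Bp * Bq + 1)) = e by rewrite /d mulfVK ?gt_eqF.
apply: (le_trans (cnorm_tri (\sum_i K i * P i) _ _)); rewrite (cnorm_distC (\sum_i _)).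
by have := lerD h1 h2; rewrite (mulrC Bq); nra.
Qed.

(** The kernel is g(z + w), not g(z - w): it is symmetric in [z] and [w], as [ap_mean_swap] expects,
    and translating [v] by [s] translates the convolution by [- s]. *)
Definition conv g v : A -> C := fun z => cmean (fun w => g (z + w) * v w).

Section FixedKernel.
Variable g : A -> C.
Hypothesis bg : bddc g.

Let bgz z : bddc (fun w => g (z + w)).
Proof. by have [B hB] := bg; exists B. Qed.

Lemma msq_translate z : msq (fun w => g (z + w)) = msq g.
Proof. by rewrite -[RHS](msq_shift hM z bg); congr msq; apply/funext => w;
    rewrite addrC. Qed.

(** This is what turns mean-square information about [v] into uniform information about
    [conv g v]. *)
Lemma conv_sqr_le v z : bddc v -> cnorm (conv g v z) ^+ 2 <= msq g * msq v.
Proof. by move=> bv; rewrite -(msq_translate z); exact: cmean_CauchySchwarz. Qed.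

Lemma conv_bdd v : bddc v -> bddc (conv g v).
Proof.
move=> bv; have [B hB] := bddcM bg bv; have [Bg hg] := bg; have [Bv hv] := bv.
exists (Bg * Bv) => z; apply: (cmean_norm_le hM) => w.
by rewrite cnormM ler_pM ?cnorm_ge0//.
Qed.

Lemma convD u v : bddc u -> bddc v ->
  conv g (fun w => u w + v w) = fun z => conv g u z + conv g v z.
Proof.
move=> bu bv; apply/funext => z; rewrite /conv -(cmeanD hM); auto.
by congr cmean; apply/funext => w; rewrite mulrDr.
Qed.

Lemma convZ (a : C) v : bddc v ->
  conv g (fun w => a * v w) = fun z => a * conv g v z.
Proof.
move=> bv; apply/funext => z; rewrite /conv -(cmeanZ hM); auto.
by congr cmean; apply/funext => w; rewrite mulrCA.
Qed.

Lemma convB u v : bddc u -> bddc v ->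
  conv g (fun w => u w - v w) = fun z => conv g u z - conv g v z.
Proof.
move=> bu bv; apply/funext => z; rewrite /conv -(cmeanB hM); auto.
by congr cmean; apply/funext => w; rewrite mulrBr.
Qed.

Lemma conv_shift v s : bddc v ->
  conv g (fun w => v (w + s)) = fun z => conv g v (z - s).
Proof.
move=> bv; apply/funext => z; rewrite /conv.
rewrite -(cmean_shift hM s (bddcM (bgz (z - s)) bv)).
by congr cmean; apply/funext => w; rewrite addrACA addNr addr0.
Qed.

End FixedKernel.
End Convolution.

(** * Approximate joint eigenvectors of the translations *)

Section JointApproximateEigenvectors.
Context {R : realType} {A : zmodType} (M : (A -> R) -> R).
Hypothesis hM : invariant_mean M.
Local Notation C := R[i].
Local Notation cmean := (@cmean R A M).
Local Notation msq := (@msq R A M).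
Local Notation conv := (@conv R A M).
Implicit Types (f g p q v : A -> C).

(* An abstract class of quadratic forms, so that one splitting of v serves     *)
(* several of them at once.                                                   *)
Record quad_form (q : (A -> C) -> R) : Prop := QuadForm {
  quad_par : forall u v, bddc u -> bddc v ->
    q (fun z => u z + v z) + q (fun z => u z - v z) = 2 * q u + 2 * q v;
  quad_scale : forall (c : C) v, bddc v ->
    q (fun z => c * v z) = cnorm c ^+ 2 * q v;
  quad_shift : forall v s, bddc v -> q (fun z => v (z + s)) = q v }.

Lemma msq_quad : quad_form msq.
Proof.
split=> [u v bu bv|c v bv|v s bv]; first exact: msq_par.
  exact: msqZ.
exact: msq_shift.
Qed.

Lemma conv_quad g : bddc g -> quad_form (fun v => msq (conv g v)).
Proof.
move=> bg; split=> [u v bu bv|c v bv|v s bv].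
- by rewrite convD// convB// (msq_par hM)//; exact: conv_bdd.
- by rewrite convZ// (msqZ hM)//; exact: conv_bdd.
- by rewrite conv_shift// (msq_shift hM (- s))//; exact: conv_bdd.
Qed.

Lemma bddc_shift v s : bddc v -> bddc (fun z => v (z + s)).
Proof. by move=> [B hB]; exists B. Qed.
Hint Resolve bddc_shift : core.

Lemma eigen_quad (s : A) (c : C) :
  quad_form (fun v => msq (fun z => v z - c * v (z + s))).
Proof.
split=> [u v bu bv|a v bv|v t bv].
- rewrite -(msq_par hM); auto; congr (msq _ + msq _); apply/funext => z; ring.
- rewrite -(msqZ hM); auto; congr (msq _); apply/funext => z; ring.
- rewrite -[RHS](msq_shift hM t); auto; congr (msq _); apply/funext => z.
  by rewrite addrAC.
Qed.

Lemma unit_sqrt (w : C) : cnorm w = 1 -> exists2 w' : C, cnorm w' = 1 & w' ^+ 2 = w.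
Proof.
move=> w1; exists (sqrtc w); last exact: sqr_sqrtc.
apply/eqP; rewrite -(@eqrXn2 _ 2) ?cnorm_ge0 ?ler01//.
by rewrite -cnormX sqr_sqrtc w1 expr1n.
Qed.

(* The binary tree of this induction is the discrete Fourier decomposition of *)
(* v under the shift by s, written without roots of unity of order 2 ^ k.     *)
Lemma spectral_splitting (s : A) (k : nat) : forall v (w : C), bddc v -> cnorm w = 1 ->
  exists (J : finType) (vs : J -> A -> C) (ws : J -> C),
  [/\ #|J| = (2 ^ k)%N, forall j, bddc (vs j), forall j, cnorm (ws j) = 1,
      forall q : (A -> C) -> R, quad_form q -> q v = \sum_j q (vs j) &
      forall j z, vs j z - ws j * vs j (z + s) =
        (2 ^+ k)^-1 * (v z - w * v (z + s *+ (2 ^ k)))].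
Proof.
elim: k => [|k IH] v w bv w1.
  exists unit, (fun=> v), (fun=> w); split=> //.
  - by rewrite card_unit.
  - by move=> q _; rewrite big_const card_unit/= addr0.
  - by move=> j z; rewrite expr0 invr1 mul1r expn0 mulr1n.
have [w' w'1 w'2] := unit_sqrt w1.
pose t := s *+ 2 ^ k.
(* As w'^2 = w, both a - w' a(. + t) and b + w' b(. + t) equal half of v - w v(. + 2t), so the two
   halves recurse with the square roots w' and -w' of [w]. *)
pose a := fun z => 2^-1 * (v z + w' * v (z + t)).
pose b := fun z => 2^-1 * (v z - w' * v (z + t)).
have ba : bddc a by apply: bddcM => //; auto.
have bb : bddc b by apply: bddcM => //; auto.
have w'N : cnorm (- w') = 1 by rewrite cnormN.
have [J1 [v1 [w1_ [c1 b1 u1 q1 e1]]]] := IH a w' ba w'1.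
have [J2 [v2 [w2_ [c2 b2 u2 q2 e2]]]] := IH b (- w') bb w'N.
exists (J1 + J2)%type, (fun j => match j with inl i => v1 i | inr i => v2 i end),
  (fun j => match j with inl i => w1_ i | inr i => w2_ i end); split.
- by rewrite card_sum c1 c2 addnn expnS mul2n.
- by case.
- by case.
- move=> q hq; rewrite big_sumType/= -q1// -q2//.
  have bt : bddc (fun z => w' * v (z + t)) by auto.
  rewrite (quad_scale hq); auto; rewrite (quad_scale hq); auto.
  rewrite -mulrDr (quad_par hq)// (quad_scale hq); auto.
  rewrite (quad_shift hq)// w'1 cnormV cnorm_nat; by field.
- have two : (2 ^ k.+1)%N = (2 ^ k + 2 ^ k)%N by rewrite addnn expnS mul2n.
  have n2 : (2 : C) != 0 by rewrite pnatr_eq0.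
  have n2k : (2 ^+ k : C) != 0 by rewrite expf_neq0.
  have tt z : z + t + t = z + s *+ 2 ^ k.+1 by rewrite two mulrnDr addrA.
  case=> [j|j] z.
    by rewrite e1 -/t /a tt exprS -w'2; field; rewrite n2k.
  by rewrite e2 -/t /b tt exprS -w'2; field; rewrite n2k.
Qed.

Definition eigen_defect (L : seq (A * C)) v : R :=
  \sum_(x <- L) msq (fun z => v z - x.2 * v (z + x.1)).

Lemma eigen_defect_quad L : quad_form (eigen_defect L).
Proof.
split=> [u v bu bv|a v bv|v t bv]; rewrite /eigen_defect.
- rewrite -big_split !mulr_sumr -big_split; apply: eq_bigr => x _.
  exact: (quad_par (eigen_quad x.1 x.2)).
- rewrite mulr_sumr; apply: eq_bigr => x _.
  exact: (quad_scale (eigen_quad x.1 x.2)).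
- by apply: eq_bigr => x _; exact: (quad_shift (eigen_quad x.1 x.2)).
Qed.

Lemma sum_gt0_exists (J : finType) (F : J -> R) :
  0 < \sum_j F j -> exists j, 0 < F j.
Proof.
move=> h; apply: contrapT => n; move: h; rewrite ltNge => /negP; apply.
by apply: sumr_le0 => j _; rewrite leNgt; apply/negP => p; apply: n; exists j.
Qed.

(** The functional [msq (conv g v) - c' * msq v - K * eigen_defect L v] is a combination of
    quadratic forms, so it splits exactly over the pieces of [v]. The new defects in the direction
    [s] total at most 4 msq v / 2^k; for large [k], some piece keeps the functional positive even
    after [K] times its new defect is subtracted. Each [s] uses up half of the gap between [c] and
    [c']. *)
Lemma joint_approx_eigenvector g (S : seq A) : bddc g -> forall (K c c' : R) v0,
  0 <= K -> c' < c -> bddc v0 -> 0 < msq v0 ->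
  c * msq v0 <= msq (conv g v0) ->
  exists v (L : seq (A * C)),
  [/\ bddc v, 0 < msq v, map fst L = S, {in L, forall x, cnorm x.2 = 1} &
      c' * msq v + K * eigen_defect L v <= msq (conv g v)].
Proof.
move=> bg; elim: S => [|s S IH] K c c' v0 K0 cc b0 p0 h0.
  exists v0, [::]; split=> //; rewrite /eigen_defect big_nil mulr0 addr0.
  by apply: le_trans h0; rewrite ler_wpM2r ?ltW.
pose c2 := (c + c') / 2.
have [v [L [bv pv LS Lu h]]] : exists v (L : seq (A * C)),
  [/\ bddc v, 0 < msq v, map fst L = S, {in L, forall x, cnorm x.2 = 1} &
      c2 * msq v + K * eigen_defect L v <= msq (conv g v)].
  by apply: (IH K c c2 v0) => //; rewrite /c2; lra.
have c2c : 0 < c2 - c' by rewrite /c2; lra.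
pose k := Num.truncn (4 * K / (c2 - c')).
have k4 : 4 * K < (c2 - c') * 2 ^+ k.
  rewrite [ltRHS]mulrC -ltr_pdivrMr//; apply: lt_le_trans
      (archimedean.Num.Theory.truncnS_gt _) _.
  by rewrite -natrX ler_nat; exact: ltn_expl.
have [J [vs [ws [cJ bJ uJ qJ eJ]]]] := spectral_splitting s k bv (@cnorm1 R).
pose Q u := msq (conv g u) - c' * msq u - K * eigen_defect L u.
have dJ j : msq (fun z => vs j z - ws j * vs j (z + s)) <= 4 * msq v / (2 ^+ k) ^+ 2.
  rewrite (_ : (fun z => vs j z - ws j * vs j (z + s)) =
     fun z => (2 ^+ k)^-1 * (v z - 1 * v (z + s *+ (2 ^ k)))); last first.
    by apply/funext => z; rewrite eJ.
  rewrite (msqZ hM); auto; rewrite cnormV cnormX cnorm_nat exprVn mulrC.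
  rewrite ler_wpM2r ?invr_ge0 ?exprn_ge0//.
  have bs : bddc (fun z => 1 * v (z + s *+ 2 ^ k)) by auto.
  have := msq_par hM bv bs; rewrite (msqZ hM (1 : C) (bddc_shift (s *+ 2 ^ k) bv)).
  rewrite (msq_shift hM)// cnorm1 expr1n mul1r.
  have := msq_ge0 hM (bddcD bv bs); lra.
have [j] : exists j, 0 < Q (vs j) - K * msq (fun z => vs j z - ws j * vs j (z + s)).
  apply: sum_gt0_exists; rewrite sumrB /Q !sumrB -!mulr_sumr.
  rewrite -(qJ _ (conv_quad bg)) -(qJ _ msq_quad) -(qJ _ (eigen_defect_quad L)).
  have : \sum_j msq (fun z => vs j z - ws j * vs j (z + s)) <= 4 * msq v / 2 ^+ k.
    apply: (le_trans (ler_sum _ (fun j _ => dJ j))).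
    rewrite sumr_const cJ -[leLHS]mulr_natl natrX expr2 invfM.
    by rewrite mulrCA !mulrA mulfK ?gt_eqF ?exprn_gt0.
  move=> /(ler_wpM2l K0) h2.
  have : K * (4 * msq v / 2 ^+ k) < (c2 - c') * msq v.
    have -> : K * (4 * msq v / 2 ^+ k) = 4 * K * msq v / 2 ^+ k by ring.
    by rewrite ltr_pdivrMr ?exprn_gt0// [ltRHS]mulrAC ltr_pM2r.
  lra.
rewrite /Q => hj.
exists (vs j), ((s, ws j) :: L); split=> //.
(* A piece of mean square 0 has vanishing convolution, against the strict inequality [hj]. *)
- rewrite lt0r msq_ge0// andbT; apply/eqP => m0.
  have : msq (conv g (vs j)) <= 0.
    rewrite -(mean_cst hM 0); apply: mean_le => // [|z]; first exact/bddc_sqr/conv_bdd.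
    by apply: le_trans (conv_sqr_le hM bg z (bJ j)) _; rewrite m0 mulr0.
  have d0 : 0 <= eigen_defect L (vs j).
    by apply: sumr_ge0 => x _; apply: msq_ge0 => //; auto.
  have d1 : 0 <= msq (fun z => vs j z - ws j * vs j (z + s)) by apply: msq_ge0 => //; auto.
  have := mulr_ge0 K0 d0; have := mulr_ge0 K0 d1.
  by move: hj; rewrite m0 mulr0; lra.
- by rewrite /= LS.
- by move=> x; rewrite inE => /orP[/eqP ->|]; [exact: uJ|exact: Lu].
- rewrite /eigen_defect big_cons/= -/(eigen_defect L (vs j)) mulrDr; lra.
Qed.

End JointApproximateEigenvectors.

Record character {R : realType} {A : zmodType} (x : A -> R[i]) : Prop := Character {
  charD : forall z w, x (z + w) = x z * x w;
  char_unit : forall z, cnorm (x z) = 1 }.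

(** * Characters and Fourier expansion *)

Section Characters.
Context {R : realType} {A : zmodType} (M : (A -> R) -> R).
Hypothesis hM : invariant_mean M.
Local Notation C := R[i].
Local Notation cmean := (@cmean R A M).
Local Notation msq := (@msq R A M).
Local Notation conv := (@conv R A M).
Implicit Types (f g p q v : A -> C).

Lemma cnorm_le_sqr (x : C) (e : R) : 0 <= e -> cnorm x ^+ 2 <= e ^+ 2 -> cnorm x <= e.
Proof. by move=> e0; rewrite ler_sqr ?nnegrE ?cnorm_ge0. Qed.

(** By Cauchy-Schwarz, the bound on [g] passes unchanged to [conv g v]: one colouring for [g] serves
    all normalised [v] at once. *)
Lemma conv_modulus g v z w e : bddc g -> bddc v -> msq v = 1 -> 0 <= e ->
  (forall s, cnorm (g (z + s) - g (w + s)) <= e) ->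
  cnorm (conv g v z - conv g v w) <= e.
Proof.
move=> [B hB] bv v1 e0 h; apply: cnorm_le_sqr => //.
have bz x : bddc (fun s => g (x + s)) by exists B.
rewrite /conv -(cmeanB hM); auto.
under eq_fun do rewrite -mulrBl.
apply: (le_trans (cmean_CauchySchwarz hM (bddcB (bz z) (bz w)) bv)).
by rewrite v1 mulr1; exact: msq_le.
Qed.

(** The eigenvector equation for [v] holds in mean square only; convolution with [g] makes it
    uniform. The value at 0 becomes large by translating [v], since a mean above [c0] is attained or
    exceeded at some point up to that level. *)
Lemma approx_eigen_conv g v0 (c0 c : R) : bddc g -> bddc v0 -> 0 < msq v0 ->
  0 <= c0 -> c0 < c -> c * msq v0 <= msq (conv g v0) ->
  forall (S : seq A) (e : R), 0 < e -> exists v, [/\ bddc v, msq v = 1,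
    c0 <= cnorm (conv g v 0) ^+ 2 &
    forall s, s \in S -> exists2 l : C, cnorm l = 1 &
      forall z, cnorm (conv g v z - l * conv g v (z - s)) <= e].
Proof.
move=> bg b0 p0 c00 cc h0 S e e0.
pose c1 := (c0 + c) / 2; have c01 : c0 < c1 by rewrite /c1; lra.
(* The penalty bounds the defect [d] by [msq g * msq v / K], and the squared convolution of the
   defect is at most [msq g * d]; this [K] makes it at most [e ^+ 2 * msq v]. *)
pose K := (msq g ^+ 2 + 1) / e ^+ 2.
have e2 : 0 < e ^+ 2 by rewrite exprn_gt0.
have K0 : 0 < K by rewrite divr_gt0// ltr_wpDl// sqr_ge0.
have [|v [L [bv pv LS Lu h]]] :=
  joint_approx_eigenvector hM S bg (ltW K0) (_ : c1 < c) b0 p0 h0.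
  by rewrite /c1; lra.
pose r : C := (Num.sqrt (msq v))^-1%:C%C.
have sv : 0 < Num.sqrt (msq v) by rewrite sqrtr_gt0.
have r2 : cnorm r ^+ 2 = (msq v)^-1.
  by rewrite cnorm_real ger0_norm ?invr_ge0 ?ltW// exprVn sqr_sqrtr ?ltW.
pose v1 z := r * v z.
have bv1 : bddc v1 by rewrite /v1; auto.
have m1 : msq v1 = 1 by rewrite (msqZ hM)// r2 mulVf ?gt_eqF.
have [z0 hz0] : exists z0, c0 <= cnorm (conv g v1 z0) ^+ 2.
  apply: contrapT => n.
  have : msq (conv g v1) <= c0.
    rewrite -(mean_cst hM c0); apply: (mean_le hM) => //.
      exact/bddc_sqr/conv_bdd.
    by move=> z; rewrite leNgt; apply/negP => zz; apply: n; exists z; exact: ltW.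
  rewrite /v1 (convZ hM)// (msqZ hM) ?r2; last exact: conv_bdd.
  have d0 : 0 <= eigen_defect M L v.
    by apply: sumr_ge0 => x _; apply: (msq_ge0 hM); apply: bddcB => //;
        apply: bddcM => //; apply: bddc_shift.
  have := mulr_ge0 (ltW K0) d0 => Kd.
  rewrite mulrC ler_pdivrMr// => h3.
  have : c1 * msq v <= c0 * msq v by lra.
  by rewrite ler_pM2r// leNgt c01.
exists (fun z => v1 (z + (- z0))); split.
- exact: bddc_shift.
- by rewrite (msq_shift hM).
- by rewrite (conv_shift hM)// opprK add0r.
- move=> s sS; have : s \in map fst L by rewrite LS.
  move=> /mapP[[s' l] xL /= ->]; exists l; first exact: (Lu _ xL).
  move=> z; rewrite (conv_shift hM)// opprK.
  set y := z + z0; have -> : z - s' + z0 = y - s' by rewrite addrAC.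
  have -> : conv g v1 y - l * conv g v1 (y - s') =
      conv g (fun z => v1 z - l * v1 (z + s')) y.
    have bs : bddc (fun z => v1 (z + s')) by exact: bddc_shift.
    by rewrite (convB hM bg); auto; rewrite (convZ hM)// (conv_shift hM).
  have bs : bddc (fun z => v1 z - l * v1 (z + s')).
    by apply: bddcB => //; apply: bddcM => //; exact: bddc_shift.
  have bs' : bddc (fun z => v z - l * v (z + s')).
    by apply: bddcB => //; apply: bddcM => //; exact: bddc_shift.
  apply: cnorm_le_sqr; first exact: ltW.
  apply: (le_trans (conv_sqr_le hM bg y bs)).
  have -> : msq (fun z => v1 z - l * v1 (z + s')) = (msq v)^-1 * msq (fun z =>
      v z - l * v (z + s')).
    by rewrite -r2 -(msqZ hM)//; congr (msq _); apply/funext => w; rewrite /v1; ring.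
  set d := msq (fun z => v z - l * v (z + s')).
  have dL : d <= eigen_defect M L v.
    rewrite /eigen_defect (big_rem _ xL)/= lerDl; apply: sumr_ge0 => x _.
    by apply: (msq_ge0 hM); apply: bddcB => //; apply: bddcM => //; apply: bddc_shift.
  have d0 : 0 <= d by exact: (msq_ge0 hM).
  have g0 : 0 <= msq g by exact: (msq_ge0 hM).
  have Tv : msq (conv g v) <= msq g * msq v.
    rewrite -(mean_cst hM (msq g * msq v)); apply: (mean_le hM) => // [|x].
      exact/bddc_sqr/conv_bdd.
    exact: conv_sqr_le.
  have h1 : K * d <= msq g * msq v.
    have := ler_wpM2l (ltW K0) dL; have : 0 <= c1 * msq v by rewrite mulr_ge0 ?ltW//; lra.
    lra.
  have h2 : d * (msq g ^+ 2 + 1) <= e ^+ 2 * (msq g * msq v).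
    by move: h1; rewrite /K mulrAC ler_pdivrMr// [leRHS]mulrC [d * _]mulrC.
  rewrite mulrCA ler_pdivrMl//.
  have G1 : 0 < msq g ^+ 2 + 1 by rewrite ltr_wpDl// sqr_ge0.
  rewrite -(ler_pM2r G1) -mulrA; apply: (le_trans (ler_wpM2l g0 h2)).
  have -> : msq g * (e ^+ 2 * (msq g * msq v)) = msq v * e ^+ 2 * msq g ^+ 2 by ring.
  rewrite mulrDr mulr1 lerDl mulr_ge0//; exact: ltW.
Qed.

(** The normalised [v i] come without a uniform bound, so the ultralimit is taken of their
    convolutions. The limit [h] satisfies [h z = x s * h (z - s)] exactly and [h 0] is not 0, so [h]
    is a multiple of [x] and [x] is a character. By the common modulus, some [conv g (v i)] is
    uniformly close to a multiple of [x]; taking its mean against the conjugate of [x] and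
    exchanging means leaves the Fourier coefficient of [g] times a factor of modulus at most 1. *)
Lemma large_character g v0 (c0 c : R) : bddc g -> ap_fun g -> bddc v0 ->
  0 < msq v0 -> 0 < c0 -> c0 < c -> c * msq v0 <= msq (conv g v0) ->
  exists x : A -> C, [/\ character x, ap_fun x &
    c0 <= cnorm (cmean (fun w => g w * conjc (x w))) ^+ 2].
Proof.
move=> bg apg b0 p0 c00 cc h0.
have H (i : seq A * nat) : exists v, [/\ bddc v, msq v = 1,
    c0 <= cnorm (conv g v 0) ^+ 2 &
    forall s, s \in i.1 -> exists2 l : C, cnorm l = 1 &
      forall z, cnorm (conv g v z - l * conv g v (z - s)) <= i.2.+1%:R^-1].
  by apply: (approx_eigen_conv bg b0 p0 (ltW c00) cc h0); rewrite invr_gt0 ltr0Sn.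
have [v hv] := choice H.
(* Outside the list of [i] the multiplier is set to 1; along the filter every translation is
   eventually in the list. *)
have H2 (i : (seq A * nat) * A) : exists l : C, cnorm l = 1 /\
    (i.2 \in i.1.1 -> forall z, cnorm (conv g (v i.1) z -
       l * conv g (v i.1) (z - i.2)) <= i.1.2.+1%:R^-1).
  have [_ _ _ hs] := hv i.1; have [si|nsi] := boolP (i.2 \in i.1.1).
    by have [l l1 hl] := hs _ si; exists l.
  by exists 1; split=> //; exact: cnorm1.
have [lam' hlam'] := choice H2; pose lam i s := lam' (i, s).
have hlam i s : cnorm (lam i s) = 1 /\ (s \in i.1 -> forall z,
    cnorm (conv g (v i) z - lam i s * conv g (v i) (z - s)) <= i.2.+1%:R^-1).
  exact: (hlam' (i, s)).
have [U [UU sU]] := ultraFilterLemma (@box_filter_proper A).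
pose u i := conv g (v i).
have uB i z : cnorm (u i z) <= msq g + 1.
  have [bv m1 _ _] := hv i.
  have := conv_sqr_le hM bg z bv; rewrite m1 mulr1 -/(u i).
  by have := cnorm_ge0 (u i z); nra.
have [h hh] := choice (fun z => is_culim_exists (fun i => uB i z)).
have lamB i s : cnorm (lam i s) <= 1 by have [-> _] := hlam i s.
have [x hx] := choice (fun s => is_culim_exists (fun i => lamB i s)).
have x1 s : cnorm (x s) = 1.
  apply/eqP; rewrite eq_le; apply/andP; split.
    by apply: is_culim_norm_le (hx s) => i; have [-> _] := hlam i s.
  by apply: is_culim_norm_ge (hx s) => i; have [-> _] := hlam i s.
have hE z s : h z = x s * h (z - s).
  apply: (is_culim_unique (hh z)).
  apply: (is_culim_near (f := fun i => lam i s * u i (z - s))).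
    apply: (is_culimM (B := 1)) => // i; by have [-> _] := hlam i s.
  move=> e e0; apply: sU; exists [:: s], (Num.truncn e^-1) => S N sS hN /=.
  rewrite cnorm_distC; have [_ hl] := hlam (S, N) s.
  apply: (le_trans (hl _ _)); first by apply: sS; rewrite inE.
  rewrite /= -[leRHS]invrK lef_pV2 ?posrE ?invr_gt0 ?ltr0Sn//.
  by rewrite (le_trans (ltW (archimedean.Num.Theory.truncnS_gt _)))// ler_nat.
have sc0 : 0 < Num.sqrt c0 by rewrite sqrtr_gt0.
have h0n : Num.sqrt c0 <= cnorm (h 0).
  apply: is_culim_norm_ge (hh 0) => i; have [_ _ hi _] := hv i.
  by rewrite -[leRHS]ger0_norm ?cnorm_ge0// -sqrtr_sqr ler_wsqrtr.
have hx0 z : h z = x z * h 0 by rewrite {1}(hE z z) subrr.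
have hn0 : h 0 != 0 by rewrite -cnorm_eq0 gt_eqF// (lt_le_trans sc0).
have cx : character x.
  split=> // z w; apply: (mulIf hn0); rewrite -hx0 (hE _ w) addrK hx0; ring.
have hmod z w (e : R) : 0 <= e -> (forall s, cnorm (g (z + s) - g (w + s)) <= e) ->
    cnorm (h z - h w) <= e.
  move=> e0 hzw; apply: (is_culim_norm_le (f := fun i => u i z - u i w)).
    by move=> i; have [bv m1 _ _] := hv i; exact: conv_modulus.
  have -> : h z - h w = h z + (-1) * h w by rewrite mulN1r.
  have : is_culim U (fun i => u i z + (-1) * u i w) (h z + (-1) * h w).
    apply: is_culimD => //; apply: (is_culimM (B := 1)) => // [i|].
      by rewrite cnormN cnorm1.
    exact: is_culim_cst.
  by under eq_fun do rewrite mulN1r.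
have apx : ap_fun x.
  move=> e e0; have [m [c' hc]] := apg _ (mulr_gt0 e0 sc0); exists m, c' => z w zw s.
  rewrite !(charD cx) -mulrBl cnormM (char_unit cx) mulr1.
  have := hmod z w _ (ltW (mulr_gt0 e0 sc0)) (hc _ _ zw).
  rewrite (hx0 z) (hx0 w) -mulrBl cnormM => hzw.
  rewrite -(ler_pM2r sc0); apply: le_trans hzw.
  by rewrite ler_wpM2l ?cnorm_ge0.
exists x; split=> //.
suff hs : Num.sqrt c0 <= cnorm (cmean (fun w => g w * conjc (x w))).
  by rewrite -(sqr_sqrtr (ltW c00)) ler_sqr ?nnegrE ?cnorm_ge0// ltW.
have [G GE] : exists G, G = cmean (fun w => g w * conjc (x w)) by eexists.
rewrite -GE.
apply/ler_addgt0Pr => e e0; pose d := e / 4; have d0 : 0 < d by rewrite /d; lra.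
have [m [c' hc]] := apg _ d0; have [r hr] := coloring_repr 0 c'.
(* Closeness at 0 and at one representative of each colour is a finite set of conditions, so one
   index meets them all; the common modulus extends them to all of [A] in [ux]. *)
have [[S N] [/= i0 ir]] : exists i, cnorm (u i 0 - h 0) <= d /\
    forall j, cnorm (u i (r j) - h (r j)) <= d.
  apply: (@filter_ex _ U); apply: filterI; first exact: hh.
  by apply: (@filter_forall _ _ _ U) => j; exact: hh.
set i := (S, N) in i0 ir.
have [bv m1 hi _] := hv i.
have ux z : cnorm (u i z - x z * u i 0) <= e.
  have t1 : cnorm (u i z - u i (r (c' z))) <= d.
    by apply: conv_modulus => //; [exact: ltW|apply: hc; rewrite hr].
  have t2 := ir (c' z).
  have t3 : cnorm (h (r (c' z)) - h z) <= d.
    by apply: hmod; [exact: ltW|apply: hc; rewrite hr].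
  have t4 : cnorm (h z - x z * u i 0) <= d.
    by rewrite hx0 -mulrBr cnormM x1 mul1r cnorm_distC.
  have := cnorm_tri (u i (r (c' z))) (u i z) (x z * u i 0).
  have := cnorm_tri (h (r (c' z))) (u i (r (c' z))) (x z * u i 0).
  have := cnorm_tri (h z) (h (r (c' z))) (x z * u i 0).
  by move: t1 t2 t3 t4; rewrite /d; lra.
have bx : bddc x by exact: bddc_unit.
have bui : bddc (u i) by exact: conv_bdd.
have k1 : cnorm (cmean (fun z => conjc (x z) * u i z) - u i 0) <= e.
  rewrite -{1}(cmean_cst hM (u i 0)) -(cmeanB hM); auto.
  apply: (cmean_norm_le hM) => z.
  have -> : conjc (x z) * u i z - u i 0 = conjc (x z) * (u i z - x z * u i 0).
    by rewrite mulrBr mulrA [conjc (x z) * x z]mulrC mulc_conj x1 expr1n mul1r.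
  by rewrite cnormM cnorm_conj x1 mul1r.
move: k1; rewrite /u /conv ap_mean_swap; auto.
have -> : (fun w => v i w * cmean (fun z => g (z + w) * conjc (x z))) =
   fun w => cmean (fun w => g w * conjc (x w)) * (v i w * x w).
  apply/funext => w.
  have -> : cmean (fun z => g (z + w) * conjc (x z)) = x w * cmean (fun w =>
      g w * conjc (x w)).
    rewrite -[X in x w * X](cmean_shift hM w); auto; rewrite -(cmeanZ hM); last first.
      exact: (@bddc_shift _ _ _ w (bddcM bg (bddc_conj bx))).
    congr cmean; apply/funext => z; rewrite (charD cx) rmorphM/=.
    have := mulc_conj (x w); rewrite x1 expr1n => xx.
    have -> : x w * (g (z + w) * (conjc (x z) * conjc (x w))) =
       g (z + w) * conjc (x z) * (x w * conjc (x w)) by ring.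
    by rewrite xx mulr1.
  ring.
rewrite (cmeanZ hM); auto.
have vx : cnorm (cmean (fun w => v i w * x w)) <= 1.
  apply: cnorm_le_sqr => //; apply: (le_trans (cmean_CauchySchwarz hM bv bx)).
  by rewrite m1 mul1r; apply: msq_le => // z; rewrite x1.
rewrite -/(conv g (v i) 0) => k1.
have ui0 : Num.sqrt c0 <= cnorm (u i 0).
  by rewrite -[leRHS]ger0_norm ?cnorm_ge0// -sqrtr_sqr ler_wsqrtr.
rewrite -GE in k1.
have k2 : cnorm (G * cmean (fun w => v i w * x w)) <= cnorm G.
  by rewrite cnormM ler_piMr// cnorm_ge0.
have := cnorm_tri (G * cmean (fun w => v i w * x w)) (u i 0) 0.
rewrite !subr0 cnorm_distC; move: ui0 k1; rewrite /u; lra.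
Qed.

End Characters.

Section FourierExpansion.
Context {R : realType} {A : zmodType} (M : (A -> R) -> R).
Hypothesis hM : invariant_mean M.
Local Notation C := R[i].
Local Notation cmean := (@cmean R A M).
Local Notation msq := (@msq R A M).
Local Notation conv := (@conv R A M).
Implicit Types (f g p q v : A -> C).

(** The translates of [N] by the colour representatives cover [A], so [m] times the mean of [N] is
    at least 1. *)
Lemma mean_syndetic (m : nat) (c : A -> 'I_m) (N : set A) :
  (forall z w, c z = c w -> N (z - w)) ->
  0 < M (fun z => (`[< N z >])%:R).
Proof.
move=> cN; have [r hr] := coloring_repr 0 c.
have b1 : bddf (fun z => (`[< N z >])%:R : R).
  by exists 1 => z; case: asboolP => _; rewrite ?normr1 ?normr0.
have h : 1 <= m%:R * M (fun z => (`[< N z >])%:R).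
  rewrite -[leLHS](mean1 hM).
  have -> : m%:R * M (fun z => (`[< N z >])%:R) =
      M (fun z => \sum_(i < m) (`[< N (z - r i) >])%:R).
    rewrite (mean_sum hM) => [|i]; last by have [B hB] := b1; exists B => z; exact: hB.
    rewrite (eq_bigr (fun=> M (fun z => (`[< N z >])%:R))) => [|i _].
      by rewrite sumr_const card_ord mulr_natl.
    exact: (mean_shift hM (- r i) b1).
  apply: (mean_le hM) => //.
    exists m%:R => z; rewrite ger0_norm ?sumr_ge0//.
    rewrite -[leRHS]mulr1 mulr_natl -[X in _ *+ X]card_ord -sumr_const.
    by apply: ler_sum => i _; case: (`[< _ >]).
  move=> z; rewrite (bigD1 (c z))//= (_ : `[< N (z - r (c z)) >] = true).
    by rewrite lerDl sumr_ge0.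
  by apply/asboolP; apply: cN; rewrite hr.
rewrite ltNge; apply/negP => h2.
have : m%:R * M (fun z => (`[< N z >])%:R) <= 0 by rewrite mulr_ge0_le0.
lra.
Qed.

(** The convolution of [g] with its conjugate is the autocorrelation of [g], equal to [msq g] at 0.
    It keeps at least half of this modulus wherever translation moves [g] little, which happens on a
    syndetic set determined by [p] and [k]. Hence [c] is the same for all [g], which makes the
    greedy subtraction of characters stop. *)
Lemma conv_conj_lower p (k : R) : ap_fun p -> bddc p -> 0 < k ->
  exists2 c : R, 0 < c & forall g, bddc g -> k <= msq g ->
   (forall h, msq (fun z => g (z + h) - g z) <= msq (fun z => p (z + h) - p z)) ->
   c * msq g <= msq (conv g (fun w => conjc (g w))).
Proof.
move=> app bp k0.
have e0 : 0 < Num.sqrt (k / 4) by rewrite sqrtr_gt0; lra.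
have [m [c hc]] := app _ e0.
(* On [N], Cauchy-Schwarz bounds the squared deviation of the autocorrelation from [msq g] by
   [k / 4 * msq g], hence by [(msq g / 2) ^+ 2]. *)
pose N : set A := [set h | msq (fun z => p (z + h) - p z) <= k / 4].
have N0 : 0 < M (fun z => (`[< N z >])%:R).
  apply: (mean_syndetic (c := c)) => z w zw; rewrite /N/=.
  rewrite -[leRHS]sqr_sqrtr; last by lra.
  apply: (msq_le hM) => y; have := hc _ _ zw (y - w).
  by rewrite [w + _]addrC subrK [z + _]addrCA.
exists (k / 4 * M (fun z => (`[< N z >])%:R)); first by rewrite mulr_gt0//; lra.
move=> g bg kg hg.
have g0 : 0 < msq g by lra.
have b1 : bddf (fun z => (`[< N z >])%:R : R).
  by exists 1 => z; case: asboolP => _; rewrite ?normr1 ?normr0.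
have bcg : bddc (fun w => conjc (g w)) by auto.
rewrite mulrAC -(meanZ hM)//; apply: (mean_le hM).
- exact: bddfM.
- exact/bddc_sqr/conv_bdd.
move=> z; case: asboolP => [Nz|_]; last by rewrite mulr0 sqr_ge0.
rewrite mulr1.
have d : cnorm (conv g (fun w => conjc (g w)) z - (msq g)%:C%C) <= msq g / 2.
  apply: cnorm_le_sqr; first by lra.
  have -> : (msq g)%:C%C = cmean (fun w => g w * conjc (g w)).
    by under eq_fun do rewrite mulc_conj; rewrite (cmean_real hM).
  have [B hB] := bg; have bgz : bddc (fun w => g (z + w)) by exists B.
  rewrite /conv -(cmeanB hM); auto.
  under eq_fun do rewrite -mulrBl.
  apply: (le_trans (cmean_CauchySchwarz hM _ bcg)); first by auto.
  rewrite msq_conj; have := hg z; have := Nz; rewrite /N/= => h1 h2.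
  have -> : (fun z0 => g (z + z0) - g z0) = (fun y => g (y + z) - g y).
    by apply/funext => y; rewrite (addrC z y).
  nra.
have : msq g <= cnorm (conv g (fun w => conjc (g w)) z - (msq g)%:C%C) +
    cnorm (conv g (fun w => conjc (g w)) z).
  rewrite -[leLHS](ger0_norm (ltW g0)) -cnorm_real cnorm_distC.
  by rewrite (le_trans _ (cnormD _ _))// subrK.
have := cnorm_ge0 (conv g (fun w => conjc (g w)) z).
move: d; set x := cnorm (conv g _ z); set y := cnorm _ => d x0 h.
have : msq g / 2 <= x by lra.
nra.
Qed.

(** A character has mean square 1, so this is Pythagoras for the projection onto it. *)
Lemma msq_sub_char f x : bddc f -> character x ->
  msq (fun z => f z - cmean (fun w => f w * conjc (x w)) * x z) =
  msq f - cnorm (cmean (fun w => f w * conjc (x w))) ^+ 2.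
Proof.
move=> bf cx; set a := cmean _.
have bx : bddc x by apply: bddc_unit; exact: char_unit.
have bfx : bddc (fun w => f w * conjc (x w)) by auto.
rewrite /msq.
have -> : (fun z => cnorm (f z - a * x z) ^+ 2) = fun z =>
   (cnorm (f z) ^+ 2 + (-2) * Re (conjc a * (f z * conjc (x z)))) + cnorm a ^+ 2.
  apply/funext => z; rewrite re_conj_sqr cnormM (char_unit cx) mulr1.
  by rewrite rmorphM/= mulrCA mulNr.
have b1 : bddf (fun z => Re (conjc a * (f z * conjc (x z)))) by auto.
rewrite !(meanD hM); auto; rewrite (meanZ hM)// (mean_cst hM).
have -> : M (fun z => Re (conjc a * (f z * conjc (x z)))) = cnorm a ^+ 2.
  have -> : M (fun z => Re (conjc a * (f z * conjc (x z)))) =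
     Re (cmean (fun z => conjc a * (f z * conjc (x z)))) by [].
  by rewrite (cmeanZ hM)// -/a mulrC mulc_conj.
rewrite /a; ring.
Qed.

(* Greedy: while the remainder is large in mean square it correlates with a    *)
(* character; subtracting its projection lowers the mean square by a fixed amount. *)
Lemma fourier_expansion p (k : R) : ap_fun p -> bddc p -> 0 < k ->
  exists (L : seq (C * (A -> C))) g,
  [/\ List.Forall (fun x => character x.2) L, bddc g, msq g <= k &
      forall z, p z = \sum_(x <- L) x.1 * x.2 z + g z].
Proof.
move=> app bp k0; have [c c0 hc] := conv_conj_lower app bp k0.
have step (n : nat) : exists (L : seq (C * (A -> C))) g,
  [/\ List.Forall (fun x => character x.2) L, bddc g /\ ap_fun g,
      forall h, msq (fun z => g (z + h) - g z) <= msq (fun z => p (z + h) - p z),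
      msq g <= k \/ msq g <= msq p - n%:R * (c / 2) &
      forall z, p z = \sum_(x <- L) x.1 * x.2 z + g z].
  elim: n => [|n [L [g [hL [bg apg] hg hgk hp]]]].
    exists [::], p; split=> //; last by move=> z; rewrite big_nil add0r.
    by right; rewrite mul0r subr0.
  have [gk|gk] := leP (msq g) k; first by exists L, g; split=> //; left.
  have bcg : bddc (fun w => conjc (g w)) by auto.
  have c2 : 0 < c / 2 by lra.
  have [|||x [cx apx hx]] := @large_character _ _ _ hM g (fun w => conjc (g w))
      (c / 2) c bg apg bcg _ c2.
  - by rewrite msq_conj; lra.
  - by lra.
  - by rewrite msq_conj; apply: hc => //; exact: ltW.
  have bx : bddc x by apply: bddc_unit; exact: char_unit.
  set a := cmean (fun w => g w * conjc (x w)) in hx.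
  exists ((a, x) :: L), (fun z => g z - a * x z); split.
  - by constructor.
  - split; first by auto.
    have -> : (fun z => g z - a * x z) = (fun z => g z + (- a) * x z).
      by apply/funext => z; rewrite mulNr.
    by apply: ap_funD => //; exact: ap_funZ.
  - move=> h; apply: le_trans (hg h).
    have bs : bddc (fun z => g (z + h)) by exact: bddc_shift.
    have bgh : bddc (fun z => g (z + h) - g z) by auto.
    have bgx : bddc (fun z => g z * conjc (x z)) by auto.
    (* A translate by [h] has [x h] times the coefficient of [g], so removing the component along
       [x] commutes with differencing and does not increase the mean square of the differences. *)
    have E : cmean (fun w => (g (w + h) - g w) * conjc (x w)) = x h * a - a.
      under eq_fun do rewrite mulrBl.
      rewrite (cmeanB hM); auto; congr (_ - _).
      rewrite /a -(cmean_shift hM h bgx) -(cmeanZ hM); last exact: (bddc_shift h bgx).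
      congr (cmean _); apply/funext => w; rewrite (charD cx) rmorphM/=.
      have := mulc_conj (x h); rewrite (char_unit cx) expr1n => xx.
      have -> : x h * (g (w + h) * (conjc (x w) * conjc (x h))) =
        g (w + h) * conjc (x w) * (x h * conjc (x h)) by ring.
      by rewrite xx mulr1.
    have := msq_sub_char bgh cx; rewrite E.
    have -> : (fun z => g (z + h) - g z - (x h * a - a) * x z) =
        (fun z => g (z + h) - a * x (z + h) - (g z - a * x z)).
      by apply/funext => z; rewrite (charD cx); ring.
    by move=> ->; rewrite lerBlDr lerDl sqr_ge0.
  - right; rewrite msq_sub_char// -/a; case: hgk => hgk; first by lra.
    by rewrite -natr1 mulrDl mul1r; lra.
  - by move=> z; rewrite big_cons/= hp; ring.
(* A round that starts above [k] lowers [msq] by at least [c / 2]; with this many rounds the second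
   alternative would make [msq g] negative. *)
have [L [g [hL [bg _] _ hgk hp]]] := step (Num.truncn (msq p / (c / 2))).+1.
exists L, g; split=> //; case: hgk => // hgk.
have c2 : 0 < c / 2 by lra.
have := archimedean.Num.Theory.truncnS_gt (msq p / (c / 2)).
rewrite ltr_pdivrMr// => h.
have := msq_ge0 hM bg; lra.
Qed.

End FourierExpansion.

(** * Approximation by eigenfunctions of an abelian group action *)

Section EquicontinuousAction.
Context {R : realType} {A : zmodType} {X : Type} (act : A -> X -> X).
Local Notation C := R[i].
Hypothesis actD : forall z w x, act (z + w) x = act z (act w x).
Hypothesis act0 : forall x, act 0 x = x.

(** A bump [p] on [A], vanishing where the action moves [F] by [h = e / 2] or more, acts as an
    approximate identity: the mean of [F] along the orbit with weight [p], divided by the mean [P]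
    of [p], is within [h] of [F]. Replacing [p] by a combination of characters close to it in mean
    square costs another [h], uniformly in [x], by Cauchy-Schwarz. *)
Lemma eigenfunction_approximation (F : X -> C) :
  bddc F ->
  (forall e : R, 0 < e -> exists (m : nat) (c : A -> 'I_m),
     forall z w, c z = c w -> forall x, cnorm (F (act z x) - F (act w x)) <= e) ->
  exists2 M : (A -> R) -> R, invariant_mean M & forall e : R, 0 < e ->
  exists L : seq (C * (A -> C)), List.Forall (fun x => character x.2) L /\
    forall x, cnorm (F x - \sum_(y <- L) y.1 * cmean M (fun w => F (act w x) * y.2 w)) <= e.
Proof.
move=> [B hB] hF; have [M hM] := @invariant_mean_exists R A; exists M => // e e0.
pose h := e / 2; have h0 : 0 < h by rewrite /h; lra.
have [x0|nX] := pselect (exists x0 : X, True); last first.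
  by exists [::]; split=> // x; exfalso; apply: nX; exists x.
case: x0 => x0 _.
have B0 : 0 <= B := le_trans (cnorm_ge0 _) (hB x0).
pose S z : set R := [set r | exists x, r = cnorm (F (act z x) - F x)].
have SB z : has_sup (S z).
  split; first by exists (cnorm (F (act z x0) - F x0)), x0.
  by exists (B + B) => _ [x ->]; rewrite (le_trans (cnormB _ _))// lerD.
pose d z := sup (S z).
have dub z x : cnorm (F (act z x) - F x) <= d z.
  by apply: sup_upper_bound => //; exists x.
have d_le z r : (forall x, cnorm (F (act z x) - F x) <= r) -> d z <= r.
  by move=> hr; apply: ge_sup; [have [] := SB z|move=> _ [x ->]].
have d0 z : 0 <= d z by apply: le_trans (dub z x0); exact: cnorm_ge0.
pose p z : C := (Num.max 0 (h - d z))%:C%C.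
have pB z : cnorm (p z) <= h.
  rewrite cnorm_real ger0_norm ?le_max ?lexx// ge_max ltW//=.
  by rewrite gerBl.
have bp : bddc p by exists h.
have dlip z w r : (forall x, cnorm (F (act z x) - F (act w x)) <= r) -> `|d z - d w| <= r.
  move=> hr; rewrite ler_distl; apply/andP; split.
    rewrite lerBlDr; apply: d_le => x; apply: (le_trans (cnorm_tri (F (act z x)) _ _)).
    by rewrite addrC lerD// cnorm_distC.
  apply: d_le => x; apply: (le_trans (cnorm_tri (F (act w x)) _ _)).
  by rewrite addrC lerD.
have app : ap_fun p.
  move=> r r0; have [m [c hc]] := hF _ r0; exists m, c => z w zw s.
  have -> : p (z + s) - p (w + s) =
      (Num.max 0 (h - d (z + s)) - Num.max 0 (h - d (w + s)))%:C%C.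
    by rewrite rmorphB.
  rewrite cnorm_real.
  have : `|d (z + s) - d (w + s)| <= r.
    by apply: dlip => x; rewrite !actD; exact: hc.
  have := d0 (z + s); have := d0 (w + s); rewrite !ler_distl.
  move=> h1 h2 /andP[h3 h4]; rewrite /Num.max; do 2![case: ifP => ?]; lra.
pose P : R := M (fun z => Num.max 0 (h - d z)).
have bmax : bddf (fun z => Num.max 0 (h - d z)).
  by exists h => z; have := pB z; rewrite cnorm_real.
have P0 : 0 < P.
  have h2 : 0 < h / 2 by lra.
  have [m [c hc]] := hF _ h2.
  (* This set contains all differences of equally coloured elements, and [p] is at least [h / 2] on
     it. *)
  pose N : set A := [set z | d z <= h / 2].
  have N0 : 0 < M (fun z => (`[< N z >])%:R).
    apply: (mean_syndetic hM (c := c)) => z w zw; rewrite /N/=; apply: d_le => x.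
    by have := hc _ _ zw (act (- w) x); rewrite -!actD subrr act0.
  have b1 : bddf (fun z => (`[< N z >])%:R : R).
    by exists 1 => z; case: asboolP => _; rewrite ?normr1 ?normr0.
  apply: (@lt_le_trans _ _ (h / 2 * M (fun z => (`[< N z >])%:R))).
    exact: mulr_gt0.
  rewrite -(meanZ hM)//; apply: (mean_le hM) => //; first exact: bddfM.
  move=> z; case: asboolP => [|_]; last by rewrite mulr0 le_max lexx.
  by rewrite /N/= => Nz; rewrite mulr1 le_max; apply/orP; right; lra.
(* A remainder of mean square [k], paired with a function bounded by [B], contributes at most
   [h * P]. *)
pose k := (h * P / (B + 1)) ^+ 2.
have hPB : 0 < h * P / (B + 1) by rewrite !divr_gt0 ?mulr_gt0//; lra.
have k0 : 0 < k by rewrite exprn_gt0.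
have [L [g [hL bg gk hp]]] := fourier_expansion hM app bp k0.
have bF x : bddc (fun w => F (act w x)) by exists B.
exists [seq (y.1 / P%:C%C, y.2) | y <- L]; split.
  by elim: hL => [|y L' hy _ IH]; constructor.
move=> x; rewrite big_map/=.
have PC : P%:C%C != 0 :> C by rewrite -cnorm_eq0 cnorm_real normr_eq0 gt_eqF.
have sumE : bddc (fun w => \sum_(y <- L) y.1 * y.2 w) /\
  cmean M (fun w => F (act w x) * \sum_(y <- L) y.1 * y.2 w) =
  \sum_(y <- L) y.1 * cmean M (fun w => F (act w x) * y.2 w).
  elim: hL {hp} => [|y L' hy _ [bs IH]].
    have -> : (fun w : A => \sum_(y <- [::]) y.1 * (y.2 : A -> C) w) = fun=> 0 :> C.
      by apply/funext => w; rewrite big_nil.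
    split; first by auto.
    by under eq_fun do rewrite big_nil mulr0; rewrite (cmean_cst hM) big_nil.
  have by2 : bddc y.2 by apply: bddc_unit; exact: char_unit.
  have by12 : bddc (fun w => y.1 * y.2 w) by auto.
  have -> : (fun w => \sum_(y <- y :: L') y.1 * y.2 w) =
      fun w => y.1 * y.2 w + \sum_(y <- L') y.1 * y.2 w.
    by apply/funext => w; rewrite big_cons.
  split; first by auto.
  rewrite big_cons -IH -(cmeanZ hM); last by auto.
  rewrite -(cmeanD hM); [|by auto..].
  by congr cmean; apply/funext => w; rewrite big_cons; ring.
case: sumE => bs sumE.
have E1 : cmean M (fun w => F (act w x) * p w) =
   \sum_(y <- L) y.1 * cmean M (fun w => F (act w x) * y.2 w) + cmean M (fun w => F
       (act w x) * g w).
  rewrite -sumE -(cmeanD hM); auto; congr cmean; apply/funext => w.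
  by rewrite hp mulrDr.
have E2 : \sum_(y <- L) y.1 / P%:C%C * cmean M (fun w => F (act w x) * y.2 w) =
   (P%:C%C)^-1 * (\sum_(y <- L) y.1 * cmean M (fun w => F (act w x) * y.2 w)).
  by rewrite mulr_sumr; apply: eq_bigr => y _; ring.
rewrite E2.
have -> : \sum_(y <- L) y.1 * cmean M (fun w => F (act w x) * y.2 w) =
  cmean M (fun w => F (act w x) * p w) - cmean M (fun w => F (act w x) * g w).
  by rewrite E1 addrK.
have n1 : cnorm (cmean M (fun w => F (act w x) * g w)) <= h * P.
  apply: cnorm_le_sqr; first by rewrite mulr_ge0// ltW.
  apply: (le_trans (cmean_CauchySchwarz hM (bF x) bg)).
  have F2 : msq M (fun w => F (act w x)) <= B ^+ 2 by apply: (msq_le hM).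
  apply: (le_trans (ler_pM (msq_ge0 hM (bF x)) (msq_ge0 hM bg) F2 gk)).
  rewrite /k expr_div_n mulrA ler_pdivrMr ?exprn_gt0//; last by lra.
  by rewrite [leRHS]mulrC ler_wpM2r ?sqr_ge0// ler_sqr ?nnegrE; lra.
have n2 : cnorm (F x * P%:C%C - cmean M (fun w => F (act w x) * p w)) <= h * P.
  have -> : F x * P%:C%C = cmean M (fun w => F x * p w).
    by rewrite (cmeanZ hM)// /p (cmean_real hM).
  rewrite -(cmeanB hM); auto; apply: (le_trans (cmean_norm hM _)); first by auto.
  rewrite /P -(meanZ hM)//; apply: (mean_le hM).
  - by apply: bddc_cnorm; auto.
  - exact: bddfM.
  move=> w; rewrite -mulrBl cnormM cnorm_real ger0_norm ?le_max ?lexx//.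
  have [dh|dh] := leP (d w) h.
    rewrite ler_wpM2r ?le_max ?lexx//.
    by rewrite cnorm_distC (le_trans (dub w x)).
  by rewrite (max_idPl _) ?mulr0//; lra.
have -> : F x - (P%:C%C)^-1 * (cmean M (fun w => F (act w x) * p w) - cmean M
    (fun w => F (act w x) * g w)) =
  (P%:C%C)^-1 * ((F x * P%:C%C - cmean M (fun w => F (act w x) * p w)) + cmean M
      (fun w => F (act w x) * g w)).
  by field.
rewrite cnormM cnormV cnorm_real (gtr0_norm P0) mulrC ler_pdivrMr//.
apply: (le_trans (cnormD _ _)); have -> : e * P = h * P + h * P by rewrite /h; field.
exact: lerD.
Qed.

End EquicontinuousAction.

(** Real and imaginary parts are rounded on a grid of mesh [e / 2]. *)
Lemma cnorm_bounded_coloring {R : realType} (B e : R) : 0 < e ->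
  exists (m : nat) (c : R[i] -> 'I_m), forall x y,
    cnorm x <= B -> cnorm y <= B -> c x = c y -> cnorm (x - y) <= e.
Proof.
move=> e0; pose K := 2 / e; have K0 : 0 < K by rewrite divr_gt0.
pose m := (Num.truncn ((B + B) * K)).+1.
pose q (r : R) : 'I_m := inord (Num.truncn ((r + B) * K)).
have hq r s : `|r| <= B -> `|s| <= B -> q r = q s -> `|r - s| <= e / 2.
  rewrite !ler_norml => /andP[r1 r2] /andP[s1 s2] /(congr1 val).
  have r0 : 0 <= (r + B) * K by apply: mulr_ge0; [lra|exact: ltW].
  have s0 : 0 <= (s + B) * K by apply: mulr_ge0; [lra|exact: ltW].
  rewrite /q /= !inordK ?ltnS; first last.
  - by apply: archimedean.Num.Theory.le_truncn; rewrite ler_pM2r//; lra.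
  - by apply: archimedean.Num.Theory.le_truncn; rewrite ler_pM2r//; lra.
  move=> h.
  have /andP[ra rb] := archimedean.Num.Theory.truncn_itv r0.
  have /andP[sa sb] := archimedean.Num.Theory.truncn_itv s0.
  rewrite h in ra rb; move: rb sb; rewrite -natr1 => rb sb.
  have eK : e / 2 * K = 1 by rewrite /K; field; rewrite gt_eqF.
  move: ra rb sa sb; rewrite !mulrDl => ra rb sa sb.
  by apply/andP; split; rewrite -(ler_pM2r K0) ?mulNr eK mulrBl; lra.
exists #|{: 'I_m * 'I_m}|, (fun x => enum_rank (q (Re x), q (Im x))) => x y xB yB.
move=> /enum_rank_inj[h1 h2]; apply: (le_trans (cnorm_ReIm _)).
have := hq _ _ (le_trans (cnorm_Re x) xB) (le_trans (cnorm_Re y) yB) h1.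
have := hq _ _ (le_trans (cnorm_Im x) xB) (le_trans (cnorm_Im y) yB) h2.
by case: x {xB h1 h2} => a b; case: y {yB} => c d /=; lra.
Qed.

(** * Uniform means of sequences *)

Section IntervalSums.
Context {R : realType}.
Local Notation C := R[i].
Implicit Types (b : int -> C) (m n t d : int) (l : nat) (e : R).

Definition wsum b m l : C := \sum_(0 <= k < l) b (m + k%:Z).

(** Stated with sums instead of quotients, so that lengths add and [l = 0] is no exception;
    uniformity in [m] gives independence of the intervals. *)
Definition uniform_mean b (c : C) := forall e : R, 0 < e ->
  exists L : nat, forall m l, (L <= l)%N ->
    cnorm (wsum b m l - c * l%:R) <= e * l%:R.

Lemma wsum_cat b m l l' : wsum b m (l + l') = wsum b m l + wsum b (m + l%:Z) l'.
Proof.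
rewrite /wsum (big_cat_nat (n := l)) ?leq_addr//=; congr (_ + _).
rewrite -{1}(add0n l) big_addn addnC addnK; apply: eq_big_nat => k _.
by rewrite PoszD [k%:Z + _]addrC addrA.
Qed.

Lemma wsumD b b' m l : wsum (fun n => b n + b' n) m l = wsum b m l + wsum b' m l.
Proof. by rewrite /wsum big_split. Qed.

Lemma wsumZ (c : C) b m l : wsum (fun n => c * b n) m l = c * wsum b m l.
Proof. by rewrite /wsum mulr_sumr. Qed.

Lemma wsum_le b m l e : (forall k, (k < l)%N -> cnorm (b (m + k%:Z)) <= e) ->
  cnorm (wsum b m l) <= e * l%:R.
Proof.
move=> h; apply: (le_trans (cnorm_sum _ _ _)).
have : \sum_(0 <= k < l) cnorm (b (m + k%:Z)) <= \sum_(0 <= k < l) e.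
  by apply: ler_sum_nat => k /andP[_ kl]; exact: h.
by rewrite sumr_const_nat subn0 mulr_natr.
Qed.

Lemma wsum_dist b m m' l e : (forall k, (k < l)%N -> cnorm (b (m + k%:Z) - b
    (m' + k%:Z)) <= e) ->
  cnorm (wsum b m l - wsum b m' l) <= e * l%:R.
Proof.
move=> h; have -> : wsum b m l - wsum b m' l = wsum (fun k => b (m + k) - b (m' + k)) 0 l.
  by rewrite /wsum -sumrB; apply: eq_bigr => k _; rewrite add0r.
by apply: wsum_le => k kl; rewrite add0r; exact: h.
Qed.

Section Bounded.
Variables (b : int -> C) (b1 : forall n, cnorm (b n) <= 1).

Lemma wsum_bound m l : cnorm (wsum b m l) <= l%:R.
Proof. by rewrite -[leRHS]mul1r; apply: wsum_le => k _; exact: b1. Qed.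

Lemma wsum_shift m t l : cnorm (wsum b (m + t) l - wsum b m l) <= 2 * `|t|%N%:R.
Proof.
have key (m' : int) (k : nat) : cnorm (wsum b (m' + k%:Z) l - wsum b m' l) <= 2 * k%:R.
  have e1 := wsum_cat b m' k l; have e2 := wsum_cat b m' l k.
  rewrite addnC e2 in e1.
  have -> : wsum b (m' + k%:Z) l - wsum b m' l = wsum b (m' + l%:Z) k - wsum b m' k.
    have -> : wsum b (m' + l%:Z) k = wsum b m' k + wsum b (m' + k%:Z) l - wsum b m' l.
      by rewrite -e1; ring.
    by ring.
  apply: (le_trans (cnormB _ _)).
  by have := wsum_bound (m' + l%:Z) k; have := wsum_bound m' k; lra.
case: t => k; first by exact: key.
rewrite NegzE abszN absz_nat cnorm_distC.
by have := key (m - k.+1%:Z) k.+1; rewrite subrK.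
Qed.

End Bounded.

(** The approximate means are bounded, since any two of them are compared on a common long window;
    an ultralimit of them is the mean. *)
Lemma uniform_mean_of_approx b : (forall e : R, 0 < e -> exists (c : C) (L : nat),
    forall m l, (L <= l)%N -> cnorm (wsum b m l - c * l%:R) <= e * l%:R) ->
  exists c, uniform_mean b c.
Proof.
move=> h.
have H (k : nat) : exists c : C, exists L : nat, forall m l, (L <= l)%N ->
     cnorm (wsum b m l - c * l%:R) <= k.+1%:R^-1 * l%:R.
  by apply: h; rewrite invr_gt0 ltr0Sn.
have [c hc] := choice H.
have inv1 (k : nat) : k.+1%:R^-1 <= 1 :> R by rewrite invf_le1 ?ltr0Sn// ler1n.
have cB k : cnorm (c k) <= cnorm (c 0%N) + 2.
  have [L0 h0] := hc 0%N; have [Lk hk] := hc k.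
  pose l := (maxn L0 Lk).+1.
  have a0 := h0 0 l (leq_trans (leq_maxl _ _) (leqnSn _)).
  have ak := hk 0 l (leq_trans (leq_maxr _ _) (leqnSn _)).
  have l0 : 0 < (l%:R : R) by rewrite ltr0Sn.
  have : cnorm (c k * l%:R - c 0%N * l%:R) <= 2 * l%:R.
    apply: (le_trans (cnorm_tri (wsum b 0 l) _ _)); rewrite cnorm_distC.
    apply: (le_trans (lerD ak a0)); rewrite -mulrDl ler_pM2r//.
    by apply: (le_trans (lerD (inv1 k) (inv1 0%N))).
  rewrite -mulrBl cnormM cnorm_nat ler_pM2r// => h2.
  have := cnormD (c 0%N) (c k - c 0%N); rewrite addrC subrK; lra.
have [U [UU sU]] := ultraFilterLemma (_ : ProperFilter \oo).
have [x hx] := is_culim_exists cB.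
exists x => e e0; pose d := e / 2; have d0 : 0 < d by rewrite /d; lra.
have tail : U [set k : nat | k.+1%:R^-1 <= d].
  apply: sU; exists (Num.truncn d^-1) => // k /= hk.
  rewrite -[leRHS]invrK lef_pV2 ?posrE ?invr_gt0 ?ltr0Sn//.
  by rewrite (le_trans (ltW (archimedean.Num.Theory.truncnS_gt _)))// ler_nat ltnS.
have [k /= [k1 k2]] := filter_ex (filterI tail (hx _ d0)).
have [L hL] := hc k; exists L => m l lL.
apply: (le_trans (cnorm_tri (c k * l%:R) _ _)).
rewrite -mulrBl [X in _ + X]cnormM cnorm_nat.
have l0 : 0 <= (l%:R : R) by [].
have -> : e * l%:R = d * l%:R + d * l%:R by rewrite /d; field.
apply: lerD; last by rewrite ler_wpM2r.
by apply: (le_trans (hL m l lL)); rewrite ler_wpM2r.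
Qed.

Lemma uniform_mean_add b b' c c' : uniform_mean b c -> uniform_mean b' c' ->
  uniform_mean (fun n => b n + b' n) (c + c').
Proof.
move=> h h' e e0; have e2 : 0 < e / 2 by lra.
have [L hL] := h _ e2; have [L' hL'] := h' _ e2; exists (maxn L L') => m l.
rewrite geq_max => /andP[l1 l2].
have -> : wsum (fun n => b n + b' n) m l - (c + c') * l%:R =
   (wsum b m l - c * l%:R) + (wsum b' m l - c' * l%:R) by rewrite wsumD; ring.
by apply: (le_trans (cnormD _ _)); have := hL m _ l1; have := hL' m _ l2; lra.
Qed.

Lemma uniform_mean_scale (a : C) b c : uniform_mean b c ->
  uniform_mean (fun n => a * b n) (a * c).
Proof.
move=> h e e0; have a0 : 0 < cnorm a + 1 by have := cnorm_ge0 a; lra.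
have [L hL] := h _ (divr_gt0 e0 a0); exists L => m l lL.
rewrite wsumZ -mulrA -mulrBr cnormM.
apply: (le_trans (ler_wpM2l (cnorm_ge0 _) (hL m _ lL))).
rewrite mulrA ler_wpM2r// mulrA ler_pdivrMr// mulrC ler_wpM2l//; [exact: ltW|lra].
Qed.

Lemma uniform_mean_uniform_limit b :
  (forall e : R, 0 < e -> exists2 b', (exists c, uniform_mean b' c) &
     forall n, cnorm (b n - b' n) <= e) ->
  exists c, uniform_mean b c.
Proof.
move=> h; apply: uniform_mean_of_approx => e e0.
have e2 : 0 < e / 2 by lra.
have [b' [c hc] hb] := h _ e2; have [L hL] := hc _ e2; exists c, L => m l lL.
have : cnorm (wsum b m l - wsum b' m l) <= e / 2 * l%:R.
  have -> : wsum b m l - wsum b' m l = wsum (fun n => b n - b' n) m l.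
    by rewrite /wsum -sumrB.
  by apply: wsum_le => k _; exact: hb.
have := hL m l lL; have := cnorm_tri (wsum b' m l) (wsum b m l) (c * l%:R).
lra.
Qed.

(** Total boundedness of the set of translates in the uniform norm, with the net taken among the
    translates themselves. *)
Definition bohr_ap b := forall e : R, 0 < e -> exists s : seq int,
  forall t, exists2 t0, t0 \in s & forall n, cnorm (b (n + t) - b (n + t0)) <= e.

(** Every window is close to one that starts in the finite net [s], and moving that one to 0 costs a
    constant; so all long windows have nearly equal averages. A much longer window is cut into
    blocks of length [L]: the blocks contribute an error [2 * d] and the incomplete one at most
    [d]. *)
Lemma bohr_uniform_mean b : (forall n, cnorm (b n) <= 1) -> bohr_ap b ->
  exists c, uniform_mean b c.
Proof.
move=> b1 hb; apply: uniform_mean_of_approx => e e0.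
pose d := e / 4; have d0 : 0 < d by rewrite /d; lra.
have [s hs] := hb _ d0.
pose T := \max_(x <- s) `|x|%N.
have hT t : t \in s -> (`|t|%N <= T)%N by move=> ts; rewrite /T; exact: leq_bigmax_seq.
pose L := (Num.truncn (2 * T%:R / d)).+1.
have base m l : (L <= l)%N -> cnorm (wsum b m l - wsum b 0 l) <= 2 * d * l%:R.
  move=> lL; have [t0 t0s ht] := hs m.
  have a1 : cnorm (wsum b m l - wsum b t0 l) <= d * l%:R.
    by apply: wsum_dist => k _; rewrite ![_ + k%:Z]addrC; exact: ht.
  have a2 := wsum_shift b1 0 t0 l; rewrite add0r in a2.
  have a3 : 2 * `|t0|%N%:R <= d * l%:R :> R.
    apply: (@le_trans _ _ (2 * T%:R)); first by rewrite ler_wpM2l// ler_nat; exact: hT.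
    rewrite mulrC -[leRHS]mulrC -ler_pdivrMr// [X in X / d]mulrC.
    by rewrite (le_trans (ltW (archimedean.Num.Theory.truncnS_gt _)))// ler_nat.
  have := cnorm_tri (wsum b t0 l) (wsum b m l) (wsum b 0 l); lra.
pose c := wsum b 0 L / L%:R.
have Lp : 0 < (L%:R : R) by rewrite ltr0Sn.
have LC : (L%:R : C) != 0 by rewrite pnatr_eq0.
have cL : c * L%:R = wsum b 0 L by rewrite /c mulfVK.
have c1 : cnorm c <= 1.
  by rewrite cnormM cnormV cnorm_nat ler_pdivrMr// mul1r; exact: wsum_bound.
have mult q : forall m, cnorm (wsum b m (q * L) - c * (q * L)%:R) <= 2 * d * (q * L)%:R.
  elim: q => [|q IH] m.
    by rewrite mul0n /wsum big_geq// mulr0 subr0 cnorm0 mulr0.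
  rewrite mulSn wsum_cat !natrD.
  have -> : wsum b m L + wsum b (m + L%:Z) (q * L) - c * (L%:R + (q * L)%:R) =
    (wsum b m L - wsum b 0 L) + (wsum b (m + L%:Z) (q * L) - c * (q * L)%:R).
    by rewrite -cL; ring.
  apply: (le_trans (cnormD _ _)); rewrite mulrDr; apply: lerD => //; exact: base.
exists c, (Num.truncn (2 * L%:R / d)).+1 => m l lL.
have a3 : 2 * L%:R <= d * l%:R :> R.
  rewrite mulrC -[leRHS]mulrC -ler_pdivrMr// [X in X / d]mulrC.
  by rewrite (le_trans (ltW (archimedean.Num.Theory.truncnS_gt _)))// ler_nat.
rewrite (divn_eq l L) wsum_cat; set q := (l %/ L)%N; set r := (l %% L)%N.
have rL : (r%:R : R) <= L%:R by rewrite ler_nat ltnW// ltn_pmod.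
have -> : wsum b m (q * L) + wsum b (m + (q * L)%:Z) r - c * (q * L + r)%:R =
  (wsum b m (q * L) - c * (q * L)%:R) + (wsum b (m + (q * L)%:Z) r - c * r%:R).
  by rewrite natrD; ring.
have qL : ((q * L)%:R : R) <= l%:R by rewrite ler_nat [leqRHS](divn_eq l L) leq_addr.
have e1 := mult q m.
have e2 := wsum_bound b1 (m + (q * L)%:Z) r.
have e3 : cnorm (c * r%:R) <= r%:R by rewrite cnormM cnorm_nat ler_piMl.
apply: (le_trans (cnormD _ _)).
have e4 := cnormB (wsum b (m + (q * L)%:Z) r) (c * r%:R).
have e5 : 2 * d * (q * L)%:R <= 2 * d * l%:R by rewrite ler_wpM2l//; lra.
rewrite -divn_eq.
apply: (@le_trans _ _ (2 * d * l%:R + d * l%:R)); first by lra.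
by rewrite -mulrDl ler_wpM2r// /d; lra.
Qed.

End IntervalSums.

(** * Separation of frequencies *)

Section Spacing.
Context {R : realType}.
Local Notation C := R[i].

Lemma geometric_sum_bound (z : C) (L : nat) : cnorm z = 1 ->
  cnorm (\sum_(n < L) z ^+ n) * cnorm (z - 1) <= 2.
Proof.
move=> z1; rewrite -cnormM mulrC -subrX1.
by apply: (le_trans (cnormB _ _)); rewrite cnormX z1 expr1n cnorm1.
Qed.

Lemma exists_phase (S : C) : exists w : C, cnorm w = 1 /\ w * S = (cnorm S)%:C%C.
Proof.
have [->|S0] := eqVneq S 0; first by exists 1; rewrite cnorm1 cnorm0 mulr0.
have n0 : cnorm S != 0 by rewrite cnorm_eq0.
exists (conjc S * (cnorm S)^-1%:C%C); split.
  by rewrite cnormM cnorm_conj cnorm_real normfV ger0_norm ?cnorm_ge0// divff.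
rewrite mulrAC [conjc S * S]mulrC mulc_conj -rmorphM/=; congr (_%:C)%C.
by rewrite expr2 mulfK.
Qed.

(* A large sieve with no attempt at good constants: Bessel's inequality for   *)
(* almost orthogonal exponentials.                                            *)
Lemma spaced_frequencies (I : finType) (D : {set I}) (L : nat) (x : I -> C)
    (a : nat -> C) (d : R) :
  (0 < L)%N -> 0 < d -> (forall n, cnorm (a n) <= 1) ->
  (forall i, i \in D -> cnorm (x i) = 1) ->
  (forall i, i \in D -> d * L%:R <= cnorm (\sum_(n < L) x i ^+ n * a n)) ->
  (forall i j, i \in D -> j \in D -> i != j ->
     4 / d ^+ 2 <= cnorm (x i - x j) * L%:R) ->
  #|D|%:R <= 2 / d ^+ 2.
Proof.
move=> L0 d0 a1 x1 hS sep.
have Lp : 0 < (L%:R : R) by rewrite ltr0n.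
pose S i := \sum_(n < L) x i ^+ n * a n.
(* Duality: phases [w i] that make every [S i] nonnegative turn the sum of their moduli into a
   pairing of [a] with the single exponential sum [T]. *)
have [w hw] := choice (fun i => exists_phase (S i)).
have w1 i : cnorm (w i) = 1 by have [] := hw i.
pose T n := \sum_(i in D) w i * x i ^+ n.
pose J : R := #|D|%:R.
have sumS : J * (d * L%:R) <= \sum_(n < L) cnorm (T n).
  have E : (\sum_(i in D) cnorm (S i))%:C%C = \sum_(n < L) a n * T n.
    rewrite rmorph_sum/= (eq_bigr (fun i => \sum_(n < L) a n * (w i * x i ^+ n))).
      by rewrite exchange_big; apply: eq_bigr => n _; rewrite mulr_sumr.
    move=> i _; have [_ <-] := hw i; rewrite mulr_sumr.
    by apply: eq_bigr => n _; ring.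
  apply: (@le_trans _ _ (\sum_(i in D) cnorm (S i))).
    by rewrite /J mulr_natl -sumr_const; apply: ler_sum => i iD; exact: hS.
  rewrite -[leLHS]ger0_norm ?sumr_ge0// => [|i _]; last exact: cnorm_ge0.
  rewrite -cnorm_real E; apply: (le_trans (cnorm_sum _ _ _)).
  by apply: ler_sum => n _; rewrite cnormM ler_piMl ?cnorm_ge0.
pose z i j := x i * conjc (x j).
pose G i j := \sum_(n < L) z i j ^+ n.
(* The geometric sum is at most 2 / |x i - x j|; the separation 4 / d^2 is what makes this at most
   [d ^+ 2 / 2 * L%:R]. *)
have Gd i j : i \in D -> j \in D ->
    cnorm (G i j) <= (if i == j then L%:R else d ^+ 2 / 2 * L%:R).
  move=> iD jD; have z1 : cnorm (z i j) = 1 by rewrite cnormM cnorm_conj !x1// mulr1.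
  have [ij|ij] := eqVneq i j.
    apply: (le_trans (cnorm_sum _ _ _)).
    rewrite (eq_bigr (fun=> 1)) => [|n _]; last by rewrite cnormX z1 expr1n.
    by rewrite sumr_const card_ord.
  have zx : cnorm (z i j - 1) = cnorm (x i - x j).
    have -> : z i j - 1 = (x i - x j) * conjc (x j).
      by rewrite mulrBl mulc_conj x1// expr1n.
    by rewrite cnormM cnorm_conj x1// mulr1.
  have := geometric_sum_bound L z1; rewrite zx -/(G i j) => hG.
  have hs := sep i j iD jD ij.
  have d2 : 0 < d ^+ 2 by rewrite exprn_gt0.
  have p4 : 0 < 4 / d ^+ 2 by rewrite divr_gt0.
  rewrite -(ler_pM2r p4).
  have -> : d ^+ 2 / 2 * L%:R * (4 / d ^+ 2) = 2 * L%:R by field; rewrite gt_eqF.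
  apply: (le_trans (ler_wpM2l (cnorm_ge0 _) hs)).
  by rewrite mulrA ler_wpM2r.
pose Q := \sum_(n < L) cnorm (T n) ^+ 2.
have QE : Q%:C%C = \sum_(i in D) \sum_(j in D) w i * conjc (w j) * G i j.
  rewrite rmorph_sum/=.
  rewrite (eq_bigr (fun n : 'I_L => \sum_(i in D) \sum_(j in D)
       w i * conjc (w j) * z i j ^+ n)); last first.
    move=> n _; rewrite -mulc_conj rmorph_sum/= mulr_suml; apply: eq_bigr => i _.
    rewrite mulr_sumr; apply: eq_bigr => j _; rewrite rmorphM/= rmorphXn/= /z exprMn.
    by ring.
  rewrite exchange_big; apply: eq_bigr => i _; rewrite exchange_big/=.
  by apply: eq_bigr => j _; rewrite mulr_sumr.
have Q0 : 0 <= Q by apply: sumr_ge0 => n _; exact: sqr_ge0.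
have QB : Q <= J * L%:R + J ^+ 2 * (d ^+ 2 / 2 * L%:R).
  rewrite -[leLHS]ger0_norm// -cnorm_real QE; apply: (le_trans (cnorm_sum _ _ _)).
  have row i : i \in D -> cnorm (\sum_(j in D) w i * conjc (w j) * G i j) <=
      L%:R + J * (d ^+ 2 / 2 * L%:R).
    move=> iD; apply: (le_trans (cnorm_sum _ _ _)).
    rewrite (bigD1 i)//=; apply: lerD.
      by rewrite !cnormM cnorm_conj !w1 !mul1r; have := Gd i i iD iD; rewrite eqxx.
    apply: (@le_trans _ _ (\sum_(j in D | j != i) (d ^+ 2 / 2 * L%:R))).
      apply: ler_sum => j /andP[jD ji]; rewrite !cnormM cnorm_conj !w1 !mul1r.
      by have := Gd i j iD jD; rewrite eq_sym (negPf ji).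
    have c0 : 0 <= d ^+ 2 / 2 * L%:R by rewrite mulr_ge0 ?divr_ge0 ?sqr_ge0.
    rewrite /J mulr_natl -sumr_const [leRHS](bigD1 i)//=.
    by rewrite lerDr.
  apply: (le_trans (ler_sum _ row)).
  have -> : J * L%:R + J ^+ 2 * (d ^+ 2 / 2 * L%:R) = J * (L%:R + J * (d ^+ 2 / 2 * L%:R)).
    by ring.
  by rewrite sumr_const {1}/J [leRHS]mulr_natl.
have J0 : 0 <= J by [].
(* This is 2xy <= x^2 + y^2 with x = |T n| and y = J d, the lower bound for the average of |T n|.
   Together with [QB] it leaves J d^2 <= 2 unless J = 0. *)
have main : 2 * (J * d) * (J * (d * L%:R)) <= Q + (J * d) ^+ 2 * L%:R.
  apply: (@le_trans _ _ (2 * (J * d) * \sum_(n < L) cnorm (T n))).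
    by rewrite ler_wpM2l// mulr_ge0// mulr_ge0// ltW.
  have -> : (J * d) ^+ 2 * L%:R = \sum_(n < L) (J * d) ^+ 2.
    by rewrite sumr_const card_ord mulr_natr.
  rewrite mulr_sumr -big_split; apply: ler_sum => n _ /=.
  by have := sqr_ge0 (cnorm (T n) - J * d); nra.
have fin : J * (J * d ^+ 2) <= J * 2.
  rewrite -(ler_pM2r Lp); move: main QB; rewrite !exprMn; nra.
rewrite -/J; have [->|Jn] := eqVneq J 0.
  by rewrite divr_ge0// sqr_ge0.
have Jp : 0 < J by rewrite lt0r Jn.
by rewrite ler_pdivlMr ?exprn_gt0//; rewrite ler_pM2l in fin.
Qed.

Lemma cnorm_exprz_dist (x y : C) (n : int) : cnorm x = 1 -> cnorm y = 1 ->
  cnorm (x ^ n - y ^ n) <= `|n|%N%:R * cnorm (x - y).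
Proof.
move=> x1 y1.
have key (u v : C) (k : nat) : cnorm u = 1 -> cnorm v = 1 ->
    cnorm (u ^+ k - v ^+ k) <= k%:R * cnorm (u - v).
  move=> u1 v1; elim: k => [|k IH]; first by rewrite !expr0 subrr cnorm0 mul0r.
  have -> : u ^+ k.+1 - v ^+ k.+1 = u * (u ^+ k - v ^+ k) + (u - v) * v ^+ k.
    by rewrite !exprS; ring.
  apply: (le_trans (cnormD _ _)); rewrite !cnormM cnormX u1 v1 expr1n mul1r mulr1.
  by rewrite -natr1 mulrDl mul1r lerD2r.
case: n => k; first exact: key.
have inv : cnorm (x^-1 - y^-1) = cnorm (x - y).
  have xn := unit_neq0 x1; have yn := unit_neq0 y1.
  have -> : x^-1 - y^-1 = - (x^-1 * y^-1 * (x - y)) by field; rewrite xn yn.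
  by rewrite cnormN !cnormM !cnormV x1 y1 invr1 !mul1r.
rewrite NegzE abszN absz_nat -!exprz_inv -inv.
by apply: key; rewrite cnormV ?x1 ?y1 invr1.
Qed.

End Spacing.

(** * The dichotomy for modulated orbits *)

Section Dichotomy.
Context {R : realType}.
Local Notation C := R[i].
Implicit Types (b : int -> C) (m n t d : int) (l : nat) (e : R).

(** The finitely many [k i] are fixed before [t], whereas the phase [x] may vary freely with [t];
    with all phases equal to 1 this would be [bohr_ap]. *)
Definition modulated_orbit b := forall e : R, 0 < e ->
  exists (r : nat) (k : 'I_r -> int), forall t, exists (i : 'I_r) (x : C),
    cnorm x = 1 /\ forall n, cnorm (b (n + t) - x ^ n * b (n + k i)) <= e.

Lemma pigeonhole_card (I : finType) (m : nat) (D : {set I}) (f : I -> 'I_m) (J : nat) :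
  (m * J < #|D|)%N -> exists c : 'I_m, (J < #|[set i in D | f i == c]|)%N.
Proof.
move=> h; apply: contrapT => n; move: h; rewrite ltnNge => /negP; apply.
have -> : #|D| = (\sum_(c : 'I_m) #|[set i in D | f i == c]|)%N.
  rewrite -sum1_card (partition_big f xpredT)//=; apply: eq_bigr => c _.
  by rewrite -sum1_card; apply: eq_bigl => i; rewrite inE.
rewrite -[X in (_ <= X * _)%N]card_ord -sum_nat_const; apply: leq_sum => c _.
by rewrite leqNgt; apply/negP => hc; apply: n; exists c.
Qed.

Section Recurrence.
Variables (b : int -> C) (b1 : forall n, cnorm (b n) <= 1).
Variables (dl : R) (dl0 : 0 < dl).
Hypothesis big : forall L0 : nat, exists m l, (L0 <= l)%N /\
  dl * l%:R < cnorm (wsum b m l).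

(** Let [k] run over a very long interval with large average. For each [i] the windows at [k + t i]
    average to that of the interval, up to boundary effects of size [T + L], so some [k] makes the
    sum of their moduli at least [dl / 2 * Q%:R * L%:R]. Windows below the level [dl / 4] account
    for at most half of this. *)
Lemma many_large_windows (Q L T : nat) (t : 'I_Q -> int) :
  (0 < L)%N -> (forall i, (`|t i| <= T)%N) ->
  exists k, dl / 4 * Q%:R <=
    #|[set i : 'I_Q | dl / 4 * L%:R <= cnorm (wsum b (k + t i) L)]%SET|%:R.
Proof.
move=> L0 hT.
have Lp : 0 < (L%:R : R) by rewrite ltr0n.
pose W : nat := (T + L)%N.
have [m [l [hl hb]]] := big (Num.truncn (4 * W%:R / dl)).+1.
have lp : 0 < (l%:R : R) by rewrite ltr0n (leq_trans _ hl).
have Wl : 4 * W%:R <= dl * l%:R.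
  rewrite mulrC -[leRHS]mulrC -ler_pdivrMr// [X in X / dl]mulrC.
  by rewrite (le_trans (ltW (archimedean.Num.Theory.truncnS_gt _)))// ler_nat.
pose a k := wsum b k L.
(* Exchanging the two sums turns the windows of length [L] into [L] copies of the long window, each
   displaced by at most [W]. *)
have inner i : cnorm (\sum_(0 <= k < l) a (m + k%:Z + t i) - L%:R * wsum b m l) <=
    2 * W%:R * L%:R.
  have -> : \sum_(0 <= k < l) a (m + k%:Z + t i) =
     \sum_(0 <= n < L) wsum b (m + (t i + n%:Z)) l.
    rewrite /a /wsum exchange_big/=; apply: eq_bigr => n _; apply: eq_bigr => k _.
    by congr b; ring.
  have -> : L%:R * wsum b m l = \sum_(0 <= n < L) wsum b m l.
    by rewrite sumr_const_nat subn0 mulr_natl.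
  rewrite -sumrB; apply: (le_trans (cnorm_sum _ _ _)).
  apply: (@le_trans _ _ (\sum_(0 <= n < L) 2 * W%:R)); last first.
    by rewrite sumr_const_nat subn0 -[leLHS]mulr_natr.
  apply: ler_sum_nat => n /andP[_ nL].
  apply: (le_trans (wsum_shift b1 _ _ _)); rewrite ler_wpM2l// ler_nat.
  by rewrite /W; have := hT i; move: nL; clear; lia.
have tot : exists k, dl / 2 * Q%:R * L%:R <= \sum_(i < Q) cnorm (a (k + t i)).
  apply: contrapT => nk.
  have small (k : nat) : cnorm (\sum_(i < Q) a (m + k%:Z + t i)) <= dl / 2 * Q%:R * L%:R.
    rewrite leNgt; apply/negP => hk; apply: nk; exists (m + k%:Z).
    by apply: (le_trans (ltW hk)); exact: cnorm_sum.
  have h1 : cnorm (\sum_(0 <= k < l) \sum_(i < Q) a (m + k%:Z + t i)) <=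
      dl / 2 * Q%:R * L%:R * l%:R.
    apply: (le_trans (cnorm_sum _ _ _)).
    apply: (@le_trans _ _ (\sum_(0 <= k < l) dl / 2 * Q%:R * L%:R)).
      by apply: ler_sum_nat => k _; exact: small.
    by rewrite sumr_const_nat subn0 -[leLHS]mulr_natr.
  have h2 : cnorm (\sum_(0 <= k < l) \sum_(i < Q) a (m + k%:Z + t i) -
      Q%:R * (L%:R * wsum b m l)) <= Q%:R * (2 * W%:R * L%:R).
    rewrite exchange_big/=.
    have -> : Q%:R * (L%:R * wsum b m l) = \sum_(i < Q) (L%:R * wsum b m l).
      by rewrite sumr_const card_ord mulr_natl.
    rewrite -sumrB; apply: (le_trans (cnorm_sum _ _ _)).
    apply: (le_trans (ler_sum _ (fun i _ => inner i))).
    by rewrite sumr_const card_ord -[leLHS]mulr_natl.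
  have [Q0|Qp] := posnP Q.
    apply: nk; exists 0; rewrite {1}Q0 mulr0 mul0r sumr_ge0// => i _; exact: cnorm_ge0.
  have Qr : 0 < (Q%:R : R) by rewrite ltr0n.
  have h3 : cnorm (Q%:R * (L%:R * wsum b m l)) <=
     dl / 2 * Q%:R * L%:R * l%:R + Q%:R * (2 * W%:R * L%:R).
    have := cnormD (\sum_(0 <= k < l) \sum_(i < Q) a (m + k%:Z + t i))
      (Q%:R * (L%:R * wsum b m l) - \sum_(0 <= k < l) \sum_(i < Q) a (m + k%:Z + t i)).
    rewrite addrC subrK => h3; apply: (le_trans h3).
    by rewrite cnorm_distC in h2; exact: lerD.
  have QL : 0 < Q%:R * L%:R :> R by exact: mulr_gt0.
  have : Q%:R * L%:R * (dl * l%:R) < Q%:R * L%:R * (dl * l%:R).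
    apply: (@lt_le_trans _ _ (Q%:R * L%:R * cnorm (wsum b m l))).
      by rewrite ltr_pM2l.
    have -> : Q%:R * L%:R * cnorm (wsum b m l) = cnorm (Q%:R * (L%:R * wsum b m l)).
      by rewrite !cnormM !cnorm_nat mulrA.
    apply: (le_trans h3).
    have -> : dl / 2 * Q%:R * L%:R * l%:R + Q%:R * (2 * W%:R * L%:R) =
      Q%:R * L%:R * (dl * l%:R / 2 + 4 * W%:R / 2) by field.
    by rewrite ler_pM2l//; lra.
  by rewrite ltxx.
case: tot => k hk; exists k; set D := [set i | _]%SET.
have up : \sum_(i < Q) cnorm (a (k + t i)) <= #|D|%:R * L%:R + Q%:R * (dl / 4 * L%:R).
  rewrite (bigID (mem D))/=; apply: lerD.
    apply: (@le_trans _ _ (\sum_(i in D) L%:R)).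
      by apply: ler_sum => i _; exact: wsum_bound.
    by rewrite sumr_const mulr_natl.
  apply: (@le_trans _ _ (\sum_(i < Q) (dl / 4 * L%:R))); last first.
    by rewrite sumr_const card_ord mulr_natl.
  have c0 : 0 <= dl / 4 * L%:R by rewrite mulr_ge0// divr_ge0// ltW.
  rewrite [leRHS](bigID (mem D))/=; apply: (@le_trans _ _ (\sum_(i | i \notin D)
      (dl / 4 * L%:R))).
    by apply: ler_sum => i; rewrite /D inE -ltNge => /ltW.
  by rewrite lerDr sumr_ge0.
rewrite -(ler_pM2r Lp).
have e1 : dl / 2 * Q%:R * L%:R = dl / 4 * Q%:R * L%:R + Q%:R * (dl / 4 * L%:R) by field.
by have := le_trans hk up; rewrite e1 lerD2r.
Qed.

Hypothesis hmod : modulated_orbit b.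

(** [Q] is fixed before [N], which is what later permits passing to all [n]. Among the indices with
    a large window, pigeonhole keeps more than [J > 2 / d ^+ 2] that share the model translate
    [io i] and nearly share [th i]. The large sieve then gives two whose frequencies differ by less
    than 4 / (d^2 L), and [L] is chosen after [N]. *)
Lemma exists_return (e : R) : 0 < e -> exists Q : nat, forall (N : nat) (t : 'I_Q -> int),
  exists i j, i != j /\ forall n, (`|n| <= N)%N ->
    cnorm (b (n + (t i - t j)) - b n) <= e.
Proof.
(* Large windows have level dl / 4 = 2d; replacing a translate by its model costs at most [ep <= d],
   so a correlation at level [d] remains. The final error consists of four terms [ep]. *)
move=> e0; pose d := dl / 8; have d0 : 0 < d by rewrite divr_gt0.
pose ep := Num.min (e / 4) d.
have ep0 : 0 < ep by rewrite lt_min d0 andbT; lra.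
have epe : 4 * ep <= e.
  have h4 : ep <= e / 4 by rewrite /ep ge_min lexx.
  lra.
have epd : ep <= d by rewrite /ep ge_min lexx orbT.
have [r [ka hka]] := hmod ep0.
have [mc [cc hcc]] := cnorm_bounded_coloring 1 ep0.
pose J := (Num.truncn (2 / d ^+ 2)).+1.
have JB : 2 / d ^+ 2 < J%:R by exact: archimedean.Num.Theory.truncnS_gt.
pose Mc := #|{: 'I_r * 'I_mc}|.
pose Q := (Num.truncn ((Mc * J)%:R * 4 / dl)).+1.
have QB : (Mc * J)%:R < dl / 4 * Q%:R.
  have : (Mc * J)%:R * 4 / dl < Q%:R by exact: archimedean.Num.Theory.truncnS_gt.
  by rewrite ltr_pdivrMr//; lra.
exists Q => N t.
pose T : nat := (\max_i `|t i| + \max_i `|ka i|)%N.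
have tT i : (`|t i| <= T)%N.
  exact: (leq_trans (leq_bigmax (F := fun i => `|t i|%N) i) (leq_addr _ _)).
have kT i : (`|ka i| <= T)%N.
  exact: (leq_trans (leq_bigmax (F := fun i => `|ka i|%N) i) (leq_addl _ _)).
(* The exponents in which [x i] and [x j] are compared are at most N + T and T in modulus; this [L]
   makes the two errors total at most [ep]. *)
pose L := (Num.truncn ((N + 2 * T)%:R * (4 / d ^+ 2) / ep)).+1.
have Lp : 0 < (L%:R : R) by rewrite ltr0Sn.
have LB : (N + 2 * T)%:R * (4 / d ^+ 2) <= ep * L%:R.
  rewrite mulrC -[leRHS]mulrC -ler_pdivrMr// [X in X / ep]mulrC.
  exact: (ltW (archimedean.Num.Theory.truncnS_gt _)).
have [k hk] := @many_large_windows Q L T t isT tT.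
set D := [set i | _]%SET in hk.
have [io hio] := choice (fun i => hka (k + t i)).
have [x hx] := choice hio.
have x1 i : cnorm (x i) = 1 by have [] := hx i.
(* Comparing the translates [i] and [j] leaves the constant phase [x j ^ (t j - t i)], which is
   close to [th i / th j] once [x i] is close to [x j]; hence [th] is coloured too. *)
pose th i := x i ^ (- t i).
have th1 i : cnorm (th i) = 1 by rewrite /th cnorm_exprz x1 exp1rz.
have DJ : (Mc * J < #|D|)%N by rewrite -(ltr_nat R); exact: lt_le_trans QB hk.
have [c hc] := pigeonhole_card (fun i => enum_rank (io i, cc (th i))) DJ.
set E := [set i in D | _]%SET in hc.
have ED i : i \in E -> i \in D by rewrite /E inE => /andP[].
have Ec i j : i \in E -> j \in E -> io i = io j /\ cnorm (th i - th j) <= ep.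
  rewrite /E !inE => /andP[_ /eqP hi] /andP[_ /eqP hj].
  have /enum_rank_inj[h1 h2] := etrans hi (esym hj).
  by split=> //; apply: hcc => //; rewrite th1.
have [i [j [iE jE ij close]]] : exists i j, [/\ i \in E, j \in E, i != j &
     cnorm (x i - x j) * L%:R < 4 / d ^+ 2].
  apply: contrapT => nsep.
  have [i0 i0E] : exists i0, i0 \in E.
    by apply/set0Pn; rewrite -card_gt0; exact: leq_ltn_trans hc.
  have := @spaced_frequencies _ _ E L x (fun n : nat => b (n%:Z + ka (io i0))) d isT d0.
  move=> /(_ (fun n : nat => b1 _) (fun i _ => x1 i)) H.
  have : #|E|%:R <= 2 / d ^+ 2.
    apply: H => [i iE|i j iE jE ij].
      have iD := ED _ iE; rewrite /D inE in iD.
      have [<- _] := Ec _ _ iE i0E.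
      have dist : cnorm (wsum b (k + t i) L - \sum_(n < L) x i ^+ n * b (n%:Z + ka
          (io i))) <= ep * L%:R.
        rewrite /wsum big_mkord -sumrB; apply: (le_trans (cnorm_sum _ _ _)).
        apply: (@le_trans _ _ (\sum_(n < L) ep)); last first.
          by rewrite sumr_const card_ord mulr_natr.
        apply: ler_sum => n _; have [_ hn] := hx i.
        by have := hn n%:Z; rewrite [n%:Z + (k + _)]addrC.
      have := cnorm_tri (\sum_(n < L) x i ^+ n * b (n%:Z + ka (io i))) (wsum b
          (k + t i) L) 0.
      rewrite !subr0 => tri.
      have : ep * L%:R <= d * L%:R by rewrite ler_pM2r.
      have dE : dl / 4 * L%:R = d * L%:R + d * L%:R by rewrite /d; field.
      by move: iD; rewrite dE; lra.
    rewrite leNgt; apply/negP => hlt; apply: nsep; exists i, j; split=> //.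
  have : J%:R < (#|E|%:R : R) by rewrite ltr_nat.
  lra.
exists i, j; split=> // n nN.
have [ioij thij] := Ec _ _ iE jE.
set ki := ka (io i).
(* At [n'] for [i] and at [n' + dt] for [j], both models approximate the same value
   [b (n' + (k + t i))], one through [b n] and the other through [b (n + dt)]. *)
pose n' := n - ki.
have [_ hi] := hx i; have [_ hj] := hx j.
pose dt := t i - t j.
have hi' := hi n'; have hj' := hj (n' + dt).
rewrite -ioij -/ki in hj'; rewrite -/ki in hi'.
have e1 : n' + dt + (k + t j) = n' + (k + t i) by rewrite /dt; ring.
have e2 : n' + dt + ki = n + dt by rewrite /n'; ring.
have e3 : n' + ki = n by rewrite /n' subrK.
rewrite e1 e2 in hj'; rewrite e3 in hi'.
have xjn := unit_neq0 (x1 j); have xin := unit_neq0 (x1 i).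
pose ph := (x i / x j) ^ n' * x j ^ (- dt).
have y1 : cnorm (x i / x j) = 1 by rewrite cnormM cnormV !x1 invr1 mulr1.
have main : cnorm (b (n + dt) - ph * b n) <= 2 * ep.
  have u1 : cnorm (x j ^ (n' + dt)) = 1 by rewrite cnorm_exprz x1 exp1rz.
  rewrite -[leLHS]mul1r -[X in X * _ <= _]u1 -cnormM mulrBr.
  have -> : x j ^ (n' + dt) * (ph * b n) = x i ^ n' * b n.
    rewrite /ph expfzDr// exprzMl ?unitfE ?invr_eq0// exprz_inv -!invr_expz.
    have a1 : x j ^ n' != 0 by rewrite expfz_neq0.
    have a2 : x j ^ dt != 0 by rewrite expfz_neq0.
    by field; rewrite a1 a2.
  apply: (le_trans (cnorm_tri (b (n' + (k + t i))) _ _)).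
  rewrite cnorm_distC; have := lerD hj' hi'; lra.
have phc : cnorm (ph - 1) <= 2 * ep.
  have c1 : cnorm ((x i / x j) ^ n' - 1) <= (N + T)%N%:R * cnorm (x i - x j).
    have := cnorm_exprz_dist n' y1 (@cnorm1 R); rewrite exp1rz => h.
    apply: (le_trans h).
    have -> : cnorm (x i / x j - 1) = cnorm (x i - x j).
      have -> : x i / x j - 1 = (x i - x j) / x j by field.
      by rewrite cnormM cnormV x1 invr1 mulr1.
    rewrite ler_wpM2r ?cnorm_ge0// ler_nat.
    by have := kT (io i); move: nN; rewrite /n' -/ki; clear; lia.
  have c2 : cnorm (x j ^ (- dt) - 1) <= T%:R * cnorm (x i - x j) + ep.
    have -> : x j ^ (- dt) - 1 = x j ^ t j * (x j ^ (- t i) - th j).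
      rewrite /th /dt mulrBr -!expfzDr// subrr expr0z; congr (x j ^ _ - 1); ring.
    rewrite cnormM cnorm_exprz x1 exp1rz mul1r.
    apply: (le_trans (cnorm_tri (th i) _ _)); apply: lerD => //.
    rewrite cnorm_distC; apply: (le_trans (cnorm_exprz_dist _ (x1 i) (x1 j))).
    by rewrite abszN ler_wpM2r ?cnorm_ge0// ler_nat.
  have -> : ph - 1 = ((x i / x j) ^ n' - 1) * x j ^ (- dt) + (x j ^ (- dt) - 1).
    by rewrite /ph; ring.
  apply: (le_trans (cnormD _ _)); rewrite cnormM [cnorm
      (x j ^ _)]cnorm_exprz x1 exp1rz mulr1.
  have c3 : (N + 2 * T)%:R * cnorm (x i - x j) <= ep.
    rewrite -(ler_pM2r Lp); apply: le_trans LB.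
    by rewrite -mulrA ler_wpM2l// ltW.
  have c4 : (N + 2 * T)%:R * cnorm (x i - x j) =
      (N + T)%N%:R * cnorm (x i - x j) + T%:R * cnorm (x i - x j).
    by rewrite -mulrDl -natrD mul2n -addnn addnA.
  lra.
have -> : b (n + dt) - b n = (b (n + dt) - ph * b n) + (ph - 1) * b n by ring.
apply: (le_trans (cnormD _ _)); rewrite [cnorm (_ * b n)]cnormM.
have := ler_piMr (cnorm_ge0 (ph - 1)) (b1 n); lra.
Qed.

(** Were the translates not totally bounded, a greedy choice would give infinitely many shifts no
    two of which differ by an [e]-almost period, and the first [Q] of them contradict [hP]. *)
Lemma modulated_orbit_bohr : bohr_ap b.
Proof.
move=> e e0; have [Q hQ] := exists_return e0.
pose P dt := forall n, cnorm (b (n + dt) - b n) <= e.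
(* If every pair failed at some [n], these finitely many failures would lie in one range |n| <= N,
   against the choice of [Q]. *)
have hP (t : 'I_Q -> int) : exists i j, i != j /\ P (t i - t j).
  apply: contrapT => nP.
  have bad (p : 'I_Q * 'I_Q) : exists n : int, p.1 != p.2 ->
      ~ cnorm (b (n + (t p.1 - t p.2)) - b n) <= e.
    have [pp|pp] := boolP (p.1 != p.2); last by exists 0.
    have : ~ P (t p.1 - t p.2) by move=> h; apply: nP; exists p.1, p.2.
    by move=> /existsNP[n hn]; exists n.
  have [n hn] := choice bad.
  have [i [j [ij h]]] := hQ (\max_p `|n p|)%N t.
  by apply: (hn (i, j) ij); apply: h; exact: (leq_bigmax (i, j)).
have Psym dt : P dt -> P (- dt).
  by move=> h n; have := h (n - dt); rewrite subrK cnorm_distC.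
apply: contrapT => ns.
have next (s : seq int) : exists t, forall t0, t0 \in s -> ~ P (t - t0).
  apply: contrapT => nt; apply: ns; exists s => t.
  apply: contrapT => h; apply: nt; exists t => t0 t0s Pt; apply: h; exists t0 => // n.
  by have := Pt (n + t0); rewrite -addrA [t0 + _]addrC subrK.
have [g hg] := choice next.
(* [s_ q] lists the first [q] shifts chosen, and [g (s_ q)] is the next one. *)
pose s_ := fix s_ q := if q is q'.+1 then g (s_ q') :: s_ q' else [::].
have mem j q : (j < q)%N -> g (s_ j) \in s_ q.
  elim: q => [//|q IH]; rewrite ltnS leq_eqVlt => /orP[/eqP->|jq] /=.
    by rewrite inE eqxx.
  by rewrite inE IH ?orbT.
have [i [j [ij Pij]]] := hP (fun i => g (s_ i)).
have [lt|lt] := ltnP i j.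
  by apply: (hg (s_ j) _ (mem _ _ lt)); rewrite -opprB; exact: Psym.
by apply: (hg (s_ i) _ (mem j i _) Pij); rewrite ltn_neqAle eq_sym ij lt.
Qed.

End Recurrence.

Theorem modulated_orbit_uniform_mean b : (forall n, cnorm (b n) <= 1) ->
  modulated_orbit b -> exists c, uniform_mean b c.
Proof.
move=> b1 hb.
have [null|/existsNP[e he]] := pselect (forall e : R, 0 < e -> exists L : nat,
    forall m l, (L <= l)%N -> cnorm (wsum b m l) <= e * l%:R).
  by exists 0 => e /null[L hL]; exists L => m l lL; rewrite mul0r subr0; exact: hL.
have [e0 he2] : 0 < e /\ ~ exists L : nat, forall m l, (L <= l)%N -> cnorm
    (wsum b m l) <= e * l%:R.
  by split; [apply: contrapT => n; apply: he => /n|move=> h; apply: he].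
apply: (bohr_uniform_mean b1); apply: (modulated_orbit_bohr b1 e0) => // L0.
apply: contrapT => nl; apply: he2; exists L0 => m l lL.
by rewrite leNgt; apply/negP => h; apply: nl; exists m, l.
Qed.

End Dichotomy.

Local Open Scope quotient_scope.
Local Open Scope group_scope.
Local Open Scope ring_scope.

Local Notation center := (@Defs.center _).

(** * Orbits on nilmanifolds *)

Section LieTopology.
Context {R : realType} {G : lieGroupType R}.
Implicit Types (x y g u : G).

Lemma lie_mul_continuous : continuous (fun p : G * G => (p.1 * p.2)%g).
Proof. by have [] := @lie_mul_smooth R G. Qed.

Lemma lie_inv_continuous : continuous (fun x : G => (x^-1)%g).
Proof. by have [] := @lie_inv_smooth R G. Qed.

Lemma lie_mulr_continuous (y : G) : continuous (fun x : G => (x * y)%g).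
Proof.
move=> x; apply: (@continuous_comp _ _ _ (fun x : G => (x, y)) (fun p : G * G =>
    (p.1 * p.2)%g)).
  by apply: cvg_pair => //=; exact: cvg_cst.
exact: lie_mul_continuous.
Qed.

Lemma lie_mul_nbhs1 (U : set G) : nbhs (1%g : G) U ->
  exists2 V : set G, nbhs (1%g : G) V & forall u v, V u -> V v -> U (u * v)%g.
Proof.
move=> hU; have := @lie_mul_continuous (1%g, 1%g) U.
rewrite /= mulg1 => /(_ hU)[[V1 V2] /= [h1 h2] h].
exists (V1 `&` V2); first exact: filterI.
by move=> u v [u1 u2] [v1 v2]; apply: (h (u, v)).
Qed.

Lemma lie_inv_nbhs1 (U : set G) : nbhs (1%g : G) U -> nbhs (1%g : G) [set u | U (u^-1)%g].
Proof. by move=> hU; have := @lie_inv_continuous 1%g U; rewrite /= invg1; exact. Qed.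

Lemma lie_div_nbhs1 (U : set G) : nbhs (1%g : G) U ->
  exists2 V : set G, nbhs (1%g : G) V & forall u v, V u -> V v -> U (u * v^-1)%g.
Proof.
move=> /lie_mul_nbhs1[V hV h]; exists (V `&` [set u | V (u^-1)%g]).
  by apply: filterI => //; exact: lie_inv_nbhs1.
by move=> u v [Vu _] [_ Vv]; exact: h.
Qed.

End LieTopology.

Section CosetSpace.
Context {R : realType} {G : lieGroupType R} (Gamma : groupClosed G).
Local Notation X := (coset_space Gamma).
Local Notation piX := (\pi_X : G -> X).

Lemma pi_coset_eq (x y : G) : piX x = piX y <-> (x^-1 * y)%g \in Gamma.
Proof.
split=> [/(@eqmodP _ (coset_equiv Gamma))//|h].
exact/(@eqmodP _ (coset_equiv Gamma)).
Qed.

Lemma pi_coset_mulr (x c : G) : c \in Gamma -> piX (x * c)%g = piX x.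
Proof.
by move=> cG; apply/esym/pi_coset_eq; rewrite mulgA mulVg mul1g.
Qed.

(** The saturation of [V] is the union of its right translates by [Gamma]. *)
Lemma pi_open (V : set G) : open V -> open (piX @` V).
Proof.
move=> oV; rewrite /open/= /quotient_open.
have -> : piX @^-1` (piX @` V) = \bigcup_(c in [set c | c \in Gamma])
    [set g | V (g * c)%g].
  apply/seteqP; split=> [g /= [h hx /pi_coset_eq hg]|g /= [c cGa hg]].
    exists (g^-1 * h)%g; last by rewrite /= mulVKg.
    by rewrite /= -gpredV invgM invgK.
  by exists (g * c)%g => //; exact: pi_coset_mulr.
apply: bigcup_open => c _.
by have := @lie_mulr_continuous R G c => /continuousP; apply.
Qed.

Lemma pi_nbhs (g : G) (V : set G) : nbhs g V -> nbhs (piX g) (piX @` V).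
Proof.
move=> /nbhs_interior hV.
have : nbhs (piX g) (piX @` V^°).
  apply: open_nbhs_nbhs; split; first exact/pi_open/open_interior.
  by exists g => //; exact: nbhs_singleton.
by apply: filterS; apply: image_subset; exact: interior_subset.
Qed.

Lemma pi_repr (x : X) : piX (repr x) = x.
Proof. exact: reprK. Qed.

Lemma continuous_on_coset_space (Z : topologicalType) (f : X -> Z) (F : G -> Z) :
  (forall g, f (piX g) = F g) -> continuous F -> continuous f.
Proof.
move=> fF cF; apply/(@quotient_continuous G {eq_quot (coset_equiv Gamma)} Z f).
by have -> : f \o piX = F by apply/funext.
Qed.

Hypothesis cG : cocompact Gamma.

(** Compactness of the quotient lifted to [G]. The neighbourhood may depend on [x], as
    [continuous_left_uc] requires. *)
Lemma cocompact_cover (W : G -> set G) : (forall x, nbhs (1%g : G) (W x)) ->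
  exists s : seq G, forall g, exists x u c,
    [/\ x \in s, W x u, c \in Gamma & g = (u * x * c)%g].
Proof.
move=> hW.
pose X0 := quotient_topology {eq_quot (coset_equiv Gamma)}.
(* The finite-subcover criterion is applied to a pointed space; the class of 1 serves as the
   point. *)
pose Xp : ptopologicalType := HB.pack X0 (isPointed.Build X0 (piX 1%g)).
pose V (x : G) : set X := [set piX g | g in [set g | (W x)^° (g * x^-1)%g]].
have oV x : open (V x).
  apply: pi_open; have := @lie_mulr_continuous R G x^-1%g => /continuousP; apply.
  exact: open_interior.
have := cG; rewrite /cocompact.
have -> : compact [set: X] = compact [set: Xp] by [].
rewrite compact_cover => /(_ G setT V)[|y _|D _ hD].
- by move=> x _; exact: oV.
- exists (repr y) => //; exists (repr y); last exact: reprK.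
  by rewrite /= mulgV; apply: nbhs_singleton; apply: nbhs_interior; exact: hW.
exists (finmap.enum_fset D) => g; have [x /= xD [h hx /esym/pi_coset_eq hg]] := hD
    (piX g) I.
exists x, (h * x^-1)%g, (h^-1 * g)%g; split=> //.
- exact: interior_subset.
- by rewrite -gpredV invgM invgK.
- by rewrite mulgVK mulVKg.
Qed.

End CosetSpace.

Section ComplexTopology.
Context {R : realType}.
Local Notation C := (Cplx R).

(** Radii in the topology of [C] are positive elements of [C], hence real; this moves them to
    [R]. *)
Lemma cvg_cnormP (T : Type) (F : set_system T) {FF : Filter F} (f : T -> C) (l : C) :
  f @ F --> l <-> forall e : R, 0 < e -> F [set t | cnorm (f t - l) <= e].
Proof.
split=> [/cvgrPdist_le h e e0|h].
  have eC : 0 < (e%:C%C : C) by rewrite ltcR.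
  by have := h _ eC; apply: filterS => t /=; rewrite cnormE lecR cnorm_distC.
apply/cvgrPdist_le => e; rewrite ltcE => /andP[/eqP/= i0 r0].
have := h _ r0; apply: filterS => t /= ht.
have -> : e = (Re e)%:C%C by case: (e) i0 => a b /= ->.
by rewrite cnormE lecR cnorm_distC.
Qed.

Lemma continuous_cnormP (T : topologicalType) (f : T -> C) : continuous f <->
  forall x (e : R), 0 < e -> nbhs x [set y | cnorm (f y - f x) <= e].
Proof.
split=> h x; first exact/cvg_cnormP/h.
exact/cvg_cnormP/h.
Qed.

Lemma uniform_cvg_cnormP (u : nat -> int -> C) (a : int -> C) :
  {uniform, u @ \oo --> a} <->
  forall e : R, 0 < e -> \forall k \near \oo, forall n, cnorm (u k n - a n) <= e.
Proof.
split=> [h e e0|h P /uniform_nbhs[E [hE sE]]].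
  have eC : 0 < (e%:C%C : C) by rewrite ltcR.
  have /h : @nbhs _ {uniform` setT -> C} a [set g | forall n, cnorm (g n - a n) <= e].
    apply/uniform_nbhs; exists [set xy | ball xy.1 (e%:C%C : C) xy.2]; split.
      by rewrite -entourage_ballE; exists (e%:C%C : C).
    move=> g /= hg n; have := hg n I; rewrite -ball_normE/= cnormE ltcR cnorm_distC.
    exact: ltW.
  by [].
move: hE; rewrite -entourage_ballE => -[e /= e0 he].
move: e0; rewrite ltcE => /andP[/eqP/= i0 r0].
have r2 : 0 < Re e / 2 by lra.
have := h _ r2; apply: filterS => k hk; apply: sE => n _; apply: he.
rewrite /= -ball_normE/= cnormE.
have -> : e = (Re e)%:C%C by case: (e) i0 => a' b' /= ->.
rewrite ltcR cnorm_distC; have := hk n; lra.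
Qed.

Lemma uniform_limitsP (A : set (int -> C)) (a : int -> C) : uniform_limits A a <->
  forall e : R, 0 < e -> exists2 b, A b & forall n, cnorm (a n - b n) <= e.
Proof.
split=> [[u [uA /uniform_cvg_cnormP h]] e e0|h].
  have [k _ /(_ k (leqnn k)) hk] := h _ e0; exists (u k) => // n.
  by rewrite cnorm_distC; exact: hk.
have H (k : nat) : exists b, A b /\ forall n, cnorm (a n - b n) <= k.+1%:R^-1.
  by have [|b Ab hb] := h k.+1%:R^-1; [rewrite invr_gt0 ltr0Sn|exists b].
have [u hu] := choice H; exists u; split=> [k|]; first by have [] := hu k.
apply/uniform_cvg_cnormP => e e0; exists (Num.truncn e^-1) => // k /= hk n.
rewrite cnorm_distC; have [_ h2] := hu k; apply: (le_trans (h2 n)).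
rewrite -[leRHS]invrK lef_pV2 ?posrE ?invr_gt0 ?ltr0Sn//.
by rewrite (le_trans (ltW (archimedean.Num.Theory.truncnS_gt _)))// ler_nat ltnS.
Qed.

End ComplexTopology.

Lemma nbhs_all_seq (T : topologicalType) (I : eqType) (p : T) (s : seq I)
    (W : I -> set T) : (forall x, x \in s -> nbhs p (W x)) ->
  nbhs p [set u | forall x, x \in s -> W x u].
Proof.
elim: s => [|y s IH] h; first by apply: filterS filterT.
have h1 : nbhs p (W y) by apply: h; rewrite inE eqxx.
have h2 : nbhs p [set u | forall x, x \in s -> W x u].
  by apply: IH => x xs; apply: h; rewrite inE xs orbT.
apply: filterS (filterI h1 h2) => u /= [u1 u2] x; rewrite inE.
by move=> /orP[/eqP->//|]; exact: u2.
Qed.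

Section IntegerPowers.
Variable G : groupType.
Implicit Types (x v z : G) (m n : int).

Lemma zexpgS x n : zexpg x (n + 1) = (zexpg x n * x)%g.
Proof.
case: n => [n|[|n]]; first by rewrite -PoszD addn1 /= expgSr.
  by rewrite /= expg1 mulVg.
rewrite NegzE.
have -> : - (n.+2%:Z) + 1 = Negz n by rewrite NegzE; lia.
by rewrite -NegzE /= [in RHS]expgS invgM mulgVK.
Qed.

Lemma zexpgB x n : zexpg x (n - 1) = (zexpg x n * x^-1)%g.
Proof. by rewrite -{2}(subrK 1 n) zexpgS mulgK. Qed.

Lemma zexpgD x m n : zexpg x (m + n) = (zexpg x m * zexpg x n)%g.
Proof.
elim/int_ind: n => [|n IH|n IH]; first by rewrite addr0 /= mulg1.
  by rewrite -addn1 PoszD addrA !zexpgS IH mulgA.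
by rewrite -addn1 PoszD opprD addrA !zexpgB IH mulgA.
Qed.

Lemma zexpg_conj x v n : (zexpg x n ^ v)%g = zexpg (x ^ v)%g n.
Proof. by case: n => n /=; rewrite ?conjVg conjXg. Qed.

Lemma zexpg_central z x n : center z ->
  zexpg (x * z)%g n = (zexpg z n * zexpg x n)%g.
Proof.
move=> cz; have comm k : commute (x ^+ k)%g (z ^+ k)%g by apply: commuteX2; apply/esym/cz.
case: n => n /=; first by rewrite expgMn; [exact: comm|apply/esym/cz].
by rewrite expgMn; [rewrite invgM|apply/esym/cz].
Qed.

End IntegerPowers.

Section NilFunctions.
Context {R : realType} {G : lieGroupType R} (Gamma : groupClosed G).
Local Notation X := (coset_space Gamma).
Local Notation piX := (\pi_X : G -> X).
Local Notation C := R[i].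

Definition left_uc (F : G -> C) := forall e : R, 0 < e ->
  exists2 U : set G, nbhs (1%g : G) U &
    forall u x, U u -> cnorm (F (u * x)%g - F x) <= e.

Definition right_invariant (F : G -> C) :=
  forall x c, c \in Gamma -> F (x * c)%g = F x.

Hypothesis cG : cocompact Gamma.

(** Heine-Cantor on the quotient: for [u] and [v] in a small neighbourhood attached to a cell centre
    [x], both [u * v * x] and [v * x] have values close to that at [x]. *)
Lemma continuous_left_uc (f : X -> Cplx R) : continuous f ->
  left_uc (f \o piX) /\ bddc (f \o piX).
Proof.
move=> cf; pose F : G -> C := f \o piX.
have cF : continuous (f \o piX).
  by move=> x; apply: continuous_comp; [exact: pi_continuous|exact: cf].
have Fr x c : c \in Gamma -> F (x * c)%g = F x.
  by move=> cGa; rewrite /F/= pi_coset_mulr.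
have near1 (e : R) : 0 < e -> forall x, nbhs (1%g : G) [set u | cnorm (F
    (u * x)%g - F x) <= e].
  move=> e0 x; have /continuous_cnormP/(_ x e e0) h := cF.
  by have := @lie_mulr_continuous R G x 1%g; rewrite /continuous_at mul1g => /(_ _ h).
split.
  move=> e e0; have e2 : 0 < e / 2 by lra.
  have H x : exists V : set G, nbhs (1%g : G) V /\
      forall u v, V u -> V v -> cnorm (F (u * v * x)%g - F x) <= e / 2.
    by have [V hV h] := lie_mul_nbhs1 (near1 _ e2 x); exists V.
  have [W hW] := choice H.
  have [s hs] := cocompact_cover cG (fun x => proj1 (hW x)).
  exists [set u | forall x, x \in s -> W x u].
    by apply: nbhs_all_seq => x _; have [] := hW x.
  move=> u g hu; have [x [v [c [xs hv cGa ->]]]] := hs g.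
  have E1 : (u * (v * x * c))%g = (u * v * x * c)%g by rewrite !mulgA.
  rewrite -/(F _) -/(F _) E1 (Fr (u * v * x)%g)// (Fr (v * x)%g)//.
  have [h1 h2] := hW x.
  have a1 := h2 _ _ (hu _ xs) hv.
  have a2 := h2 _ _ (nbhs_singleton h1) hv; rewrite mul1g in a2.
  apply: (le_trans (cnorm_tri (F x) _ _)); rewrite [X in _ + X]cnorm_distC.
  lra.
have [s hs] := cocompact_cover cG (near1 1 ltr01).
exists (1 + \sum_(x <- s) cnorm (F x)) => g.
have [x [u [c [xs hu cGa ->]]]] := hs g.
have -> : (f \o piX) (u * x * c)%g = F (u * x)%g by rewrite -[RHS](Fr _ c).
have := cnormD (F (u * x)%g - F x) (F x); rewrite subrK => h.
apply: (le_trans h); apply: lerD => //.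
rewrite (big_rem _ xs)/= lerDl; apply: sumr_ge0 => y _; exact: cnorm_ge0.
Qed.


(** In the theory of nilmanifolds, these are functions with a vertical frequency. *)
Definition vertical_eigenfunction (F : G -> C) := forall z, center z ->
  exists2 p : C, cnorm p = 1 & forall x, F (z * x)%g = p * F x.

Lemma eigen_zexpg (F : G -> C) z p : cnorm p = 1 ->
  (forall x, F (z * x)%g = p * F x) -> forall n x, F (zexpg z n * x)%g = p ^ n * F x.
Proof.
move=> p1 h n x; have pn := unit_neq0 p1.
have hV y : F (z^-1 * y)%g = p^-1 * F y.
  by apply: (mulfI pn); rewrite -h mulVKg mulrA divff// mul1r.
elim/int_ind: n x => [|n IH|n IH] x; first by rewrite /= mul1g expr0z mul1r.
  rewrite -addn1 PoszD zexpgS -mulgA IH h mulrA expfzDr//.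
rewrite -addn1 PoszD opprD zexpgB -mulgA IH hV mulrA expfzDr//.
Qed.

(** The identity behind it is tau^n v = v [tau, v]^n tau^n, valid because the commutator is central.
    Two points tau^t g0 in the same cell differ by a small left factor [v] and an element of
    [Gamma]; moving [v] to the front produces [tau, v]^n, on which [F] gives the phase [p ^ n]. *)
Lemma eigenfunction_modulated_orbit (F : G -> C) (tau g0 : G) :
  (forall x y : G, center [~ x, y]%g) ->
  left_uc F -> right_invariant F -> vertical_eigenfunction F ->
  modulated_orbit (fun n => F (zexpg tau n * g0)%g).
Proof.
move=> nil Fu Fr Fe e e0.
have [U hU Ue] := Fu _ e0.
(* The factor [v] will be a quotient of two elements of [V] and has to lie in [U]. *)
have [V hV VU] := lie_div_nbhs1 hU.
have [s hs] := cocompact_cover cG (fun _ => hV).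
have H t : exists i : 'I_(size s), exists u c, [/\ V u, c \in Gamma &
    (zexpg tau t * g0)%g = (u * nth 1%g s i * c)%g].
  have [x [u [c [xs Vu cGa E]]]] := hs (zexpg tau t * g0)%g.
  have xi : (index x s < size s)%N by rewrite index_mem.
  by exists (Ordinal xi), u, c; rewrite nth_index.
have [col hcol] := choice H.
have [k hk] := coloring_repr (0 : int) col.
exists (size s), k => t; exists (col t).
have [u [c [Vu cGa E]]] := hcol t.
have [u' [c' [Vu' cGa' E']]] := hcol (k (col t)); rewrite hk in E'.
set v := (u * u'^-1)%g.
have Ev : (zexpg tau t * g0)%g = (v * (zexpg tau (k (col t)) * g0) * (c'^-1 * c))%g.
  by rewrite E E' /v !mulgA mulgVK mulgK.
have Uv : U v by exact: VU.
move: v Ev Uv => v Ev Uv.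
have [p p1 hp] := Fe _ (nil tau v).
exists p; split=> // n.
have cc : (c'^-1 * c)%g \in Gamma by rewrite gpredM// gpredV.
set y := (zexpg tau (k (col t)) * g0)%g in Ev.
set w := zexpg [~ tau, v]%g n.
have nv : (zexpg tau n * v)%g = (v * (w * zexpg tau n))%g.
  rewrite [LHS]conjgC zexpg_conj; congr (_ * _)%g.
  by rewrite -zexpg_central// /commg mulVKg.
have -> : F (zexpg tau (n + t) * g0)%g = F (v * (w * (zexpg tau n * y)))%g.
  by rewrite zexpgD -mulgA Ev [in LHS]mulgA Fr// [in LHS]mulgA nv !mulgA.
have -> : (zexpg tau (n + k (col t)) * g0)%g = (zexpg tau n * y)%g.
  by rewrite zexpgD -mulgA.
by rewrite -(eigen_zexpg p1 hp); exact: Ue.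
Qed.

End NilFunctions.

(* The centre written additively, so that the mean on abelian groups applies. *)
Definition center_zmod (G : groupType) : Type := {z : G | `[< center z >]}.

Section CenterZmod.
Variable G : groupType.
Local Notation Z := (center_zmod G).
HB.instance Definition _ := Choice.on Z.

Lemma centerP (z : Z) : center (val z).
Proof. exact: (asboolW (valP z)). Qed.

Lemma center1 : center (1%g : G).
Proof. by move=> x; apply/esym/commute1. Qed.

Lemma centerM (x y : G) : center x -> center y -> center (x * y)%g.
Proof. by move=> cx cy z; apply/esym/commuteM; apply/esym; [exact: cx|exact: cy]. Qed.

Lemma centerV (x : G) : center x -> center (x^-1)%g.
Proof. by move=> cx z; apply/esym/commuteV/esym/cx. Qed.

Definition center_add (x y : Z) : Z :=
  exist _ (val x * val y)%g (asboolT (centerM (centerP x) (centerP y))).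
Definition center_opp (x : Z) : Z :=
  exist _ (val x)^-1%g (asboolT (centerV (centerP x))).
Definition center_zero : Z := exist _ 1%g (asboolT center1).

Lemma center_addA : associative center_add.
Proof. by move=> x y z; apply: val_inj; rewrite /= mulgA. Qed.
Lemma center_addC : commutative center_add.
Proof. by move=> x y; apply: val_inj; exact: centerP. Qed.
Lemma center_add0 : left_id center_zero center_add.
Proof. by move=> x; apply: val_inj; rewrite /= mul1g. Qed.
Lemma center_addN : left_inverse center_zero center_opp center_add.
Proof. by move=> x; apply: val_inj; rewrite /= mulVg. Qed.

HB.instance Definition _ :=
  GRing.isZmodule.Build Z center_addA center_addC center_add0 center_addN.

Lemma val_centerD (x y : Z) : val (x + y) = (val x * val y)%g.
Proof. by []. Qed.

End CenterZmod.

(** * Uniform means along orbits *)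

Section NilsequenceMeans.
Context {R : realType} {G : lieGroupType R} (Gamma : groupClosed G).
Local Notation X := (coset_space Gamma).
Local Notation piX := (\pi_X : G -> X).
Local Notation C := R[i].
Hypothesis cG : cocompact Gamma.
Hypothesis nil : forall x y : G, center [~ x, y]%g.

(** Division by [|B| + 1] meets the bound 1 under which the dichotomy is stated. *)
Lemma eigenfunction_uniform_mean (F : G -> C) (tau g0 : G) : bddc F ->
  left_uc F -> right_invariant Gamma F -> vertical_eigenfunction F ->
  exists c, uniform_mean (fun n => F (zexpg tau n * g0)%g) c.
Proof.
move=> [B hB] Fu Fr Fe.
have B0 : 0 < `|B| + 1 by have := normr_ge0 B; lra.
pose a : C := (`|B| + 1)%:C%C; have an : a != 0.
  by rewrite -cnorm_eq0 cnorm_real normr_eq0 gt_eqF.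
pose F' x := a^-1 * F x.
have na : cnorm a^-1 = (`|B| + 1)^-1 by rewrite cnormV cnorm_real gtr0_norm.
have a1 : cnorm a^-1 <= 1 by rewrite na invf_le1//; have := normr_ge0 B; lra.
have [||c hc] := @modulated_orbit_uniform_mean R (fun n => F' (zexpg tau n * g0)%g).
- move=> n; rewrite cnormM na mulrC ler_pdivrMr// mul1r.
  by apply: (le_trans (hB _)); have := ler_norm B; lra.
- apply: (@eigenfunction_modulated_orbit _ _ _ cG F' tau g0 nil).
  + move=> e e0; have [U hU h] := Fu _ e0; exists U => // u x Uu.
    rewrite -mulrBr cnormM (le_trans _ (h u x Uu))// ler_piMl ?cnorm_ge0//.
  + by move=> x c cGa; rewrite /F' Fr.
  + by move=> z /Fe[p p1 hp]; exists p => // x; rewrite /F' hp mulrCA.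
exists (a * c).
have -> : (fun n => F (zexpg tau n * g0)%g) = (fun n => a * F' (zexpg tau n * g0)%g).
  by apply/funext => n; rewrite /F' mulrA divff// mul1r.
exact: uniform_mean_scale.
Qed.

(** A central [z] passes through the small factor [u], so the translate of [F] by [z] is determined
    up to e / 3 by its values at the finitely many cell centres, and these bounded values are
    coloured with error e / 3. *)
Lemma center_orbit_coloring (F : G -> C) : bddc F -> left_uc F -> right_invariant Gamma F ->
  forall e : R, 0 < e -> exists (m : nat) (c : center_zmod G -> 'I_m),
  forall z w, c z = c w -> forall x, cnorm (F (val z * x)%g - F (val w * x)%g) <= e.
Proof.
move=> [B hB] Fu Fr e e0; have e3 : 0 < e / 3 by lra.
have [U hU Ue] := Fu _ e3.
have [s hs] := cocompact_cover cG (fun _ => hU).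
have [m [cc hcc]] := cnorm_bounded_coloring B e3.
exists #|{: {ffun 'I_(size s) -> 'I_m}}|,
  (fun z => enum_rank [ffun i : 'I_(size s) => cc (F (val z * nth 1%g s i)%g)]).
move=> z w /enum_rank_inj/ffunP zw x.
have [y [u [c [ys Uu cGa ->]]]] := hs x.
have E (v : center_zmod G) : F (val v * (u * y * c))%g = F (u * (val v * y))%g.
  by rewrite mulgA Fr// !mulgA; congr (F (_ * _)%g); exact: centerP.
rewrite !E.
have yi : (index y s < size s)%N by rewrite index_mem.
have := zw (Ordinal yi); rewrite !ffunE/= nth_index// => h.
have h0 := hcc _ _ (hB _) (hB _) h.
have h1 := Ue u (val z * y)%g Uu; have h2 := Ue u (val w * y)%g Uu.
apply: (le_trans (cnorm_tri (F (val z * y)%g) _ _)).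
apply: (le_trans (lerD h1 (cnorm_tri (F (val w * y)%g) _ _))).
rewrite [X in _ + (_ + X)]cnorm_distC; lra.
Qed.

(** Averaging against [x] gives a function on which a central [z] acts by the inverse of [x z].
    Uniform continuity and invariance under [Gamma] survive because central translations commute
    with both. *)
Lemma center_mean_properties (M : (center_zmod G -> R) -> R) (F : G -> C)
    (x : center_zmod G -> C) : invariant_mean M -> character x ->
  bddc F -> left_uc F -> right_invariant Gamma F ->
  let E g := cmean M (fun w => F (val w * g)%g * x w) in
  [/\ bddc E, left_uc E, right_invariant Gamma E & vertical_eigenfunction E].
Proof.
move=> hM cx [B hB] Fu Fr E.
have bx : bddc x by apply: bddc_unit; exact: char_unit.
have bF g : bddc (fun w : center_zmod G => F (val w * g)%g) by exists B.
split.
- exists B => g; apply: (cmean_norm_le hM) => w.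
  by rewrite cnormM (char_unit cx) mulr1.
- move=> e e0; have [U hU h] := Fu _ e0; exists U => // u g Uu.
  rewrite /E -(cmeanB hM); auto; apply: (cmean_norm_le hM) => w.
  rewrite -mulrBl cnormM (char_unit cx) mulr1.
  have -> : (val w * (u * g))%g = (u * (val w * g))%g.
    by rewrite !mulgA; congr (_ * _)%g; exact: centerP.
  exact: h.
- move=> g c cGa; rewrite /E; congr cmean; apply/funext => w.
  by rewrite mulgA (Fr (val w * g)%g).
- move=> z0 cz; pose z : center_zmod G := exist _ z0 (asboolT cz).
  exists (x z)^-1; first by rewrite cnormV (char_unit cx) invr1.
  move=> g; rewrite /E.
  have xn := unit_neq0 (char_unit cx z).
  have bFx : bddc (fun w : center_zmod G => F (val w * g)%g * x w) by auto.
  rewrite -(cmean_shift hM z bFx) -(cmeanZ hM); last exact: (bddc_shift z bFx).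
  congr cmean; apply/funext => w; rewrite (charD cx) val_centerD -mulgA.
  by field.
Qed.

Lemma coset_function_uniform_mean (F : G -> C) (tau g0 : G) : bddc F ->
  left_uc F -> right_invariant Gamma F ->
  exists c, uniform_mean (fun n => F (zexpg tau n * g0)%g) c.
Proof.
move=> bF Fu Fr.
pose act (z : center_zmod G) (g : G) := (val z * g)%g.
have actD z w g : act (z + w) g = act z (act w g) by rewrite /act val_centerD mulgA.
have act0 g : act 0 g = g by rewrite /act /= mul1g.
have [M hM appr] := eigenfunction_approximation actD act0 bF
    (center_orbit_coloring bF Fu Fr).
apply: uniform_mean_uniform_limit => e e0.
have [L [hL hF]] := appr e e0.
exists (fun n => \sum_(y <- L) y.1 * cmean M (fun w => F (act w
    (zexpg tau n * g0)%g) * y.2 w)) => //.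
elim: hL {hF} => [|y L' hy _ [c IH]].
  exists 0 => d d0; exists 0%N => m l _; rewrite mul0r subr0 /wsum big1 => [|k _];
      last by rewrite big_nil.
  by rewrite cnorm0 mulr_ge0 ?ler0n//; exact: ltW.
have [bE Eu Er Ee] := center_mean_properties hM hy bF Fu Fr.
have [c' hc'] := eigenfunction_uniform_mean tau g0 bE Eu Er Ee.
exists (y.1 * c' + c).
have -> : (fun n => \sum_(z <- y :: L') z.1 * cmean M (fun w => F (act w
    (zexpg tau n * g0)%g) * z.2 w)) =
  fun n => y.1 * cmean M (fun w => F (act w (zexpg tau n * g0)%g) * y.2 w) +
   \sum_(z <- L') z.1 * cmean M (fun w => F (act w (zexpg tau n * g0)%g) * z.2 w).
  by apply/funext => n; rewrite big_cons.
by apply: uniform_mean_add => //; exact: uniform_mean_scale.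
Qed.

End NilsequenceMeans.

Lemma two_step_nilpotent_commg (G : groupType) : two_step_nilpotent G ->
  forall x y : G, center [~ x, y]%g.
Proof. by move=> h x y; apply: h => H hH; exact: hH. Qed.

Section Averages.
Context {R : realType}.
Local Notation C := (Cplx R).

Lemma basic_uniform_mean (a : int -> C) : basic_two_step_nilseq a ->
  exists c, uniform_mean a c.
Proof.
move=> [G [Gamma [f [tau [x0 [[nil _ cG] cf ->]]]]]].
have [Fu bF] := continuous_left_uc cG cf.
have Fr : right_invariant Gamma (f \o (\pi_(coset_space Gamma) : G -> _)).
  by move=> x c cGa; rewrite /= pi_coset_mulr.
exact: (coset_function_uniform_mean cG (two_step_nilpotent_commg nil) tau
    (repr x0) bF Fu Fr).
Qed.

Lemma nilseq_average (a : int -> C) : two_step_nilseq a ->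
  exists Av : C, forall (m : nat -> int) (l : nat -> nat), l @ \oo --> \oo ->
    interval_avg a (m j) (l j) @[j --> \oo] --> Av.
Proof.
move=> /uniform_limitsP ha.
have [c hc] : exists c, uniform_mean a c.
  apply: uniform_mean_uniform_limit => e e0; have [b bb hb] := ha _ e0.
  by exists b => //; exact: basic_uniform_mean.
exists c => m l hl; apply/cvg_cnormP => e e0; have [L hL] := hc _ e0.
(* [L.+1] instead of [L] keeps [l j] positive for the division. *)
have hl2 : \forall j \near \oo, (L.+1 <= l j)%N := hl _ (nbhs_infty_ge L.+1).
apply: filterS hl2 => j lj.
have lp : 0 < ((l j)%:R : R) by rewrite ltr0n (leq_trans _ lj).
have lC : ((l j)%:R : R[i]) != 0 by rewrite pnatr_eq0 -lt0n (leq_trans _ lj).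
rewrite /= /interval_avg -/(wsum a (m j) (l j)).
have -> : wsum a (m j) (l j) / (l j)%:R - c = (wsum a (m j) (l j) - c * (l j)%:R) /
    (l j)%:R.
  by rewrite mulrBl mulfK.
rewrite cnormM cnormV cnorm_nat ler_pdivrMr//.
exact: (hL _ _ (leq_trans (leqnSn _) lj)).
Qed.

End Averages.

(** * Products of nilmanifolds *)

Section RowVectorCalculus.
Context {R : realType}.

Lemma cvg_rowP (T : Type) (F : set_system T) {FF : Filter F} n (f : T -> 'rV[R]_n)
    (l : 'rV[R]_n) :
  f @ F --> l <-> forall j, (fun t => f t 0 j) @ F --> l 0 j.
Proof.
split=> [h j|h A [P hP sA]].
  exact: (cvg_comp f (fun M : 'rV_n => M 0 j) h (@coord_continuous _ _ _ 0 j l)).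
have hF : F (fun t => forall j, P 0 j (f t 0 j)).
  by apply: filter_forall => j; apply: h; exact: hP.
change (F (f @^-1` A)); move: hF; apply: filterS => t ht.
by apply: sA => i j; rewrite (ord1 i); exact: ht.
Qed.

Lemma continuous_rowP (T : topologicalType) n (f : T -> 'rV[R]_n) (x : T) :
  {for x, continuous f} <-> forall j, {for x, continuous (fun t => f t 0 j)}.
Proof. exact: (@cvg_rowP T (nbhs x)). Qed.

Lemma cvg_row_mx (T : Type) (F : set_system T) (FF : Filter F) m n
    (f : T -> 'rV[R]_m) (g : T -> 'rV[R]_n) (a : 'rV[R]_m) (b : 'rV[R]_n) :
  f @ F --> a -> g @ F --> b -> (fun t => row_mx (f t) (g t)) @ F --> row_mx a b.
Proof.
move=> /cvg_rowP hf /cvg_rowP hg; apply/cvg_rowP => j.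
case: (split_ordP j) => k ->.
  by rewrite row_mxEl; under eq_fun do rewrite row_mxEl; exact: hf.
by rewrite row_mxEr; under eq_fun do rewrite row_mxEr; exact: hg.
Qed.

Lemma continuous_row_mx (T : topologicalType) m n (f : T -> 'rV[R]_m) (g :
    T -> 'rV[R]_n) x :
  {for x, continuous f} -> {for x, continuous g} ->
  {for x, continuous (fun t => row_mx (f t) (g t))}.
Proof. exact: (@cvg_row_mx T (nbhs x)). Qed.

Lemma lsubmx_continuous m n : continuous (@lsubmx R 1 m n).
Proof.
move=> x; apply/continuous_rowP => j.
have -> : (fun t : 'rV[R]_(m + n) => lsubmx t 0 j) = (fun t => t 0 (lshift n j)).
  by apply/funext => t; rewrite mxE.
exact: coord_continuous.
Qed.

Lemma rsubmx_continuous m n : continuous (@rsubmx R 1 m n).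
Proof.
move=> x; apply/continuous_rowP => j.
have -> : (fun t : 'rV[R]_(m + n) => rsubmx t 0 j) = (fun t => t 0 (rshift m j)).
  by apply/funext => t; rewrite mxE.
exact: coord_continuous.
Qed.

Lemma continuous_at_eq (S T : topologicalType) (f g : S -> T) x :
  (\near x, f x = g x) -> {for x, continuous f} -> {for x, continuous g}.
Proof.
move=> fg cf A; rewrite -(nbhs_singleton fg) => /cf hA.
by apply: filterS (filterI fg hA) => y /= [<-].
Qed.

Lemma Ck_on_sub m n k (U V : set 'rV[R]_m) (f : 'rV[R]_m -> 'rV[R]_n) :
  U `<=` V -> Ck_on k V f -> Ck_on k U f.
Proof.
move=> UV; elim: k f => [|k IH] f /=.
  by move=> [h _]; split=> // x; rewrite inE => Ux; apply: h; rewrite inE; exact: UV.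
move=> [h hd]; split.
  by move=> x; rewrite inE => Ux; apply: h; rewrite inE; exact: UV.
move=> v; have [h1 h2] := hd v; split; last exact: IH.
by move=> x; rewrite inE => Ux; apply: h1; rewrite inE; exact: UV.
Qed.

(** Since [U] is open, derivatives at its points depend on the values in [U] alone. *)
Lemma Ck_on_eq m n k (U : set 'rV[R]_m) (f g : 'rV[R]_m -> 'rV[R]_n) :
  open U -> (forall x, U x -> f x = g x) -> Ck_on k U f -> Ck_on k U g.
Proof.
move=> oU; elim: k f g => [|k IH] f g fg /= [h hd].
all: have near x : x \in U -> \near x, f x = g x
  by rewrite inE => Ux; apply: (filterS _ (open_nbhs_nbhs (conj oU Ux))) => y /fg.
all: have cg : {in U, continuous g}
  by move=> x xU; apply: (continuous_at_eq (near x xU)); exact: h.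
  by split.
split=> // v; have [h1 h2] := hd v; split.
  by move=> x xU; apply: (near_eq_derivable _ (h1 x xU)); exact: near.
apply: IH h2 => x Ux; apply: near_eq_derive; apply: near.
by rewrite inE.
Qed.

(** For a linear inner map, the chain rule is an equality of difference quotients before any limit
    is taken. *)
Lemma growth_rate_comp_linear m n p (L : 'rV[R]_m -> 'rV[R]_n) (lL : linear L)
    (f : 'rV[R]_n -> 'rV[R]_p) x v :
  (fun h : R => h^-1 *: (((f \o L) \o shift x) (h *: v) - (f \o L) x)) =
  (fun h => h^-1 *: ((f \o shift (L x)) (h *: L v) - f (L x))).
Proof. by apply/funext => h /=; rewrite lL. Qed.

Lemma derivable_comp_linear m n p (L : 'rV[R]_m -> 'rV[R]_n) (lL : linear L) (f :
    'rV[R]_n -> 'rV[R]_p)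
   x v : derivable f (L x) (L v) -> derivable (f \o L) x v.
Proof. by rewrite /derivable (growth_rate_comp_linear lL). Qed.

Lemma derive_comp_linear m n p (L : 'rV[R]_m -> 'rV[R]_n) (f :
    'rV[R]_n -> 'rV[R]_p) v : linear L ->
  'D_v (f \o L) = 'D_(L v) f \o L.
Proof. by move=> lL; apply/funext => x; rewrite /derive (growth_rate_comp_linear lL). Qed.

Lemma Ck_on_comp_linear m n p k (L : 'rV[R]_m -> 'rV[R]_n) (U : set 'rV[R]_n)
    (f : 'rV[R]_n -> 'rV[R]_p) : linear L -> continuous L ->
  Ck_on k U f -> Ck_on k (L @^-1` U) (f \o L).
Proof.
move=> lL cL; elim: k f => [|k IH] f /= [h hd].
all: have cf : {in L @^-1` U, continuous (f \o L)}
  by move=> x; rewrite inE => Ux; apply: continuous_comp; [exact: cL|apply: h; rewrite inE].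
  by split.
split=> // v; have [h1 h2] := hd (L v); split.
  by move=> x; rewrite inE => Ux; apply: (derivable_comp_linear lL); apply: h1; rewrite inE.
by rewrite (derive_comp_linear _ _ lL); exact: IH.
Qed.

Lemma derivable_row_mx m n p (f : 'rV[R]_m -> 'rV[R]_n) (g : 'rV[R]_m -> 'rV[R]_p) x v :
  derivable f x v -> derivable g x v ->
  derivable (fun y => row_mx (f y) (g y)) x v /\
  'D_v (fun y => row_mx (f y) (g y)) x = row_mx ('D_v f x) ('D_v g x).
Proof.
move=> df dg.
have E : (fun h : R => h^-1 *: (((fun y => row_mx (f y) (g y)) \o shift x)
    (h *: v) - row_mx (f x) (g x))) =
  (fun h => row_mx (h^-1 *: ((f \o shift x) (h *: v) - f x)) (h^-1 *:
      ((g \o shift x) (h *: v) - g x))).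
  by apply/funext => h /=; rewrite opp_row_mx add_row_mx scale_row_mx.
have FF : Filter (0^' : set_system R) by exact: _.
have c := cvg_row_mx FF df dg; rewrite -E in c.
split; first by apply/cvg_ex; exists (row_mx ('D_v f x) ('D_v g x)).
by apply: cvg_lim => //; exact: norm_hausdorff.
Qed.

Lemma Ck_on_row_mx m n p k (U : set 'rV[R]_m) (f : 'rV[R]_m -> 'rV[R]_n) (g :
    'rV[R]_m -> 'rV[R]_p) :
  open U -> Ck_on k U f -> Ck_on k U g -> Ck_on k U (fun y => row_mx (f y) (g y)).
Proof.
move=> oU; elim: k f g => [|k IH] f g /= [hf df] [hg dg].
all: have c : {in U, continuous (fun y => row_mx (f y) (g y))}
  by move=> x xU; apply: continuous_row_mx; [exact: hf|exact: hg].
  by split.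
split=> // v; have [f1 f2] := df v; have [g1 g2] := dg v; split.
  by move=> x xU; have [] := derivable_row_mx (f1 x xU) (g1 x xU).
apply: (Ck_on_eq oU _ (IH _ _ f2 g2)) => x Ux.
have xU : x \in U by rewrite inE.
by have [_ ->] := derivable_row_mx (f1 x xU) (g1 x xU).
Qed.

Lemma smooth_on_row_mx m1 m2 m n p (L1 : 'rV[R]_m -> 'rV[R]_m1)
    (L2 : 'rV[R]_m -> 'rV[R]_m2)
    (U1 : set 'rV[R]_m1) (U2 : set 'rV[R]_m2) (U : set 'rV[R]_m)
    (f : 'rV[R]_m1 -> 'rV[R]_n) (g : 'rV[R]_m2 -> 'rV[R]_p) (h :
        'rV[R]_m -> 'rV[R]_(n + p)) :
  linear L1 -> linear L2 -> continuous L1 -> continuous L2 -> open U1 -> open U2 ->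
  U `<=` L1 @^-1` U1 `&` L2 @^-1` U2 ->
  smooth_on U1 f -> smooth_on U2 g ->
  (forall z, h z = row_mx (f (L1 z)) (g (L2 z))) -> smooth_on U h.
Proof.
move=> l1 l2 c1 c2 o1 o2 sU sf sg hE k.
have -> : h = (fun z => row_mx ((f \o L1) z) ((g \o L2) z)) by apply/funext.
apply: (Ck_on_sub sU); apply: Ck_on_row_mx.
- apply: openI.
    by apply: open_comp => // x _; exact: c1.
  by apply: open_comp => // x _; exact: c2.
- by apply: (Ck_on_sub (@subIsetl _ _ _)); exact: Ck_on_comp_linear.
- by apply: (Ck_on_sub (@subIsetr _ _ _)); exact: Ck_on_comp_linear.
Qed.

End RowVectorCalculus.

Section ProductTopology.
Context {S T : topologicalType}.

Lemma fst_continuous : continuous (@fst S T).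
Proof. by move=> [x y]; exact: cvg_fst. Qed.

Lemma snd_continuous : continuous (@snd S T).
Proof. by move=> [x y]; exact: cvg_snd. Qed.

Lemma open_setX (A : set S) (B : set T) : open A -> open B -> open (A `*` B).
Proof.
move=> oA oB; have -> : A `*` B = fst @^-1` A `&` snd @^-1` B by [].
by apply: openI; apply: open_comp => // x _;
  [exact: fst_continuous|exact: snd_continuous].
Qed.

Lemma hausdorff_prod : hausdorff_space S -> hausdorff_space T ->
  hausdorff_space (S * T)%type.
Proof.
rewrite !open_hausdorff => hS hT [x1 x2] [y1 y2] xy.
have [E|n1] := eqVneq x1 y1.
  have n2 : x2 != y2 by apply: contra xy => /eqP ->; rewrite E.
  have [[A B] /= [hA hB] [oA oB /eqP AB]] := hT _ _ n2.
  exists (snd @^-1` A, snd @^-1` B); rewrite /= ?inE/=.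
    by rewrite !inE in hA hB.
  split; try by apply: open_comp => // ? _; exact: snd_continuous.
  by rewrite -preimage_setI AB preimage_set0.
have [[A B] /= [hA hB] [oA oB /eqP AB]] := hS _ _ n1.
exists (fst @^-1` A, fst @^-1` B); rewrite /= ?inE/=.
  by rewrite !inE in hA hB.
split; try by apply: open_comp => // ? _; exact: fst_continuous.
by rewrite -preimage_setI AB preimage_set0.
Qed.

Lemma second_countable_prod : @second_countable S -> @second_countable T ->
  @second_countable (S * T)%type.
Proof.
move=> [A cA [oA bA]] [B cB [oB bB]].
exists [set p.1 `*` p.2 | p in A `*` B].
  by apply: (card_le_trans (card_image_le _ _)); exact: countableX.
split=> [_ [[U V] /= [hU hV] <-]|[x y] W [[U V] /= [hU hV] sW]].
  by apply: open_setX; [exact: oA|exact: oB].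
have [U' [AU' U'x] sU] := bA x _ hU; have [V' [BV' V'y] sV] := bB y _ hV.
exists (U' `*` V').
  by split=> //; exists (U', V').
by move=> [u v] [/= /sU hu /sV hv]; exact: sW.
Qed.

End ProductTopology.

Section ProductCharts.
Context {R : realType}.

Lemma chart_img_prod (S T : Type) m n (c : chart R S m) (d : chart R T n) :
  chart_img (prod_chart c d) =
  @lsubmx R 1 m n @^-1` chart_img c `&` @rsubmx R 1 m n @^-1` chart_img d.
Proof.
apply/seteqP; split=> [_ [[x y] [/= hx hy] <-]|z [/= [x hx ex] [y hy ey]]].
  by rewrite /= row_mxKl row_mxKr; split; [exists x|exists y].
by exists (x, y) => //=; rewrite ex ey hsubmxK.
Qed.

Lemma is_chart_prod (S T : topologicalType) m n (c : chart R S m) (d : chart R T n) :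
  is_chart c -> is_chart d -> is_chart (prod_chart c d).
Proof.
move=> [c1 c2 c3 c4 c5] [d1 d2 d3 d4 d5]; split.
- exact: open_setX.
- rewrite chart_img_prod; apply: openI; apply: open_comp => // x _.
    exact: lsubmx_continuous.
  exact: rsubmx_continuous.
- move=> [x y]; rewrite inE => -[/= hx hy].
  by rewrite row_mxKl row_mxKr c3 ?inE// d3 ?inE.
- move=> [x y]; rewrite inE => -[/= hx hy]; apply: cvg_row_mx.
    apply: (@continuous_comp _ _ _ fst (chart_map c)); first exact: fst_continuous.
    by apply: c4; rewrite inE.
  apply: (@continuous_comp _ _ _ snd (chart_map d)); first exact: snd_continuous.
  by apply: d4; rewrite inE.
- move=> z; rewrite inE chart_img_prod => -[/= hx hy].
  have h1 : {for z, continuous (chart_inv c \o @lsubmx R 1 m n)}.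
    by apply: continuous_comp; [exact: lsubmx_continuous|apply: c5; rewrite inE].
  have h2 : {for z, continuous (chart_inv d \o @rsubmx R 1 m n)}.
    by apply: continuous_comp; [exact: rsubmx_continuous|apply: d5; rewrite inE].
  exact: (cvg_pair h1 h2).
Qed.

Lemma open_in_chart (S T : topologicalType) m (c : chart R S m) (f : S -> T) (V : set T) :
  is_chart c -> continuous f -> open V ->
  open (chart_img c `&` (f \o chart_inv c) @^-1` V).
Proof.
move=> [_ oc _ _ ci] cf oV; rewrite openE => z [/= hz Vz].
apply: filterI; first by apply: open_nbhs_nbhs.
have hc : {for z, continuous (f \o chart_inv c)}.
  by apply: continuous_comp; [apply: ci; rewrite inE|exact: cf].
by apply: (hc V); exact: open_nbhs_nbhs.
Qed.

(** Covers the identity, the inverse and the product on [G1 * G2] alike: [q1] and [q2] split the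
    argument, and [L1] and [L2] are the same splitting in coordinates. *)
Lemma smooth_in_charts_pair (S S1 S2 T1 T2 : topologicalType) m m1 m2 n1 n2
    (c : chart R S m) (c1 : chart R S1 m1) (c2 : chart R S2 m2)
    (d1 : chart R T1 n1) (d2 : chart R T2 n2)
    (q1 : S -> S1) (q2 : S -> S2) (L1 : 'rV[R]_m -> 'rV[R]_m1) (L2 : 'rV[R]_m -> 'rV[R]_m2)
    (f1 : S1 -> T1) (f2 : S2 -> T2) :
  linear L1 -> linear L2 -> continuous L1 -> continuous L2 ->
  (forall z, q1 (chart_inv c z) = chart_inv c1 (L1 z)) ->
  (forall z, q2 (chart_inv c z) = chart_inv c2 (L2 z)) ->
  chart_img c `<=` L1 @^-1` chart_img c1 -> chart_img c `<=` L2 @^-1` chart_img c2 ->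
  is_chart c1 -> is_chart c2 -> open (chart_dom d1) -> open (chart_dom d2) ->
  continuous f1 -> continuous f2 ->
  smooth_in_charts c1 d1 f1 -> smooth_in_charts c2 d2 f2 ->
  smooth_in_charts c (prod_chart d1 d2) (fun p => (f1 (q1 p), f2 (q2 p))).
Proof.
move=> l1 l2 cL1 cL2 e1 e2 i1 i2 hc1 hc2 od1 od2 cf1 cf2 s1 s2.
apply: (smooth_on_row_mx l1 l2 cL1 cL2 (open_in_chart hc1 cf1 od1)
    (open_in_chart hc2 cf2 od2) _ s1 s2).
  move=> z [/= hz [/=]]; rewrite e1 e2 => h1 h2.
  by split; split=> //=; [exact: i1|exact: i2].
by move=> z; rewrite /= e1 e2.
Qed.

Lemma is_chart_open (T : topologicalType) n (c : chart R T n) : is_chart c -> open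
    (chart_dom c).
Proof. by case. Qed.

End ProductCharts.

Section ProductGroup.
Variables G1 G2 : groupType.
Local Notation G := (G1 * G2)%type.

Definition pair_one : G := (1%g, 1%g).
Definition pair_inv (x : G) : G := (x.1^-1, x.2^-1)%g.
Definition pair_mul (x y : G) : G := (x.1 * y.1, x.2 * y.2)%g.

Lemma pair_mulA : associative pair_mul.
Proof. by move=> x y z; rewrite /pair_mul/= !mulgA. Qed.
Lemma pair_mul1 : left_id pair_one pair_mul.
Proof. by move=> [x y]; rewrite /pair_mul/= !mul1g. Qed.
Lemma pair_1mul : right_id pair_one pair_mul.
Proof. by move=> [x y]; rewrite /pair_mul/= !mulg1. Qed.
Lemma pair_mulV : left_inverse pair_one pair_inv pair_mul.
Proof. by move=> [x y]; rewrite /pair_mul/= !mulVg. Qed.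
Lemma pair_Vmul : right_inverse pair_one pair_inv pair_mul.
Proof. by move=> [x y]; rewrite /pair_mul/= !mulgV. Qed.

HB.instance Definition _ :=
  isGroup.Build G pair_mulA pair_mul1 pair_1mul pair_mulV pair_Vmul.

End ProductGroup.

Section ProductLieGroup.
Context {R : realType}.
Variables G1 G2 : lieGroupType R.
Local Notation G := (G1 * G2)%type.
Local Notation A := (prod_atlas (@lie_atlas R G1) (@lie_atlas R G2)).

Let is_chart1 c : @lie_atlas R G1 c -> is_chart c.
Proof. by have [h _ _] := @lie_smooth_atlas R G1; exact: h. Qed.

Let is_chart2 c : @lie_atlas R G2 c -> is_chart c.
Proof. by have [h _ _] := @lie_smooth_atlas R G2; exact: h. Qed.

Lemma prod_smooth_atlas : smooth_atlas A.
Proof.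
have [_ b1 s1] := @lie_smooth_atlas R G1; have [_ b2 s2] := @lie_smooth_atlas R G2.
split.
- move=> _ [[c d] [/= hc hd] <-].
  by apply: is_chart_prod; [exact: is_chart1|exact: is_chart2].
- apply/seteqP; split=> // -[x y] _.
  have [c hc cx] : (\bigcup_(c in @lie_atlas R G1) chart_dom c) x by rewrite b1.
  have [d hd dy] : (\bigcup_(c in @lie_atlas R G2) chart_dom c) y by rewrite b2.
  by exists (prod_chart c d) => //; exists (c, d).
- move=> _ _ [[c1 c2] [/= hc1 hc2] <-] [[d1 d2] [/= hd1 hd2] <-].
  have -> : id = (fun p : G => (id p.1, id p.2)) by apply/funext; case.
  have i : chart_img (prod_chart c1 c2) = _ := chart_img_prod c1 c2.
  apply: (@smooth_in_charts_pair R G G1 G2 G1 G2 _ _ _ _ _ _ c1 c2 d1 d2 fst snd lsubmx rsubmx id id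
    (linearP _) (linearP _) (@lsubmx_continuous _ _ _) (@rsubmx_continuous _ _ _)) => //.
  + by rewrite i; exact: subIsetl.
  + by rewrite i; exact: subIsetr.
  + exact: is_chart1.
  + exact: is_chart2.
  + exact/is_chart_open/is_chart1.
  + exact/is_chart_open/is_chart2.
  + by move=> x; exact: cvg_id.
  + by move=> x; exact: cvg_id.
  + exact: s1.
  + exact: s2.
Qed.

Lemma prod_inv_smooth : smooth_map A A (fun x : G => (x^-1)%g).
Proof.
have [k1 s1] := @lie_inv_smooth R G1; have [k2 s2] := @lie_inv_smooth R G2.
split.
  move=> x; apply: cvg_pair.
    by apply: (@continuous_comp _ _ _ fst); [exact: fst_continuous|exact: k1].
  by apply: (@continuous_comp _ _ _ snd); [exact: snd_continuous|exact: k2].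
move=> _ _ [[c1 c2] [/= hc1 hc2] <-] [[d1 d2] [/= hd1 hd2] <-].
have i : chart_img (prod_chart c1 c2) = _ := chart_img_prod c1 c2.
apply: (@smooth_in_charts_pair R G G1 G2 G1 G2 _ _ _ _ _ _ c1 c2 d1 d2 fst snd lsubmx rsubmx
   (fun x => x^-1)%g (fun x => x^-1)%g
    (linearP _) (linearP _) (@lsubmx_continuous _ _ _) (@rsubmx_continuous _ _ _)) => //.
+ by rewrite i; exact: subIsetl.
+ by rewrite i; exact: subIsetr.
+ exact: is_chart1.
+ exact: is_chart2.
+ exact/is_chart_open/is_chart1.
+ exact/is_chart_open/is_chart2.
+ exact: s1.
+ exact: s2.
Qed.

Lemma prod_mul_smooth : smooth_map (prod_atlas A A) A (fun p : G * G => (p.1 * p.2)%g).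
Proof.
have [k1 s1] := @lie_mul_smooth R G1; have [k2 s2] := @lie_mul_smooth R G2.
pose q1 (p : G * G) : G1 * G1 := (p.1.1, p.2.1).
pose q2 (p : G * G) : G2 * G2 := (p.1.2, p.2.2).
have cq1 : continuous q1.
  move=> p; apply: cvg_pair; apply: (@continuous_comp _ _ _ _ fst).
  - exact: fst_continuous.
  - exact: fst_continuous.
  - exact: snd_continuous.
  - exact: fst_continuous.
have cq2 : continuous q2.
  move=> p; apply: cvg_pair; apply: (@continuous_comp _ _ _ _ snd).
  - exact: fst_continuous.
  - exact: snd_continuous.
  - exact: snd_continuous.
  - exact: snd_continuous.
split.
  move=> p; apply: cvg_pair.
    by apply: (@continuous_comp _ _ _ q1 (fun p => p.1 * p.2)%g); [exact: cq1|exact: k1].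
  by apply: (@continuous_comp _ _ _ q2 (fun p => p.1 * p.2)%g); [exact: cq2|exact: k2].
move=> _ _ [[_ _] [/= [[c1 c2] [/= hc1 hc2] <-] [[e1 e2] [/= he1 he2] <-]] <-] [[d1 d2] [/= hd1 hd2] <-].
(* Coordinates on [G * G] come in the order G1, G2, G1, G2; [L1] and [L2] collect the two blocks of
   each factor. *)
pose L1 (z : 'rV[R]_((@lie_dim R G1 + @lie_dim R G2) + (@lie_dim R G1 + @lie_dim R G2))) :=
  row_mx (lsubmx (lsubmx z)) (lsubmx (rsubmx z)).
pose L2 (z : 'rV[R]_((@lie_dim R G1 + @lie_dim R G2) + (@lie_dim R G1 + @lie_dim R G2))) :=
  row_mx (rsubmx (lsubmx z)) (rsubmx (rsubmx z)).
have l1 : linear L1 by move=> a u v; rewrite /L1 !linearP scale_row_mx add_row_mx.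
have l2 : linear L2 by move=> a u v; rewrite /L2 !linearP scale_row_mx add_row_mx.
have cl1 : continuous L1.
  move=> z; exact: (continuous_row_mx
    (continuous_comp (@lsubmx_continuous R _ _ z) (@lsubmx_continuous R _ _ _))
    (continuous_comp (@rsubmx_continuous R _ _ z) (@lsubmx_continuous R _ _ _))).
have cl2 : continuous L2.
  move=> z; exact: (continuous_row_mx
    (continuous_comp (@lsubmx_continuous R _ _ z) (@rsubmx_continuous R _ _ _))
    (continuous_comp (@rsubmx_continuous R _ _ z) (@rsubmx_continuous R _ _ _))).
have a1 : prod_atlas (@lie_atlas R G1) (@lie_atlas R G1)
    (prod_chart c1 e1) by exists (c1, e1).
have a2 : prod_atlas (@lie_atlas R G2) (@lie_atlas R G2)
    (prod_chart c2 e2) by exists (c2, e2).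
apply: (@smooth_in_charts_pair R (G * G)%type (G1 * G1)%type
    (G2 * G2)%type G1 G2 _ _ _ _ _ _
  (prod_chart c1 e1) (prod_chart c2 e2) d1 d2 q1 q2 L1 L2
   (fun p => p.1 * p.2)%g (fun p => p.1 * p.2)%g l1 l2 cl1 cl2) => //.
+ by move=> z; rewrite /q1/L1/= row_mxKl row_mxKr.
+ by move=> z; rewrite /q2/L2/= row_mxKl row_mxKr.
+ rewrite !chart_img_prod => z [[h1 h2] [h3 h4]]; rewrite /preimage/L1/= in h1 h2 h3 h4 *.
  by rewrite row_mxKl row_mxKr.
+ rewrite !chart_img_prod => z [[h1 h2] [h3 h4]]; rewrite /preimage/L2/= in h1 h2 h3 h4 *.
  by rewrite row_mxKl row_mxKr.
+ by apply: is_chart_prod; exact: is_chart1.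
+ by apply: is_chart_prod; exact: is_chart2.
+ exact/is_chart_open/is_chart1.
+ exact/is_chart_open/is_chart2.
+ exact: s1.
+ exact: s2.
Qed.

HB.instance Definition _ := isLieGroup.Build R G
  (hausdorff_prod (@lie_hausdorff R G1) (@lie_hausdorff R G2))
  (second_countable_prod (@lie_second_countable R G1) (@lie_second_countable R G2))
  prod_smooth_atlas prod_mul_smooth prod_inv_smooth.

End ProductLieGroup.

Definition center_pred (G : groupType) : {pred G} := [pred z | `[< center z >]].

Section CenterSubgroup.
Variable G : groupType.

Lemma center_predE (x : G) : (x \in @center_pred G) = `[< center x >].
Proof. by []. Qed.

Lemma center_pred_mul : mulg_closed (@center_pred G).
Proof.
move=> x y; rewrite !center_predE => /asboolP cx /asboolP cy.
by apply/asboolP; exact: centerM.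
Qed.

Lemma center_pred1 : 1%g \in @center_pred G.
Proof. by rewrite center_predE; apply/asboolP; exact: center1. Qed.

Lemma center_pred_inv : invg_closed (@center_pred G).
Proof.
by move=> x; rewrite !center_predE => /asboolP cx; apply/asboolP; exact: centerV.
Qed.

HB.instance Definition _ := isMulClosed.Build G (@center_pred G) center_pred_mul.
HB.instance Definition _ := isMul1Closed.Build G (@center_pred G) center_pred1.
HB.instance Definition _ := isInvClosed.Build G (@center_pred G) center_pred_inv.

(** The centre is one of the subgroups whose intersection is the commutator subgroup. *)
Lemma commg_two_step_nilpotent : (forall x y : G, center [~ x, y]%g) ->
  two_step_nilpotent G.
Proof.
move=> h z hz; have := hz (GroupClosed.clone G (@center_pred G) _) => /(_ _)/asboolP; apply.
by move=> x y; rewrite center_predE; apply/asboolP.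
Qed.

End CenterSubgroup.

Definition prod_pred (G1 G2 : groupType) (A1 : {pred G1}) (A2 : {pred G2}) :
  {pred (G1 * G2)%type} := [pred p | (p.1 \in A1) && (p.2 \in A2)].

Section ProductSubgroup.
Variables (G1 G2 : groupType) (A1 : groupClosed G1) (A2 : groupClosed G2).

Lemma prod_predE p : (p \in prod_pred A1 A2) = (p.1 \in A1) && (p.2 \in A2).
Proof. by []. Qed.

Lemma prod_pred_mul : mulg_closed (prod_pred A1 A2).
Proof.
move=> x y; rewrite !prod_predE => /andP[x1 x2] /andP[y1 y2].
by rewrite !gpredM.
Qed.

Lemma prod_pred1 : 1%g \in prod_pred A1 A2.
Proof. by rewrite prod_predE !gpred1. Qed.

Lemma prod_pred_inv : invg_closed (prod_pred A1 A2).
Proof. by move=> x; rewrite !prod_predE => /andP[x1 x2]; rewrite !gpredV x1 x2. Qed.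

HB.instance Definition _ := isMulClosed.Build _ (prod_pred A1 A2) prod_pred_mul.
HB.instance Definition _ := isMul1Closed.Build _ (prod_pred A1 A2) prod_pred1.
HB.instance Definition _ := isInvClosed.Build _ (prod_pred A1 A2) prod_pred_inv.

Definition prod_subgroup : groupClosed (G1 * G2)%type :=
  GroupClosed.clone _ (prod_pred A1 A2) _.

Lemma zexpg_pair (x1 : G1) (x2 : G2) (n : int) :
  zexpg ((x1, x2) : (G1 * G2)%type) n = (zexpg x1 n, zexpg x2 n).
Proof.
have E k : (((x1, x2) : (G1 * G2)%type) ^+ k)%g = ((x1 ^+ k)%g, (x2 ^+ k)%g).
  by elim: k => [|k IH]; rewrite ?expgS ?IH// !expg0.
by case: n => n; rewrite /zexpg E.
Qed.

Lemma prod_two_step_nilpotent : two_step_nilpotent G1 -> two_step_nilpotent G2 ->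
  two_step_nilpotent (G1 * G2)%type.
Proof.
move=> /two_step_nilpotent_commg n1 /two_step_nilpotent_commg n2.
apply: commg_two_step_nilpotent => -[x1 x2] [y1 y2] [z1 z2].
have h1 := n1 x1 y1 z1; have h2 := n2 x2 y2 z2.
by apply: (congr2 pair).
Qed.

End ProductSubgroup.

Section ProductNilmanifold.
Context {R : realType} {G1 G2 : lieGroupType R}.
Variables (Gamma1 : groupClosed G1) (Gamma2 : groupClosed G2).
Local Notation G := (G1 * G2)%type.
Local Notation Gamma := (prod_subgroup Gamma1 Gamma2).
Local Notation X1 := (coset_space Gamma1).
Local Notation X2 := (coset_space Gamma2).
Local Notation X := (@coset_space R G Gamma).

Lemma prod_discrete : discrete_subgroup Gamma1 -> discrete_subgroup Gamma2 ->
  @discrete_subgroup R G Gamma.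
Proof.
move=> d1 d2 [x1 x2] /andP[/= x1G x2G].
have [_ [V1 n1 e1]] := d1 x1 x1G; have [_ [V2 n2 e2]] := d2 x2 x2G.
split; first by rewrite inE; apply/andP.
exists (V1 `*` V2); first by exists (V1, V2).
apply/seteqP; split=> [[y1 y2] [[/= v1 v2] /andP[/= g1 g2]]|_ ->] /=.
  have -> : y1 = x1 by have : [set x1] y1 by rewrite -e1.
  by have -> : y2 = x2 by have : [set x2] y2 by rewrite -e2.
split; last by apply/andP.
by split; exact: nbhs_singleton.
Qed.

Definition prod_coset (x : X1 * X2) : X := \pi_X (repr x.1, repr x.2).

Lemma prod_cosetE (g1 : G1) (g2 : G2) :
  prod_coset (\pi_X1 g1, \pi_X2 g2) = \pi_X (g1, g2).
Proof.
apply/(@pi_coset_eq R G Gamma); apply/andP; split=> /=.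
  by apply/pi_coset_eq; rewrite pi_repr.
by apply/pi_coset_eq; rewrite pi_repr.
Qed.

(** Openness of the two coset projections supplies the neighbourhoods: a product of open quotient
    maps is a quotient map. *)
Lemma prod_coset_continuous : continuous prod_coset.
Proof.
move=> [x1 x2] W hW.
have [[U1 U2] [/= h1 h2] sU] := @pi_continuous G {eq_quot (coset_equiv Gamma)}
    (repr x1, repr x2) W hW.
exists ((\pi_X1 : G1 -> X1) @` U1, (\pi_X2 : G2 -> X2) @` U2).
  split=> /=; [rewrite -[x1]pi_repr|rewrite -[x2]pi_repr]; exact: pi_nbhs.
move=> [_ _] [/= [u1 U1u <-] [u2 U2u <-]].
by rewrite /preimage/= prod_cosetE; apply: (sU (u1, u2)).
Qed.

Lemma prod_cocompact : cocompact Gamma1 -> cocompact Gamma2 -> @cocompact R G Gamma.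
Proof.
move=> c1 c2; rewrite /cocompact.
have -> : [set: X] = prod_coset @` ([set: X1] `*` [set: X2]).
  apply/seteqP; split=> // x _; rewrite -[x]pi_repr.
  exists (\pi_X1 (repr x).1, \pi_X2 (repr x).2) => //.
  by rewrite prod_cosetE -surjective_pairing.
apply: continuous_compact; last exact: compact_setX.
by apply: continuous_subspaceT; exact: prod_coset_continuous.
Qed.

Lemma prod_two_step_nilmanifold : two_step_nilmanifold Gamma1 ->
  two_step_nilmanifold Gamma2 -> @two_step_nilmanifold R G Gamma.
Proof.
move=> [a1 b1 c1] [a2 b2 c2]; split.
- exact: prod_two_step_nilpotent.
- exact: prod_discrete.
- exact: prod_cocompact.
Qed.

End ProductNilmanifold.

(** * Operations on basic nilsequences *)

Section BasicAlgebra.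
Context {R : realType}.
Local Notation C := (Cplx R).

Lemma basic_nilseq_op (op : C -> C -> C) :
  (forall (T : topologicalType) (f g : T -> C), continuous f -> continuous g ->
     continuous (fun t => op (f t) (g t))) ->
  forall a b : int -> C, basic_two_step_nilseq a -> basic_two_step_nilseq b ->
  basic_two_step_nilseq (fun n => op (a n) (b n)).
Proof.
move=> cop a b [G1 [Gamma1 [f1 [tau1 [x1 [nil1 cf1 ->]]]]]].
move=> [G2 [Gamma2 [f2 [tau2 [x2 [nil2 cf2 ->]]]]]].
pose G : lieGroupType R := (G1 * G2)%type.
pose Gamma : groupClosed G := prod_subgroup Gamma1 Gamma2.
pose X := coset_space Gamma; pose X1 := coset_space Gamma1; pose X2 := coset_space Gamma2.
pose f (x : X) : C := op (f1 (\pi_X1 (repr x).1)) (f2 (\pi_X2 (repr x).2)).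
have fE (g : G) : f (\pi_X g) = op (f1 (\pi_X1 g.1)) (f2 (\pi_X2 g.2)).
  have /(@pi_coset_eq R G Gamma)/andP[/= h1 h2] := pi_repr (\pi_X g : X).
  rewrite /f; congr (op (f1 _) (f2 _)); exact/pi_coset_eq.
exists G, Gamma, f, ((tau1, tau2) : G), (\pi_X ((repr x1, repr x2) : G)); split.
- exact: prod_two_step_nilmanifold.
- apply: (continuous_on_coset_space fE); apply: cop.
    move=> g; apply: (@continuous_comp _ _ _ fst (fun g => f1 (\pi_X1 g))).
      exact: fst_continuous.
    apply: (@continuous_comp _ _ _ (\pi_X1 : G1 -> X1) f1); [exact: pi_continuous|
        exact: cf1].
  move=> g; apply: (@continuous_comp _ _ _ snd (fun g => f2 (\pi_X2 g))).
    exact: snd_continuous.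
  apply: (@continuous_comp _ _ _ (\pi_X2 : G2 -> X2) f2); [exact: pi_continuous|exact: cf2].
- by apply/funext => n; rewrite translate_pi fE zexpg_pair.
Qed.

Lemma basic_nilseq_map (op : C -> C) : continuous op ->
  forall a : int -> C, basic_two_step_nilseq a -> basic_two_step_nilseq (op \o a).
Proof.
move=> cop a [G [Gamma [f [tau [x0 [nil cf ->]]]]]].
exists G, Gamma, (op \o f), tau, x0; split; [exact: nil| |by []].
by move=> x; apply: continuous_comp; [exact: cf|exact: cop].
Qed.

Lemma basic_nilseq_shift (a : int -> C) : basic_two_step_nilseq a ->
  basic_two_step_nilseq (shift_seq a).
Proof.
move=> [G [Gamma [f [tau [x0 [nil cf ->]]]]]].
exists G, Gamma, f, tau, (translate tau x0); split=> //.
apply/funext => n; rewrite /shift_seq; congr f.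
by rewrite /(translate tau x0) translate_pi mulgA -zexpgS.
Qed.

Lemma basic_nilseq_bounded (a : int -> C) : basic_two_step_nilseq a ->
  exists B : R, forall n, cnorm (a n) <= B.
Proof.
move=> [G [Gamma [f [tau [x0 [[_ _ cG] cf ->]]]]]].
have [_ [B hB]] := continuous_left_uc cG cf.
by exists B => n; have := hB (zexpg tau n * repr x0)%g.
Qed.

End BasicAlgebra.

(** * Exponentials on the line modulo the integers *)

Section SmoothLinear.
Context {R : realType}.

Lemma Ck_on_cst m n (U : set 'rV[R]_m) (a : 'rV[R]_n) k :
  Ck_on k U (fun=> a).
Proof.
elim: k a => [|k IH] a; split=> //=; try by move=> x _; exact: cst_continuous.
move=> v; split; first by move=> x _; exact: derivable_cst.
have -> : 'D_v (fun=> a) = (fun=> 0) :> ('rV[R]_m -> 'rV[R]_n); last exact: IH.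
by apply/funext => x; exact: derive_cst.
Qed.

Lemma derive_linear m n (L : 'rV[R]_m -> 'rV[R]_n) x v : linear L ->
  derivable L x v /\ 'D_v L x = L v.
Proof.
move=> lL.
have c : h^-1 *: ((L \o shift x) (h *: v) - L x) @[h --> (0 : R)^'] --> L v.
  apply: cvg_near_cst; near=> h.
  have h0 : h != 0 by near: h; exact: nbhs_dnbhs_neq.
  by rewrite /= lL addrK scalerA mulVf// scale1r.
split; first by apply/cvg_ex; exists (L v).
by apply: cvg_lim => //; exact: norm_hausdorff.
Unshelve. all: by end_near.
Qed.

Lemma smooth_on_linear m n (L : 'rV[R]_m -> 'rV[R]_n) (U : set 'rV[R]_m) :
  linear L -> continuous L -> smooth_on U L.
Proof.
move=> lL cL [|k]; split=> //; try by move=> x _; exact: cL.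
move=> v; split; first by move=> x _; have [] := derive_linear x v lL.
have -> : 'D_v L = (fun=> L v); last exact: Ck_on_cst.
by apply/funext => x; have [_] := derive_linear x v lL.
Qed.

End SmoothLinear.

(** A copy of [R] on which addition is the group law written multiplicatively, kept apart from the
    ring structure. *)
Definition real_line (R : realType) : Type := R.

Section RealLine.
Context {R : realType}.
Local Notation L := (real_line R).

HB.instance Definition _ := Topological.copy L R.

HB.instance Definition _ := isGroup.Build L
  (@addrA R) (@add0r R) (@addr0 R) (@addNr R) (@addrN R).

Lemma line_mulE (x y : L) : (x * y)%g = (x : R) + y.
Proof. by []. Qed.

Lemma line_invE (x : L) : (x^-1)%g = - (x : R).
Proof. by []. Qed.

Definition line_chart : chart R L 1 :=
  Chart setT (fun x : L => const_mx (x : R)) (fun z => z 0 0 : L).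

Lemma line_chart_img : chart_img line_chart = setT.
Proof.
apply/seteqP; split=> // z _; exists (z 0 0) => //.
by apply/rowP => j; rewrite mxE (ord1 j).
Qed.

Lemma const_mx_continuous : continuous (fun x : R => const_mx x : 'rV[R]_1).
Proof.
move=> x; apply/continuous_rowP => j.
have -> : (fun t : R => (const_mx t : 'rV[R]_1) 0 j) = id.
  by apply/funext => t; rewrite mxE.
exact: cvg_id.
Qed.

Lemma line_is_chart : is_chart line_chart.
Proof.
split.
- exact: openT.
- by rewrite line_chart_img; exact: openT.
- by move=> x _; rewrite /= mxE.
- by move=> x _; exact: const_mx_continuous.
- by move=> z _; exact: coord_continuous.
Qed.

Lemma line_smooth_atlas : smooth_atlas [set line_chart].
Proof.
split.
- by move=> _ ->; exact: line_is_chart.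
- by apply/seteqP; split=> // x _; exists line_chart.
- move=> _ _ -> ->; apply: smooth_on_linear.
    by move=> a u v; apply/rowP => j; rewrite !mxE/= !mxE.
  move=> z; apply: (@continuous_comp _ _ _ (fun z : 'rV[R]_1 => z 0 0) (fun x : R =>
      const_mx x)).
    exact: coord_continuous.
  exact: const_mx_continuous.
Qed.

Lemma line_mul_smooth : smooth_map (prod_atlas [set line_chart] [set line_chart])
  [set line_chart] (fun p : L * L => (p.1 * p.2)%g).
Proof.
split; first by move=> p; exact: (@add_continuous R p).
move=> _ _ [[_ _] [-> ->] <-] ->.
apply: smooth_on_linear.
  by move=> a u v; apply/rowP => j; rewrite !mxE/= !line_mulE !mxE mulrDr addrACA.
move=> z; apply: (@continuous_comp _ _ _
  (fun z : 'rV[R]_(1 + 1) => lsubmx z 0 0 + rsubmx z 0 0) (fun x : R => const_mx x)).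
  exact: (cvgD
    (continuous_comp (@lsubmx_continuous R 1 1 z) (@coord_continuous _ _ _ 0 0 _))
    (continuous_comp (@rsubmx_continuous R 1 1 z) (@coord_continuous _ _ _ 0 0 _))).
exact: const_mx_continuous.
Qed.

Lemma line_inv_smooth : smooth_map [set line_chart] [set line_chart] (fun x : L =>
    (x^-1)%g).
Proof.
split; first by move=> x; exact: (@opp_continuous R x).
move=> _ _ -> ->; apply: smooth_on_linear.
  by move=> a u v; apply/rowP => j; rewrite !mxE/= !line_invE !mxE opprD mulrN.
move=> z; apply: (@continuous_comp _ _ _ (fun z : 'rV[R]_1 => - z 0 0) (fun x : R =>
    const_mx x)).
  exact: (cvgN (@coord_continuous _ _ _ 0 0 z)).
exact: const_mx_continuous.
Qed.

Lemma line_hausdorff : hausdorff_space L.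
Proof. exact: Rhausdorff. Qed.

Lemma line_second_countable : @second_countable L.
Proof.
pose I (p : rat * rat) : set R := `]ratr p.1, ratr p.2[%classic.
exists [set I p | p in [set: rat * rat]].
  by apply: (card_le_trans (card_image_le _ _)); exact: countableP.
split=> [_ [p _ <-]|x A].
  exact: (@itv_open _ R (ratr p.1) (ratr p.2)).
move=> /nbhs_ballP[e /= e0 sA].
have /rat_in_itvoo[a] : (x : R) - e < x by rewrite ltrBlDr ltrDl.
have /rat_in_itvoo[b] : (x : R) < x + e by rewrite ltrDl.
rewrite !in_itv/= => /andP[b1 b2] /andP[a1 a2].
exists (I (a, b)).
  by split; [exists (a, b)|rewrite /I/= in_itv/= a2 b1].
move=> y; rewrite /I/= in_itv/= => /andP[y1 y2]; apply: sA.
rewrite /= -ball_normE/= ltr_distlC; lra.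
Qed.

HB.instance Definition _ := isLieGroup.Build R L line_hausdorff line_second_countable
  line_smooth_atlas line_mul_smooth line_inv_smooth.

End RealLine.

Section Exponentials.
Context {R : realType}.
Local Notation L := (real_line R).
Local Notation C := (Cplx R).

Definition line_int : {pred L} := [pred x : R | x \is a Num.int].

Lemma line_int_mul : mulg_closed line_int.
Proof. move=> x y /intrP[m hm] /intrP[n hn]; apply/intrP; exists (m + n).
by rewrite rmorphD/= -hm -hn. Qed.

Lemma line_int1 : 1%g \in line_int.
Proof. by apply/intrP; exists 0. Qed.

Lemma line_int_inv : invg_closed line_int.
Proof. move=> x /intrP[m hm]; apply/intrP; exists (- m).
by rewrite rmorphN/= -hm. Qed.

HB.instance Definition _ := isMulClosed.Build _ line_int line_int_mul.
HB.instance Definition _ := isMul1Closed.Build _ line_int line_int1.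
HB.instance Definition _ := isInvClosed.Build _ line_int line_int_inv.

Local Notation Z := (GroupClosed.clone L line_int _).
Local Notation X := (@coset_space R L Z).

Lemma line_two_step_nilmanifold : @two_step_nilmanifold R L Z.
Proof.
split.
- apply: commg_two_step_nilpotent => x y z.
  by rewrite /commute; exact: (@addrC R).
- move=> x hx; split; first by rewrite inE.
  exists (ball (x : R) 1); first exact: nbhsx_ballx.
  apply/seteqP; split=> [y [hy yZ]|_ ->] /=; last by split=> //; exact: ballxx.
  move: hy; rewrite -ball_normE/=.
  move: hx yZ => /intrP[m ->] /intrP[n ->].
  by rewrite -rmorphB -intr_norm (_ : 1 = 1%:~R)// ltr_int => h; congr (_%:~R); lia.
- rewrite /cocompact.
  have -> : [set: X] = (\pi_X : L -> X) @` `[(0 : R), 1].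
    apply/seteqP; split=> // x _; rewrite -[x]pi_repr.
    set r : R := repr x.
    exists (r - (Num.floor r)%:~R).
      rewrite /= in_itv/=; have := floor_le_tmp r; have := floorD1_gt r; lra.
    apply/(@pi_coset_eq R L Z); apply/intrP; exists (Num.floor r).
    by rewrite line_mulE line_invE; lra.
  apply: continuous_compact; last exact: segment_compact.
  by apply: continuous_subspaceT; exact: pi_continuous.
Qed.

Definition circle_exp (x : R) : C := (cos (2 * pi * x) +i* sin (2 * pi * x))%C.

Lemma circle_exp_continuous : continuous circle_exp.
Proof.
apply/continuous_cnormP => x e e0; have e2 : 0 < e / 2 by lra.
have cm : continuous (fun x : R => 2 * pi * x) by exact: mulrl_continuous.
have cc : {for x, continuous (fun x : R => cos (2 * pi * x))}.
  by apply: (@continuous_comp _ _ _ (fun x : R => 2 * pi * x)); [exact: cm|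
      exact: continuous_cos].
have cs : {for x, continuous (fun x : R => sin (2 * pi * x))}.
  by apply: (@continuous_comp _ _ _ (fun x : R => 2 * pi * x)); [exact: cm|
      exact: continuous_sin].
have /cvgrPdist_le/(_ _ e2) h1 := cc; have /cvgrPdist_le/(_ _ e2) h2 := cs.
apply: filterS (filterI h1 h2) => y /= [y1 y2].
apply: (le_trans (cnorm_ReIm (circle_exp y - circle_exp x)));
    rewrite /circle_exp/= distrC [X in _ + X]distrC.
lra.
Qed.

Lemma circle_expD1 (x : R) : circle_exp (x + 1) = circle_exp x.
Proof.
rewrite /circle_exp mulrDr mulr1 (_ : 2 * pi = pi *+ 2); last by rewrite mulr_natl.
by rewrite cosD2pi sinD2pi.
Qed.

Lemma circle_expDint (x : R) (n : int) : circle_exp (x + n%:~R) = circle_exp x.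
Proof.
elim/int_ind: n => [|n IH|n IH]; first by rewrite addr0.
  by rewrite -addn1 PoszD rmorphD/= addrA circle_expD1.
by rewrite -[LHS]circle_expD1 -IH; congr circle_exp;
    rewrite -addn1 PoszD opprD rmorphD/= rmorphN/=; lra.
Qed.

Lemma expseq_basic (t : R) : basic_two_step_nilseq (expseq t : int -> C).
Proof.
pose f (x : X) : C := circle_exp (repr x).
have fE (g : L) : f (\pi_X g) = circle_exp g.
  have /(@pi_coset_eq R L Z)/intrP[n hn] := pi_repr (\pi_X g : X).
  move: hn; rewrite line_mulE line_invE -/(f _) => hn.
  rewrite /f -(circle_expDint _ n) -hn; congr circle_exp; exact: addNKr.
exists L, Z, f, t, (\pi_X (0 : L)); split.
- exact: line_two_step_nilmanifold.
- by apply: (continuous_on_coset_space fE); exact: circle_exp_continuous.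
- apply/funext => n; rewrite translate_pi fE.
  rewrite /expseq /circle_exp.
  have -> : (zexpg (t : L) n * (0 : L))%g = n%:~R * t; last by [].
  rewrite (_ : (_ * _)%g = zexpg (t : L) n); last exact: (@addr0 R).
  elim/int_ind: n => [|n IH|n IH]; first by rewrite mul0r.
    rewrite -addn1 PoszD zexpgS rmorphD/= mulrDl mul1r -IH //.
  by rewrite -addn1 PoszD opprD zexpgB rmorphB/= mulrBl mul1r -IH.
Qed.

End Exponentials.

(** * The algebra of nilsequences *)

Section Algebra.
Context {R : realType}.
Local Notation C := (Cplx R).
Implicit Types a b : int -> C.

Lemma basic_nilseqW a : basic_two_step_nilseq a -> two_step_nilseq a.
Proof.
move=> h; apply/uniform_limitsP => e e0; exists a => // n.
by rewrite subrr cnorm0; exact: ltW.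
Qed.

Lemma nilseq_uniform_limits : uniform_limits (@two_step_nilseq R) `<=` @two_step_nilseq R.
Proof.
move=> a /uniform_limitsP h; apply/uniform_limitsP => e e0.
have e2 : 0 < e / 2 by lra.
have [b /uniform_limitsP hb ab] := h _ e2.
have [c hc bc] := hb _ e2; exists c => // n.
apply: (le_trans (cnorm_tri (b n) _ _)); have := ab n; have := bc n; lra.
Qed.

Lemma nilseq_bounded a : two_step_nilseq a -> exists2 B : R, 0 < B & forall n, cnorm
    (a n) <= B.
Proof.
move=> /uniform_limitsP/(_ 1 ltr01)[b /basic_nilseq_bounded[B hB] ab].
exists (`|B| + 1) => [|n]; first by have := normr_ge0 B; lra.
have := cnormD (a n - b n) (b n); rewrite subrK => h; apply: (le_trans h).
have := ab n; have := hB n; have := ler_norm B; lra.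
Qed.

Lemma nilseq_linfty : @two_step_nilseq R `<=` @linfty R.
Proof.
move=> a /nilseq_bounded[B B0 hB]; exists (B%:C%C : C); split.
  by rewrite realE lecR ltW.
move=> x Bx n _ /=; rewrite cnormE; apply: le_trans (ltW Bx).
by rewrite lecR.
Qed.

(** Continuity of [op] settles basic nilsequences; the Lipschitz bound carries the approximation
    through [op]. *)
Lemma nilseq_lipschitz (op : C -> C) (K : R) : 0 < K ->
  (forall x y, cnorm (op x - op y) <= K * cnorm (x - y)) ->
  forall a, two_step_nilseq a -> two_step_nilseq (op \o a).
Proof.
move=> K0 opK a /uniform_limitsP ha; apply/uniform_limitsP => e e0.
have eK : 0 < e / K by exact: divr_gt0.
have [b hb ab] := ha _ eK; exists (op \o b).
  apply: basic_nilseq_map hb; apply/continuous_cnormP => x d d0.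
  have dK : 0 < d / K by exact: divr_gt0.
  have /continuous_cnormP/(_ x _ dK) : continuous (@id C) by move=> y; exact: cvg_id.
  apply: filterS => y /= hy; apply: (le_trans (opK _ _)).
  by rewrite mulrC -ler_pdivlMr.
by move=> n; apply: (le_trans (opK _ _)); rewrite mulrC -ler_pdivlMr.
Qed.

Lemma nilseq_conj a : two_step_nilseq a -> two_step_nilseq (conj_seq a).
Proof.
apply: (@nilseq_lipschitz (fun x => Num.conj x) 1) => // x y.
have -> : Num.conj x - Num.conj y = conjc (x - y) by rewrite -[LHS]rmorphB.
by rewrite cnorm_conj mul1r.
Qed.

Lemma nilseq_shift a : two_step_nilseq a -> two_step_nilseq (shift_seq a).
Proof.
move=> /uniform_limitsP ha; apply/uniform_limitsP => e e0.
have [b hb ab] := ha _ e0; exists (shift_seq b); first exact: basic_nilseq_shift.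
by move=> n; exact: ab.
Qed.

Lemma nilseq_add a b : two_step_nilseq a -> two_step_nilseq b ->
  two_step_nilseq (fun n => a n + b n).
Proof.
move=> /uniform_limitsP ha /uniform_limitsP hb; apply/uniform_limitsP => e e0.
have e2 : 0 < e / 2 by lra.
have [a' na aa] := ha _ e2; have [b' nb bb] := hb _ e2.
exists (fun n => a' n + b' n).
  apply: (@basic_nilseq_op R (fun x y => x + y) _ a' b' na nb).
  by move=> T f g cf cg x; exact: (cvgD (cf x) (cg x)).
move=> n; rewrite opprD addrACA; apply: (le_trans (cnormD _ _)).
have := aa n; have := bb n; lra.
Qed.

Lemma nilseq_mul a b : two_step_nilseq a -> two_step_nilseq b ->
  two_step_nilseq (fun n => a n * b n).
Proof.
move=> na nb; have [A A0 hA] := nilseq_bounded na; have [B B0 hB] := nilseq_bounded nb.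
move: na nb => /uniform_limitsP na /uniform_limitsP nb.
apply/uniform_limitsP => e e0.
(* The bound 1 keeps [b'] below [B + 1], which then fixes the accuracy asked of [a']. *)
have [b' nb' bb] : exists2 b', basic_two_step_nilseq b' &
    forall n, cnorm (b n - b' n) <= Num.min 1 (e / 2 / A).
  by apply: nb; rewrite lt_min ltr01/= divr_gt0//; lra.
have [a' na' aa] := na (e / 2 / (B + 1)) (ltac:(rewrite divr_gt0//; lra)).
exists (fun n => a' n * b' n).
  apply: (@basic_nilseq_op R (fun x y => x * y) _ a' b' na' nb').
  by move=> T f g cf cg x; exact: (cvgM (cf x) (cg x)).
move=> n; have := bb n; rewrite le_min => /andP[b1 b2].
have hb' : cnorm (b' n) <= B + 1.
  have := cnormB (b n) (b n - b' n); rewrite subKr; have := hB n; lra.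
have -> : a n * b n - a' n * b' n = a n * (b n - b' n) + (a n - a' n) * b' n by ring.
apply: (le_trans (cnormD _ _)); rewrite !cnormM.
have h1 : cnorm (a n) * cnorm (b n - b' n) <= e / 2.
  apply: (le_trans (ler_pM (cnorm_ge0 _) (cnorm_ge0 _) (hA n) b2)).
  by rewrite mulrC divfK// gt_eqF.
have h2 : cnorm (a n - a' n) * cnorm (b' n) <= e / 2.
  apply: (le_trans (ler_pM (cnorm_ge0 _) (cnorm_ge0 _) (aa n) hb')).
  by rewrite divfK// gt_eqF//; lra.
lra.
Qed.

Lemma nilseq_scale (c : C) a : two_step_nilseq a -> two_step_nilseq (fun n => c * a n).
Proof.
apply: (@nilseq_lipschitz (fun x => c * x) (cnorm c + 1)).
  by have := cnorm_ge0 c; lra.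
by move=> x y; rewrite -mulrBr cnormM ler_wpM2r ?cnorm_ge0// lerDl.
Qed.

Lemma nilseq_trig_poly : @trig_poly R `<=` @two_step_nilseq R.
Proof.
move=> _ [m [c [t ->]]]; elim/big_ind: _.
- have := nilseq_scale 0 (basic_nilseqW (expseq_basic (0 : R))).
  by congr two_step_nilseq; apply/funext => n; rewrite mul0r.
- by move=> a b; exact: nilseq_add.
- by move=> j _; apply: nilseq_scale; exact/basic_nilseqW/expseq_basic.
Qed.

Lemma almost_periodic_nilseq : @almost_periodic R `<=` @two_step_nilseq R.
Proof.
move=> a /uniform_limitsP h; apply/nilseq_uniform_limits/uniform_limitsP => e e0.
by have [b /nilseq_trig_poly hb ab] := h _ e0; exists b.
Qed.

Lemma nilseq_subalgebra : subalgebra_of (@two_step_nilseq R) (@linfty R).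
Proof.
split.
- exact: nilseq_linfty.
- have := basic_nilseqW (expseq_basic (0 : R)).
  by congr two_step_nilseq; apply/funext => n; rewrite /expseq !mulr0 cos0 sin0.
- by move=> c a b ha hb; apply: nilseq_add hb; exact: nilseq_scale.
- by move=> a b; exact: nilseq_mul.
Qed.

End Algebra.

Theorem proposition2 (R : realType) :
  [/\ subalgebra_of (@two_step_nilseq R) (@linfty R),
      @almost_periodic R `<=` @two_step_nilseq R,
      forall a : int -> Cplx R, two_step_nilseq a -> two_step_nilseq (conj_seq a),
      forall a : int -> Cplx R, two_step_nilseq a -> two_step_nilseq (shift_seq a) &
      uniform_limits (@two_step_nilseq R) `<=` @two_step_nilseq R]
  /\
  (forall a : int -> Cplx R, two_step_nilseq a ->
     exists Av : Cplx R,
       forall (m : nat -> int) (l : nat -> nat),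
         l @ \oo --> \oo ->
         interval_avg a (m j) (l j) @[j --> \oo] --> Av).
Proof.
split; last exact: nilseq_average.
split.
- exact: nilseq_subalgebra.
- exact: almost_periodic_nilseq.
- exact: nilseq_conj.
- exact: nilseq_shift.
- exact: nilseq_uniform_limits.
Qed.
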